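(* For an integer $t\ge 1$ let $M_t$ be the cycle matroid of the generalized theta graph consisting of two vertices joined by four internally disjoint paths of lengths $(1,t,t,t)$, and write $h_k^\beta=h_k^\beta(M_t)$. For $t\ge 6$, \[ (h_0^\beta,h_1^\beta,h_2^\beta,h_3^\beta) =\left(1,\ 3t+1,\ \frac{9t^2+9t-6}{2},\ \frac{9t^3+21t^2-28t}{2}\right). \] Consequently, \[ (h_2^\beta)^2-h_1^\beta h_3^\beta=\frac{27t^4+18t^3+99t^2-52t+36}{4}>0. \] For $t=26$ the first four coefficients are $(1,79,3156,85826)$ and $(h_2^\beta)^2-h_1^\beta h_3^\beta=3180082$.
   Context: Let $M$ be a simple matroid of rank $r$ on a finite ground set $E$, and let $L=L(M)$ be its lattice of flats, a geometric lattice with rank function $\mathrm{rk}$, bottom $\hat 0$, top $\hat 1$, and atom set $A$ (identified with $E$). $L_k$ is the set of flats of rank $k$. $\mathbb R[L]$ is the real vector space with basis $(e_x)_{x\in L}$. For an atom $a$, the linear operator $L_a$ on $\mathbb R[L]$ is $L_ae_x=e_{x\vee a}$ if $a\not\le x$, and $L_ae_x=0$ if $a\le x$. For $x\in L_k$, $\beta_x$ is the number of ordered atom bases of $x$, i.e. of tuples $(a_1,\dots,a_k)\in A^k$ with $a_1\vee\dots\vee a_k=x$ (so $\beta_{\hat 0}=1$). Put $v_k=\sum_{x\in L_k}\beta_xe_x$; in particular $v_r=\beta_{\hat 1}e_{\hat 1}$. Equip $\mathbb R[L]$ with the inner product $\langle e_x,e_y\rangle_\beta=\delta_{x,y}/\beta_x$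 and let $L_a^\beta$ be the adjoint of $L_a$ for it. Put $U^\beta=\sum_{a\in A}L_a^\beta$, $Ke_x=\mathrm{rk}(x)e_x$, $s(x)=|A|-|\{a\in A:a\le x\}|$, and $S^{-1}e_x=s(x)^{-1}e_x$ for $x<\hat 1$, $S^{-1}e_{\hat 1}=0$. Define $D_\beta=S^{-1}U^\beta K$. Define $\mathcal C_0^\beta(M)=\mathbb R v_r$ and $\mathcal C_{k+1}^\beta(M)=D_\beta\mathcal C_k^\beta(M)+\sum_{a\in A}L_a^\beta\mathcal C_k^\beta(M)$; put $h_k^\beta(M)=\dim\mathcal C_k^\beta(M)$. *)

(* Defs.v *)
From HB Require Import structures.
From mathcomp Require Import all_boot all_order all_algebra.
From mathcomp Require Import boolp zify.

Set Implicit Arguments.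
Unset Strict Implicit.
Unset Printing Implicit Defensive.

Import Order.TTheory GRing.Theory Num.Theory.

Record matroid (E : finType) := Matroid {
  indep : {set E} -> bool;
  indep_set0 : indep set0;
  indep_sub : forall I J : {set E}, J \subset I -> indep I -> indep J;
  indep_aug : forall I J : {set E}, indep I -> indep J -> #|I| < #|J| ->
    exists2 e, e \in J :\: I & indep (e |: I)
}.

Section Rank.
Variables (E : finType) (M : matroid E).
Implicit Types (X Y I J : {set E}) (e : E).

Definition mrank X := \max_(I : {set E} | indep M I && (I \subset X)) #|I|.

Definition mclosure X := [set e | mrank (e |: X) == mrank X].

Definition is_flat X := mclosure X == X.

Lemma mrank_indep I X : indep M I -> I \subset X -> #|I| <= mrank X.
Proof. by move=> indI sIX; apply: (@leq_bigmax_cond _ _ _ I); rewrite indI. Qed.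

Lemma mrank_basis X :
  exists I : {set E}, [/\ indep M I, I \subset X & #|I| = mrank X].
Proof.
have P0 : indep M set0 && (set0 \subset X) by rewrite indep_set0 sub0set.
rewrite /mrank (bigop.bigmax_eq_arg set0) ?P0 //.
by case: arg_maxnP => // I /andP[indI sIX] _; exists I.
Qed.

Lemma mrankS X Y : X \subset Y -> mrank X <= mrank Y.
Proof.
move=> sXY; have [I [indI sIX <-]] := mrank_basis X.
exact: mrank_indep indI (subset_trans sIX sXY).
Qed.

Lemma basis_extend I X : indep M I -> I \subset X ->
  exists J : {set E}, [/\ indep M J, I \subset J, J \subset X & #|J| = mrank X].
Proof.
move=> indI sIX; have [n leXn] := ubnP (mrank X - #|I|).
elim: n I indI sIX leXn => // n IHn I indI sIX leXn.
have := mrank_indep indI sIX; rewrite leq_eqVlt => /orP[/eqP eqI | ltI].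
  by exists I.
have [K [indK sKX cK]] := mrank_basis X.
have [|e] := indep_aug indI indK; first by rewrite cK.
rewrite inE => /andP[neI eK] indeI.
have [||J [indJ sJ sJX cJ]] := IHn (e |: I) indeI.
- by rewrite subUset sub1set (subsetP sKX).
- by rewrite cardsU1 neI add1n; move: leXn ltI; clear; lia.
by exists J; split=> //; apply: subset_trans sJ; apply: subsetUr.
Qed.

Lemma subset_mclosure X : X \subset mclosure X.
Proof. by apply/subsetP=> e eX; rewrite inE (setUidPr _) ?sub1set. Qed.

Lemma mclosureS X Y : X \subset Y -> mclosure X \subset mclosure Y.
Proof.
move=> sXY; apply/subsetP=> e; rewrite !inE => /eqP eX.
rewrite eqn_leq [X in _ && X]mrankS ?subsetUr // andbT leqNgt; apply/negP=> ltY.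
have [I [indI sIX cI]] := mrank_basis X.
have [J [indJ sIJ sJY cJ]] := basis_extend indI (subset_trans sIX sXY).
have [K [indK sKY cK]] := mrank_basis (e |: Y).
have [|f] := indep_aug indJ indK; first by rewrite cJ cK.
rewrite inE => /andP[nfJ fK] indfJ.
have [fY | nfY] := boolP (f \in Y).
  have : #|f |: J| <= mrank Y.
    by apply: mrank_indep => //; rewrite subUset sub1set fY.
  by rewrite cardsU1 nfJ add1n cJ ltnn.
have/eqP fe : f == e by move/(subsetP sKY): fK; rewrite !inE (negPf nfY) orbF.
rewrite {}fe in nfJ indfJ {nfY fK}.
have indeI : indep M (e |: I) by apply: indep_sub indfJ; apply: setUS.
have : #|e |: I| <= mrank (e |: X) by apply: mrank_indep => //; apply: setUS.
by rewrite cardsU1 (contra (subsetP sIJ e) nfJ) add1n cI eX ltnn.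
Qed.

Lemma mrank_closure X : mrank (mclosure X) = mrank X.
Proof.
apply/eqP; rewrite eqn_leq [X in _ && X]mrankS ?subset_mclosure // andbT leqNgt.
apply/negP=> lt_r; have [I [indI sIX cI]] := mrank_basis X.
have [J [indJ sJX cJ]] := mrank_basis (mclosure X).
have [|e] := indep_aug indI indJ; first by rewrite cI cJ.
rewrite inE => /andP[neI /(subsetP sJX)]; rewrite inE => /eqP eX indeI.
have : #|e |: I| <= mrank (e |: X) by apply: mrank_indep => //; apply: setUS.
by rewrite cardsU1 neI add1n cI eX ltnn.
Qed.

Lemma mclosure_flat X : is_flat (mclosure X).
Proof.
rewrite /is_flat eqEsubset subset_mclosure andbT.
apply/subsetP=> e; rewrite !inE mrank_closure => /eqP eX.
by rewrite eqn_leq [X in _ && X]mrankS ?subsetUr // andbT -eX mrankS // setUS ?subset_mclosure.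
Qed.

Lemma mclosure_le X F : is_flat F -> (mclosure X \subset F) = (X \subset F).
Proof.
move=> /eqP fF; apply/idP/idP => [|sXF].
  exact: subset_trans (subset_mclosure X).
by rewrite -fF mclosureS.
Qed.

Lemma flatI F G : is_flat F -> is_flat G -> is_flat (F :&: G).
Proof.
move=> fF fG; rewrite /is_flat eqEsubset subset_mclosure andbT subsetI.
by rewrite !mclosure_le ?subsetIl ?subsetIr.
Qed.

Lemma flatT : is_flat setT.
Proof. by rewrite /is_flat eqEsubset subsetT subset_mclosure. Qed.

End Rank.

Record flat (E : finType) (M : matroid E) :=
  Flat { flat_set :> {set E}; flat_setP : is_flat M flat_set }.

Section FlatLattice.
Variables (E : finType) (M : matroid E).

HB.instance Definition _ := [isSub for @flat_set E M].
HB.instance Definition _ := [Finite of flat M by <:].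

Implicit Types x y z : flat M.

Definition flat_le x y := flat_set x \subset flat_set y.

Fact flat_le_refl : reflexive flat_le.
Proof. by move=> x; apply: subxx. Qed.

Fact flat_le_anti : antisymmetric flat_le.
Proof. by move=> x y; rewrite /flat_le -eqEsubset => /eqP/val_inj. Qed.

Fact flat_le_trans : transitive flat_le.
Proof. by move=> y x z; apply: subset_trans. Qed.

Fact flat_display : Order.disp_t. Proof. exact: Order.Disp tt tt. Qed.

HB.instance Definition _ := Order.Le_isPOrder.Build flat_display (flat M)
  flat_le_refl flat_le_anti flat_le_trans.

Definition cl (X : {set E}) : flat M := Flat (mclosure_flat M X).

Definition flat_meet x y : flat M := Flat (flatI (flat_setP x) (flat_setP y)).
Definition flat_join x y : flat M := cl (x :|: y).

Fact flat_meetP x y z : (x <= flat_meet y z)%O = (x <= y)%O && (x <= z)%O.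
Proof. exact: subsetI. Qed.

Fact flat_joinP x y z : (flat_join x y <= z)%O = (x <= z)%O && (y <= z)%O.
Proof.
by rewrite -[LHS]/(mclosure M _ \subset _) mclosure_le ?flat_setP // subUset.
Qed.

HB.instance Definition _ :=
  Order.POrder_MeetJoin_isLattice.Build flat_display (flat M)
    flat_meetP flat_joinP.

Definition flat_bot : flat M := cl set0.
Definition flat_top : flat M := Flat (flatT M).

Fact flat_le0 x : (flat_bot <= x)%O.
Proof.
by rewrite -[(_ <= _)%O]/(mclosure M _ \subset _) mclosure_le ?flat_setP // sub0set.
Qed.

Fact flat_le1 x : (x <= flat_top)%O.
Proof. exact: subsetT. Qed.

HB.instance Definition _ :=
  Order.hasBottom.Build flat_display (flat M) flat_le0.
HB.instance Definition _ :=
  Order.hasTop.Build flat_display (flat M) flat_le1.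

Lemma leEflat x y : (x <= y)%O = (flat_set x \subset flat_set y). Proof. by []. Qed.

Lemma cl_le X x : (cl X <= x)%O = (X \subset x).
Proof. exact: mclosure_le (flat_setP x). Qed.

(* The rank of [x] in the matroid, which is also its height in the lattice *)
Definition rk x : nat := mrank M x.

(* In a simple matroid these are the singletons of the ground set *)
Definition atoms : {set flat M} := [set a | rk a == 1].

Definition atom_bases x : {set (rk x).-tuple (flat M)} :=
  [set a : (rk x).-tuple (flat M) |
    all (fun y => y \in atoms) a && (\join_(y <- a) y == x)%O].

Definition beta x : nat := #|atom_bases x|.

Definition nmiss x : nat := #|atoms| - #|[set a in atoms | (a <= x)%O]|.

Lemma rk_le_eq x y : (x <= y)%O -> rk y <= rk x -> x = y.
Proof.
rewrite leEflat => sxy le_r; apply: val_inj; apply/eqP=> /=.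
rewrite eqEsubset sxy -(eqP (flat_setP x)); apply/subsetP=> e ey.
rewrite inE eqn_leq [X in _ && X]mrankS ?subsetUr // andbT.
by apply: leq_trans le_r; apply: mrankS; rewrite subUset sub1set ey.
Qed.

Lemma beta_gt0 x : 0 < beta x.
Proof.
have [I [indI sIx cI]] := mrank_basis M x.
pose b := [seq cl [set e] | e <- enum I].
have sz_b : size b == rk x by rewrite size_map -cardE cI.
apply/card_gt0P; exists (Tuple sz_b); rewrite inE; apply/andP; split.
  apply/allP=> _ /mapP[e eI ->]; rewrite mem_enum in eI.
  rewrite inE /rk /= mrank_closure.
  have ind1 : indep M [set e] by apply: indep_sub indI; rewrite sub1set.
  rewrite eqn_leq -{2}(cards1 e) (mrank_indep ind1) // andbT.
  have [J [_ sJ <-]] := mrank_basis M [set e].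
  by rewrite -(cards1 e) subset_leq_card.
apply/eqP/rk_le_eq.
  apply/joinsP_seq=> _ /mapP[e eI ->] _; rewrite mem_enum in eI.
  by rewrite cl_le sub1set (subsetP sIx).
rewrite {1}/rk -[X in X <= _]cI; apply: mrank_indep => //; apply/subsetP=> e eI.
rewrite -sub1set -cl_le; apply: (@joins_sup_seq _ _ _ _ xpredT id) => //.
by apply/map_f; rewrite mem_enum.
Qed.

End FlatLattice.

Record mgraph := MGraph {
  vertex : finType;
  edge : finType;
  ends : edge -> vertex * vertex
}.

Section CycleMatroid.
Variable G : mgraph.
Implicit Types (e f : edge G) (x y z : vertex G) (F I J : {set edge G}).
Implicit Type c : seq (vertex G * edge G).

Definition links e x y := (ends e == (x, y)) || (ends e == (y, x)).

(* A closed walk x_1 e_1 x_2 e_2 ... x_k e_k (x_1) is encoded as the sequence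
   of pairs (x_i, e_i); loops (k = 1) and pairs of parallel edges (k = 2) are
   cycles *)
Definition step (p q : vertex G * edge G) := links p.2 p.1 q.1.

Definition is_cycle c :=
  [&& c != [::], uniq (unzip1 c), uniq (unzip2 c) & cycle step c].

Definition acyclic F : bool :=
  `[< forall c, is_cycle c -> ~~ all (fun e => e \in F) (unzip2 c) >].

Lemma linksC e x y : links e x y = links e y x.
Proof. by rewrite /links orbC. Qed.

Lemma links_ends e : links e (ends e).1 (ends e).2.
Proof. by rewrite /links; case: (ends e) => x y; rewrite eqxx. Qed.

Lemma acyclic0 : acyclic set0.
Proof. by apply/asboolP => -[//|p c] _ /=; rewrite inE. Qed.

Lemma acyclic_sub I J : J \subset I -> acyclic I -> acyclic J.
Proof.
move=> sJI /asboolP acI; apply/asboolP=> c /acI; apply: contra.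
by apply: sub_all => e; apply: (subsetP sJI).
Qed.

Let adj F : rel (vertex G) := fun x y => [exists f in F, links f x y].

Let connC F x y : connect (adj F) x y = connect (adj F) y x.
Proof.
apply: sym_connect_sym => {}x {}y; apply: eq_existsb => f.
by rewrite linksC.
Qed.

Let step_connect F p c :
  path step p c -> all (fun e => e \in F) (belast p.2 (unzip2 c)) ->
  connect (adj F) p.1 (last p c).1.
Proof.
elim: c p => [|q c IHc] p /=; first by rewrite connect0.
case/andP=> pq /IHc{}IHc /andP[pF /IHc]; apply: connect_trans.
by apply: connect1; apply/existsP; exists p.2; rewrite pF.
Qed.

Let acyclic_add I e : acyclic I ->
  ~~ connect (adj I) (ends e).1 (ends e).2 -> acyclic (e |: I).
Proof.
move=> /asboolP acI nconn; apply/asboolP=> c cyc_c; apply/negP=> sc.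
have nconnl x y : links e x y -> ~~ connect (adj I) y x.
  move: nconn; rewrite /links; case: (ends e) => a b /=; rewrite !xpair_eqE.
  by move=> nc /orP[] /andP[/eqP<- /eqP<-]; rewrite // connC.
have [ec | nec] := boolP (e \in unzip2 c); last first.
  move/acI/negP: cyc_c; apply; apply/allP=> f fc.
  have := allP sc f fc; rewrite !inE => /predU1P[fe|//].
  by rewrite -fe fc in nec.
have [i [c' [v def_c]]] : exists i t v, rot i c = (v, e) :: t.
  case/mapP: ec => -[v f] vc /= ->; case/rot_to: vc => i t def_c.
  by exists i, t, v.
case/and4P: cyc_c => _ _ U cyc.
rewrite -(rot_cycle i) def_c in cyc.
have{}U : uniq (unzip2 (rot i c)) by rewrite /unzip2 map_rot rot_uniq.
have{}sc : all (fun f => f \in e |: I) (unzip2 (rot i c)).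
  by apply/allP=> f; rewrite /unzip2 map_rot mem_rot => /(allP sc).
rewrite def_c /= in U sc; case/andP: U => ne _; case/andP: sc => _ sc.
case: c' def_c cyc ne sc => [|q t] _ /=.
  by rewrite andbT => /nconnl; rewrite connect0.
case/andP=> /nconnl ncq pth ne sc; case/negP: ncq.
have -> : v = (last q (rcons t (v, e))).1 by rewrite last_rcons.
apply: step_connect pth _; rewrite /unzip2 map_rcons belast_rcons.
apply/allP=> f ft; have : f \in e |: I := allP (sc : all _ (q.2 :: unzip2 t)) f ft.
rewrite in_setU1 => /predU1P[fe|//].
by rewrite -fe ft in ne.
Qed.

Let simple_path F x p : path (adj F) x p -> uniq (x :: p) ->
  exists c, [/\ unzip1 c = belast x p, uniq (unzip2 c),
    all (fun f => f \in F) (unzip2 c),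
    (forall f y z, f \in unzip2 c -> links f y z ->
      (y \in x :: p) && (z \in x :: p)) &
    forall e, sorted step (rcons c (last x p, e))].
Proof.
elim: p x => [|y p IHp] x /=; first by exists [::].
case/andP=> /existsP[f /andP[fF fxy]] pth /andP[nx U].
have [c [c1 Uc cF cV cs]] := IHp y pth U.
exists ((x, f) :: c); split=> /=.
- by rewrite c1.
- rewrite Uc andbT; apply/negP=> /cV/(_ fxy)/andP[xp _].
  by rewrite xp in nx.
- by rewrite fF.
- move=> g a b; rewrite inE => /predU1P[->|/cV gc /gc/andP[ap bp]]; last first.
    by rewrite in_cons ap orbT in_cons bp orbT.
  move: fxy; rewrite /links => /orP[] /eqP->; rewrite !xpair_eqE.
    by move=> /orP[] /andP[/eqP<- /eqP<-]; rewrite !inE !eqxx ?orbT.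
  by move=> /orP[] /andP[/eqP<- /eqP<-]; rewrite !inE !eqxx ?orbT.
move=> e; have := cs e; case: {cV cF Uc cs} c c1 => [|q c] /=.
  case: p {IHp pth U nx} => //= _ _; rewrite andbT; exact: fxy.
case: p {IHp pth U nx} => //= z p [c1 _] ->; rewrite andbT /step /= c1.
exact: fxy.
Qed.

Let acyclic_bridge F e : acyclic F -> e \in F ->
  ~~ connect (adj (F :\ e)) (ends e).1 (ends e).2.
Proof.
move=> /asboolP acF eF; rewrite connC; apply/negP=> /connectP[p pth lst].
move: lst; case/shortenP: pth => {}p pth U _ lst.
have [c [c1 Uc cF _ /(_ e) cs]] := simple_path pth U.
rewrite -lst in cs.
suff /acF/negP : is_cycle (rcons c ((ends e).1, e)).
  apply; rewrite /unzip2 map_rcons all_rcons eF; apply: sub_all cF => f.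
  by rewrite !inE => /andP[].
apply/and4P; split.
- by case: (c).
- by rewrite /unzip1 map_rcons -/(unzip1 c) c1 lst -lastI.
- rewrite /unzip2 map_rcons rcons_uniq Uc andbT; apply/negP=> /(allP cF).
  by rewrite !inE eqxx.
case: c c1 cs {Uc cF} => [|q c] /= c1.
  case: p lst c1 {pth U} => //= lst _ _.
  by rewrite andbT /step /= {2}lst links_ends.
move=> cs; rewrite rcons_path cs last_rcons /step /=.
by case: p c1 {lst pth U} => //= z p [-> _]; apply: links_ends.
Qed.

Let incidence e : {ffun vertex G -> rat^o} :=
  [ffun x => (x == (ends e).1)%:R - (x == (ends e).2)%:R]%R.

Let cutspace F := (\sum_(e in F) <[incidence e]>)%VS.

Let connect_cutspace F x y : connect (adj F) x y ->
  [ffun z => (z == x)%:R - (z == y)%:R]%R \in cutspace F.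
Proof.
case/connectP=> p; elim: p x => [|z p IHp] x /=.
  move=> _ ->; rewrite (_ : finfun _ = 0%R) ?mem0v //.
  by apply/ffunP=> z; rewrite !ffunE subrr.
case/andP=> /existsP[f /andP[fF fxz]] pth lst.
have -> : [ffun u => (u == x)%:R - (u == y)%:R]%R =
    ([ffun u => (u == x)%:R - (u == z)%:R] +
     [ffun u => (u == z)%:R - (u == y)%:R])%R :> {ffun vertex G -> rat^o}.
  by apply/ffunP=> u; rewrite !ffunE addrA subrK.
apply: memvD (IHp _ pth lst).
have fC : incidence f \in cutspace F.
  by apply: subvP (memv_line _); apply: (sumv_sup f).
case/orP: fxz => /eqP ef.
  rewrite (_ : finfun _ = incidence f) //.
  by apply/ffunP=> u; rewrite !ffunE ef.
rewrite (_ : finfun _ = - incidence f)%R ?memvN //.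
by apply/ffunP=> u; rewrite !ffunE ef opprB.
Qed.

Let dim_cutspace F : acyclic F -> \dim (cutspace F) = #|F|.
Proof.
have [n] := ubnP #|F|; elim: n F => // n IHn F leFn acF.
have [->|[e eF]] := set_0Vmem F; first by rewrite /cutspace big_set0 dimv0 cards0.
have acFe : acyclic (F :\ e) by apply: acyclic_sub acF; apply: subD1set.
rewrite (cardsD1 e F) eF in leFn *.
rewrite -(IHn _ leFn acFe) /cutspace (big_setD1 e) //= -/(cutspace _).
pose phi (u : {ffun vertex G -> rat^o}) : rat :=
  (\sum_(z | connect (adj (F :\ e)) z (ends e).1) u z)%R.
have phi_inc f : phi (incidence f) =
    ((connect (adj (F :\ e)) (ends f).1 (ends e).1)%:R -
     (connect (adj (F :\ e)) (ends f).2 (ends e).1)%:R)%R.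
  have aux v : (\sum_(z | connect (adj (F :\ e)) z (ends e).1) (z == v)%:R
      = (connect (adj (F :\ e)) v (ends e).1)%:R :> rat)%R.
    rewrite big_mkcond (bigD1 v) //= eqxx big1 ?addr0 => [|z /negPf->].
      by case: ifP.
    by case: ifP.
  rewrite /phi -!aux -sumrB; by apply: eq_bigr => z _; rewrite ffunE.
have ne : incidence e \notin cutspace (F :\ e).
  apply/negP=> /memv_sumP[u uF def_e].
  have : phi (incidence e) = 1%R.
    rewrite phi_inc connect0 connC (negPf (acyclic_bridge acF eF)).
    by rewrite subr0.
  rewrite def_e /phi; under eq_bigr do rewrite sum_ffunE.
  rewrite exchange_big big1 //= => f fF.
  have /vlineP[k ->] := uF f fF.
  under eq_bigr do rewrite ffunE.
  rewrite -mulr_sumr -/(phi (incidence f)) phi_inc.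
  suff -> : connect (adj (F :\ e)) (ends f).1 (ends e).1 =
            connect (adj (F :\ e)) (ends f).2 (ends e).1 by rewrite subrr mulr0.
  apply: (same_connect (connC (F :\ e))); apply: connect1; apply/existsP; exists f.
  by rewrite fF links_ends.
rewrite dimv_disjoint_sum; last first.
  apply/eqP; rewrite -subv0; apply/subvP=> u; rewrite memv_cap => /andP[].
  case/vlineP=> k -> kC; rewrite memv0; have [->|k0] := eqVneq k 0%R.
    by rewrite scale0r.
  case/negP: ne; rewrite -[incidence e](scalerK k0); exact: memvZ.
rewrite dim_vline; case: eqP => // e0.
by rewrite e0 mem0v in ne.
Qed.

Lemma acyclic_aug I J : acyclic I -> acyclic J -> #|I| < #|J| ->
  exists2 e, e \in J :\: I & acyclic (e |: I).
Proof.
move=> acI acJ ltIJ; apply: contrapT => nex.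
suff : #|J| <= #|I| by rewrite leqNgt ltIJ.
rewrite -(dim_cutspace acI) -(dim_cutspace acJ); apply: dimvS.
apply/subv_sumP=> e eJ; rewrite -memvE.
have [eI | neI] := boolP (e \in I).
  by apply: subvP (memv_line _); apply: (sumv_sup e).
apply: connect_cutspace; apply: contrapT => /negP nconn; apply: nex.
by exists e; [rewrite inE neI | apply: acyclic_add].
Qed.

Definition cycle_matroid : matroid (edge G) :=
  Matroid acyclic0 acyclic_sub acyclic_aug.

End CycleMatroid.

Section Theta.
Variables (m : nat) (l : m.-tuple nat).

(* [inl false] and [inl true] are the two common end vertices, and
   [inr (i, k)] is the vertex in position k + 1 on the i-th path, which has
   length [tnth l i] (assumed positive) *)
Definition theta_vertex : finType :=
  (bool + {i : 'I_m & 'I_(tnth l i).-1})%type.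

Definition theta_edge : finType := {i : 'I_m & 'I_(tnth l i)}.

Definition theta_pos (i : 'I_m) (j : nat) : theta_vertex :=
  if j is j'.+1 then
    if insub j' is Some k then
      inr (Tagged (fun i : 'I_m => 'I_(tnth l i).-1) (k : 'I_(tnth l i).-1))
    else inl true
  else inl false.

Definition theta_ends (e : theta_edge) : theta_vertex * theta_vertex :=
  (theta_pos (tag e) (tagged e), theta_pos (tag e) (tagged e).+1).

Definition theta_graph : mgraph := MGraph theta_ends.

End Theta.

Definition theta_matroid (t : nat) :=
  cycle_matroid (theta_graph [tuple 1; t; t; t]).

Local Open Scope ring_scope.

Section Operators.
Variables (R : realFieldType) (E : finType) (M : matroid E).
Implicit Types (x y a : flat M).

Definition flat_space : vectType R := {ffun flat M -> R^o}.
Implicit Types (u v : flat_space) (f g : 'End(flat_space)).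

Definition coord_ u x : R := (u : {ffun flat M -> R^o}) x.

Definition e_ x : flat_space := [ffun y => (y == x)%:R : R^o].

Lemma coord_e x y : coord_ (e_ x) y = (y == x)%:R.
Proof. exact: ffunE. Qed.

Lemma coordP (k : R) u v x : coord_ (k *: u + v) x = k * coord_ u x + coord_ v x.
Proof. by rewrite /coord_ !ffunE. Qed.

Definition ext_fun (w : flat M -> flat_space) u : flat_space :=
  \sum_x coord_ u x *: w x.

Fact ext_fun_linear w : linear (ext_fun w).
Proof.
move=> k u v; rewrite /ext_fun scaler_sumr -big_split; apply: eq_bigr => x _.
by rewrite coordP scalerDl scalerA.
Qed.

HB.instance Definition _ w :=
  GRing.isLinear.Build R flat_space flat_space _ (ext_fun w)
    (ext_fun_linear w).

Definition lin_ext (w : flat M -> flat_space) : 'End(flat_space) :=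
  linfun (ext_fun w).

Lemma lin_ext_e w x : lin_ext w (e_ x) = w x.
Proof.
rewrite lfunE /= /ext_fun (bigD1 x) //= coord_e eqxx scale1r big1 ?addr0 //.
by move=> y /negPf nyx; rewrite coord_e nyx scale0r.
Qed.

Lemma flat_space_sum u : u = \sum_x coord_ u x *: e_ x.
Proof.
apply/ffunP=> y; rewrite sum_ffunE (bigD1 y) //= big1 => [|x /negPf nxy].
  by rewrite addr0 !ffunE eqxx; apply/esym/mulr1.
by rewrite !ffunE eq_sym nxy; apply: mulr0.
Qed.

(* The vector v_k *)
Definition vlevel (k : nat) : flat_space :=
  \sum_(x : flat M | rk x == k) (beta x)%:R *: e_ x.

Definition dotb u v : R := \sum_x coord_ u x * coord_ v x / (beta x)%:R.

Lemma dotb_e x y : dotb (e_ x) (e_ y) = (x == y)%:R / (beta x)%:R.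
Proof.
rewrite /dotb (bigD1 x) //= !coord_e eqxx mul1r big1 ?addr0 // => z /negPf nzx.
by rewrite coord_e nzx !mul0r.
Qed.

(* The value at [e_ y] is forced by [adjointbP] below, as the [e_ x] are
   orthogonal of square norm [1 / beta x]; see also [adjointb_unique] *)
Definition adjointb f : 'End(flat_space) :=
  lin_ext (fun y => \sum_x ((beta x)%:R * dotb (f (e_ x)) (e_ y)) *: e_ x).

Lemma dotbC u v : dotb u v = dotb v u.
Proof. by apply: eq_bigr => x _; rewrite (mulrC (coord_ u x)). Qed.

Lemma dotb_linl v : linear (fun u => dotb u v : R^o).
Proof.
move=> k u w; rewrite /dotb scaler_sumr -big_split; apply: eq_bigr => x _ /=.
by rewrite coordP !mulrDl -!mulrA.
Qed.

Lemma dotb_suml (I : finType) (c : I -> R) (w : I -> flat_space) v :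
  dotb (\sum_i c i *: w i) v = \sum_i c i * dotb (w i) v.
Proof.
pose p u : R^o := dotb u v.
pose pL := GRing.isLinear.Build R flat_space R^o _ p (dotb_linl v).
pose pl : {linear flat_space -> R^o} := HB.pack p pL.
rewrite -[LHS]/(pl _) linear_sum; apply: eq_bigr => i _.
by rewrite linearZ.
Qed.

Lemma dotb_sumr (I : finType) (c : I -> R) (w : I -> flat_space) v :
  dotb v (\sum_i c i *: w i) = \sum_i c i * dotb v (w i).
Proof.
by rewrite dotbC dotb_suml; apply: eq_bigr => i _; rewrite dotbC.
Qed.

Lemma dotb_ev x v : dotb (e_ x) v = coord_ v x / (beta x)%:R.
Proof.
rewrite /dotb (bigD1 x) //= !coord_e eqxx mul1r big1 ?addr0 // => z /negPf nzx.
by rewrite coord_e nzx !mul0r.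
Qed.

Lemma adjointbP f u v : dotb (f u) v = dotb u (adjointb f v).
Proof.
rewrite [v]flat_space_sum linear_sum; under [in RHS]eq_bigr do rewrite linearZ.
rewrite !dotb_sumr; apply: eq_bigr => y _; congr (_ * _).
rewrite [in RHS](_ : _ (e_ y) = adjointb f (e_ y)) // /adjointb lin_ext_e.
rewrite [u]flat_space_sum linear_sum.
under [in LHS]eq_bigr do rewrite linearZ.
rewrite !dotb_suml; apply: eq_bigr => x _; congr (_ * _).
rewrite dotb_sumr (bigD1 x) //= dotb_e eqxx big1 ?addr0 => [|z /negPf nzx].
  by rewrite mul1r mulrAC divff ?mul1r // pnatr_eq0 -lt0n beta_gt0.
by rewrite dotb_e eq_sym nzx mul0r mulr0.
Qed.

Lemma adjointb_unique f g :
  (forall u v, dotb (f u) v = dotb u (g v)) -> g = adjointb f.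
Proof.
move=> fg; apply/lfunP=> v; apply/ffunP=> x.
have := fg (e_ x) v; rewrite adjointbP !dotb_ev => /mulIf eq_x.
by apply/esym/eq_x; rewrite invr_eq0 pnatr_eq0 -lt0n beta_gt0.
Qed.

Definition Lop a : 'End(flat_space) :=
  lin_ext (fun x => if (a <= x)%O then 0 else e_ (x `|` a)%O).

Definition Lbeta a : 'End(flat_space) := adjointb (Lop a).

Definition Ubeta : 'End(flat_space) := \sum_(a in atoms M) Lbeta a.

Definition Kop : 'End(flat_space) := lin_ext (fun x => (rk x)%:R *: e_ x).

Definition Sinv : 'End(flat_space) :=
  lin_ext (fun x => if x == \top%O then 0 else (nmiss x)%:R^-1 *: e_ x).

Definition Dbeta : 'End(flat_space) := (Sinv \o Ubeta \o Kop)%VF.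

Fixpoint Cbeta (k : nat) : {vspace flat_space} :=
  if k is k'.+1 then
    (Dbeta @: Cbeta k' + \sum_(a in atoms M) (Lbeta a @: Cbeta k'))%VS
  else <[vlevel (rk (\top%O : flat M))]>%VS.

Definition hbeta (k : nat) : nat := \dim (Cbeta k).

End Operators.

(* Main.v *)
Require Import Defs.
From Stdlib Require Import BinNatDef.
From mathcomp Require Import all_boot all_order all_algebra.
From mathcomp Require Import boolp reals zify ring lra.

Import Order.TTheory GRing.Theory Num.Theory.

Set Implicit Arguments.
Unset Strict Implicit.
Unset Printing Implicit Defensive.

(** Write [v(x)] for the coordinate of [v] on [beta x *: e_ x].  In these coordinates the
   weights disappear: [L_a^beta] maps [v] to the function with value [v(x `|` a)] at the
   flats [x] that do not contain [a], and zero elsewhere, and [D_beta] averages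
   [v(x `|` a)] over the atoms [a] that [x] misses, up to a nonzero factor that depends
   on the rank only ([ncoord_edge_op], [ncoord_D]).  So the space with index [k] is a
   space of functions on the flats of corank [k].

   A set of edges of a theta graph is acyclic if and only if it contains at most one
   complete path ([theta_acyclicP]).  Hence the complement of a flat either meets all the
   paths, or meets no path in exactly one edge ([mclosureC]), and the corank of the flat is
   the nullity of its complement in the dual matroid ([rk_nullity]).  This leaves few
   shapes of complements, named by their numbers of edges on the three long paths, with a
   prefix e if they contain the edge [eps] which is a path by itself: 2 and e111 in
   corank 1; 3, 22 and e211 in corank 2; 4, 32, 222, e311 and e221 in corank 3.

   The functions in the first three spaces are then described by coefficients ([rep1],
   [rep2], [rep3]).  At the first step there is one coefficient per edge.  At the second
   step there is one per pair of edges, which the operators [L_a^beta] account for, and one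
   more per edge of a long path, which appears in the shape e211 only and is due to
   [D_beta].  At the third step there is one per triple of edges, and there are further
   coefficients [X] and [W] for pairs, seen by the shapes e311 and e221 only.  These
   descriptions are stable under the operators ([rep3_edge_op], [rep3_D]), all the
   coefficients occur ([rep3_exists]), and every vector has coefficients in normal form
   ([rep3_normal]), which are unique ([rep3_inj]).  The last point is where [t] has to be
   at least 6: a function of pairs of positions has to be determined by its sums over the
   pairs of each quadruple ([sum_pairs_quads_eq0]).

   The dimensions are the numbers of coefficients of the normal forms: 3t + 1 at the first
   step, C(3t + 1, 2) + 3(t - 1) at the second, and at the third
   C(3t + 1, 3) - 3t + 6t(t - 1) + 3 C(t, 2) + 3t(t - 1). *)

(** * Independent sets of a theta graph *)

Section ThetaCircuits.
Variables (m : nat) (l : m.-tuple nat).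
Hypothesis l_gt0 : forall i, 0 < tnth l i.
Let G := theta_graph l.
Implicit Types (F : {set edge G}) (i j : 'I_m).

Definition path_edge i (k : 'I_(tnth l i)) : edge G :=
  Tagged (fun i => 'I_(tnth l i)) k.

Definition full F i := [forall k : 'I_(tnth l i), path_edge k \in F].

Lemma theta_pos_last i : theta_pos l i (tnth l i) = inl true.
Proof.
by have := l_gt0 i; case E: (tnth l i) => [//|n] _ /=; rewrite insubF // E ltnn.
Qed.

Lemma theta_pos_lt i k : k < tnth l i -> theta_pos l i k != inl true.
Proof. by case: k => // k kl; rewrite /= insubT //; lia. Qed.

Lemma theta_pos_gt0 i k : 0 < k -> theta_pos l i k != inl false.
Proof. by case: k => // k _ /=; case: insub. Qed.

Let inner (v : theta_vertex l) := if v is inr s then Some s else None.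

Lemma theta_pos_inj i j k n : 0 < k -> k < tnth l i ->
  theta_pos l i k = theta_pos l j n -> i = j /\ k = n.
Proof.
case: k => // k _ kl; case: n => [|n] /=; first by rewrite insubT //; lia.
rewrite insubT ?[in X in X -> _]/=; first by lia.
move=> kl'; case: insubP => // u _ <- /(congr1 inner) [] /= ij.
have {}ij : i = j by [].
case: _ / ij u => u /eqP; rewrite eq_Tagged /= => /eqP <-.
by [].
Qed.

Lemma theta_pos_inj_lt i k n : k < tnth l i -> n < tnth l i ->
  theta_pos l i k = theta_pos l i n -> k = n.
Proof.
case: k n => [|k] [|n] // kl nl e.
- by have := @theta_pos_inj i i n.+1 0 isT nl (esym e); case.
- by have := @theta_pos_inj i i k.+1 0 isT kl e; case.
- by have := @theta_pos_inj i i k.+1 n.+1 isT kl e; case.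
Qed.

Local Arguments theta_pos : simpl never.

Lemma linksP (e : edge G) (x y : vertex G) : links e x y ->
  (x = (ends e).1 /\ y = (ends e).2) \/ (y = (ends e).1 /\ x = (ends e).2).
Proof. by case/orP=> /eqP ->; [left | right]. Qed.

Lemma ends_neq (e : edge G) : (ends e).1 != (ends e).2.
Proof.
case: e => i k /=.
have [k0|k0] := posnP (nat_of_ord k).
  by rewrite k0 eq_sym (@theta_pos_gt0 i 1).
apply/eqP=> /(theta_pos_inj k0 (ltn_ord k)) [_]; lia.
Qed.

(** The two neighbours of [e] in the closed walk are incident to its two ends; the
   absence of loops makes them different from [e]. *)
Lemma cycle_deg c (e : edge G) (x y : vertex G) :
  is_cycle c -> e \in unzip2 c -> links e x y ->
  exists e' z, [/\ e' \in unzip2 c, e' != e & links e' x z].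
Proof.
case/and4P=> _ _ U cyc /mapP[[v f] vc /= fe] lxy; subst f.
case/rot_to: vc => i c' def_c.
rewrite -(rot_cycle i) def_c in cyc.
rewrite -(rot_uniq i) -map_rot def_c /= in U; case/andP: U => ne U.
have memc f : f \in unzip2 c' -> f \in unzip2 c.
  by move=> fc; rewrite -(mem_rot i) -map_rot def_c /= inE fc orbT.
have nec f : f \in unzip2 c' -> f != e.
  by move=> fc; apply: contraNneq ne => <-.
case: c' {def_c ne} cyc memc nec {U} => [|q t] /=.
  rewrite andbT /step /= => /linksP lvv _ _; have := ends_neq e.
  by case: lvv => -[<- <-]; rewrite eqxx.
rewrite rcons_path /step /= => /and3P[lvq pth lst] memc nec.
set u := last q t in lst; have ut : u.2 \in q.2 :: unzip2 t.
  rewrite -[q.2 :: _]/(unzip2 (q :: t)); apply: map_f; exact: mem_last.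
have [<-|vx] := eqVneq v x.
  by exists u.2, u.1; split; [apply: memc | apply: nec | rewrite linksC].
have qx : q.1 = x.
  move: vx; case/linksP: lxy => -[ex ey]; case/linksP: lvq => -[ev eq];
    by rewrite ?ex ?ey ?ev ?eq ?eqxx.
rewrite -{}qx in lxy *; exists q.2.
have q2 : q.2 \in q.2 :: unzip2 t by rewrite inE eqxx.
clear ut; rewrite {}/u in lst;
case: t pth lst q2 memc nec => [|w t] /= pth lst q2 memc nec.
  by exists v; split; [apply: memc | apply: nec |].
by case/andP: pth => lq _; exists w.1; split; [apply: memc | apply: nec |].
Qed.

Lemma path_edge_eq (i : 'I_m) (k k' : 'I_(tnth l i)) : val k = val k' ->
    path_edge k = path_edge k'.
Proof. by move/val_inj->. Qed.

(** Internal vertices of a path have degree two, so that a cycle which uses one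
   edge of a path uses them all. *)
Lemma cycle_full c i (k : 'I_(tnth l i)) : is_cycle c -> path_edge k \in unzip2 c ->
  forall k' : 'I_(tnth l i), path_edge k' \in unzip2 c.
Proof.
move=> cyc kc.
have inc n (f : edge G) z : 0 < n -> n < tnth l i ->
    links f (theta_pos l i n) z ->
    exists2 h : 'I_(tnth l i), f = path_edge h & val h = n \/ (val h).+1 = n.
  move=> n0 nl; case: f => j h /linksP /= [] [].
    by case/(theta_pos_inj n0 nl)=> ij ->; subst j; exists h => //; left.
  move=> _; case/(theta_pos_inj n0 nl)=> ij ->; subst j; exists h => //; by right.
have up (h h' : 'I_(tnth l i)) : val h' = (val h).+1 ->
    (path_edge h \in unzip2 c) = (path_edge h' \in unzip2 c).
  move=> hh'; have n0 : 0 < val h' by rewrite hh'.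
  apply/idP/idP=> hc.
    have lh : links (path_edge h) (theta_pos l i (val h')) (theta_pos l i (val h)).
      by rewrite hh' linksC; apply: links_ends.
    have [f [z [fc fh /(inc _ _ _ n0 (ltn_ord h')) [g ef gh]]]] := cycle_deg cyc hc lh.
    case: gh => gh; first by rewrite -(path_edge_eq gh) -ef.
    by case/eqP: fh; rewrite ef; apply: path_edge_eq; lia.
  have lh : links (path_edge h') (theta_pos l i (val h')) (theta_pos l i (val h').+1).
    exact: links_ends.
  have [f [z [fc fh /(inc _ _ _ n0 (ltn_ord h')) [g ef gh]]]] := cycle_deg cyc hc lh.
  case: gh => gh; first by case/eqP: fh; rewrite ef; apply: path_edge_eq.
  by rewrite -(@path_edge_eq i g h) -?ef //; lia.
have all0 n (h0 h : 'I_(tnth l i)) : val h0 = 0 -> val h = n ->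
    (path_edge h0 \in unzip2 c) = (path_edge h \in unzip2 c).
  move=> h00; elim: n h => [|n IHn] h hn.
    by rewrite (@path_edge_eq i h0 h) // h00.
  have nl : n < tnth l i by have := ltn_ord h; rewrite -[nat_of_ord h]/(val h); lia.
  by rewrite (IHn (Ordinal nl)) //; apply: up.
move=> k'; pose h0 := Ordinal (l_gt0 i).
by rewrite -(all0 (val k') h0 k') // (all0 (val k) h0 k).
Qed.

Lemma cycle_two_full c F : is_cycle c -> all (fun e => e \in F) (unzip2 c) ->
  exists i j, [/\ i != j, full F i & full F j].
Proof.
move=> cyc /allP cF.
have [[i k] kc] : exists e, e \in unzip2 c.
  by case/and4P: cyc; case: c {cF} => [//|p c] _ _ _ _; exists p.2; rewrite inE eqxx.
have fulli : full F i.
  by apply/forallP=> k'; apply: cF; apply: (cycle_full cyc kc).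
have lastl : (tnth l i).-1 < tnth l i by rewrite ltn_predL.
pose h := Ordinal lastl.
have hc : path_edge h \in unzip2 c by apply: (cycle_full cyc kc).
have lh : links (path_edge h) (inl true) (theta_pos l i h).
  rewrite linksC; have := links_ends (path_edge h).
  by rewrite /= [_.-1.+1]prednK ?theta_pos_last.
have [[j g] [z [gc gh lg]]] := cycle_deg cyc hc lh.
exists i, j; split=> //; last first.
  by apply/forallP=> k'; apply: cF; apply: (cycle_full cyc gc).
apply: contraNneq gh => ij; subst j; apply/eqP/path_edge_eq => /=.
case/linksP: lg => -[] /=.
  by move=> e; have := theta_pos_lt (ltn_ord g); rewrite -e eqxx.
move=> _ e; have [gl|] := ltnP g.+1 (tnth l i).
  by have := theta_pos_lt gl; rewrite -e eqxx.
by have := ltn_ord g; rewrite -[nat_of_ord g]/(val g); lia.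
Qed.

Let path_iota (T : Type) (r : rel T) (f : nat -> T) a n :
  (forall k, a <= k < a + n -> r (f k) (f k.+1)) ->
  path r (f a) (map f (iota a.+1 n)).
Proof.
elim: n a => [//|n IHn] a H /=; rewrite H ?leqnn ?addnS ?leq_addr ?ltnS ?leq_addr //=.
by apply: IHn => k Hk; apply: H; lia.
Qed.

Lemma two_full_cycle F i j : i != j -> full F i -> full F j -> ~~ acyclic (G := G) F.
Proof.
move=> nij /forallP fi /forallP fj; apply/negP=> /asboolP ac.
pose ed i k : edge G := path_edge (insubd (Ordinal (l_gt0 i)) k).
have ledk i' k : k < tnth l i' ->
    links (ed i' k) (theta_pos l i' k) (theta_pos l i' k.+1).
  move=> kl; have := links_ends (ed i' k).
  by rewrite /= /theta_ends /= !val_insubd kl.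
set a := tnth l i; set b := tnth l j.
have [a0 b0] : 0 < a /\ 0 < b by rewrite /a /b !l_gt0.
(* along path i from the first end vertex, then back along path j *)
pose f k : vertex G * edge G :=
  if k < a then (theta_pos l i k, ed i k)
  else (theta_pos l j (b - (k - a)), ed j (b - (k - a)).-1).
pose c := f 0 :: map f (iota 1 (a + b).-1).
have def_c : c = map f (iota 0 (a + b)).
  by rewrite /c -map_cons; congr map; rewrite -[in RHS](@prednK (a + b)) //; lia.
have injV k n : k < a + b -> n < a + b -> (f k).1 = (f n).1 -> k = n.
  wlog le_kn: k n / k <= n => [hw kl nl e|].
    by have [kn|/ltnW nk] := leqP k n; [apply: hw | apply/esym/hw].
  rewrite /f => kl nl; case: ltnP => ka; case: ltnP => na /=; last 2 first.
  - lia.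
  - move=> e; have [na'|na'] := eqVneq n a.
      have : b - (k - a) = b - (n - a).
        rewrite na' subnn subn0 in e *; move: e; rewrite theta_pos_last.
        case: (eqVneq k a) => [->|ka']; first by rewrite subnn subn0.
        by move=> e; have := @theta_pos_lt j (b - (k - a)); rewrite e eqxx; lia.
      lia.
    have := @theta_pos_inj j j (b - (n - a)) (b - (k - a)).
    rewrite e => /(_ _ _ erefl); have ? : 0 < b - (n - a) by lia.
    have ? : b - (n - a) < b by lia.
    by move=> /(_ _ _)[] //; lia.
  - exact: theta_pos_inj_lt.
  case: (posnP k) => [->|k0] e.
    by have := @theta_pos_gt0 j (b - (n - a)); rewrite -e eqxx; lia.
  by have [ij _] := theta_pos_inj k0 ka e; rewrite ij eqxx in nij.
have edF i' k : full F i' -> ed i' k \in F by move/forallP; apply.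
have injE k n : k < a + b -> n < a + b -> (f k).2 = (f n).2 -> k = n.
  have tagE i' k' : tag (ed i' k') = i' by [].
  have valE i' k' n' : k' < tnth l i' -> n' < tnth l i' ->
      ed i' k' = ed i' n' -> k' = n'.
    move=> kl nl /eqP; rewrite eq_Tagged /= -val_eqE /= !val_insubd kl nl.
    by move/eqP.
  rewrite /f => kl nl; case: ltnP => ka; case: ltnP => na /= e.
  - exact: (valE i).
  - by have := congr1 tag e; rewrite !tagE => ij; rewrite ij eqxx in nij.
  - by have := congr1 tag e; rewrite !tagE => ij; rewrite ij eqxx in nij.
  by have := valE j _ _ _ _ e; rewrite -/b => /(_ _ _); lia.
have cyc : is_cycle c.
  apply/and4P; split=> //.
  - rewrite def_c /unzip1 -map_comp map_inj_in_uniq ?iota_uniq // => k n.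
    rewrite !mem_iota; apply: injV.
  - rewrite def_c /unzip2 -map_comp map_inj_in_uniq ?iota_uniq // => k n.
    rewrite !mem_iota; apply: injE.
  rewrite /c /= rcons_path; apply/andP; split.
    apply: path_iota => k kl; rewrite /step /f.
    case: (ltnP k a) => ka.
      case: (ltnP k.+1 a) => ka'; first by apply: ledk.
      have -> : b - (k.+1 - a) = b by lia.
      rewrite /= theta_pos_last -(theta_pos_last i) -/a.
      have -> : a = k.+1 by lia.
      exact: ledk.
    case: (ltnP k.+1 a) => ka'; first lia.
    rewrite /= linksC; have -> : b - (k.+1 - a) = (b - (k - a)).-1 by lia.
    have := @ledk j (b - (k - a)).-1; rewrite prednK; last lia.
    by apply; rewrite -/b; lia.
  have -> : last (f 0) (map f (iota 1 (a + b).-1)) = f (a + b).-1.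
    by rewrite last_map -nth_last size_iota; case: (a + b).-1 => [//|n];
       rewrite nth_iota.
  rewrite /step /f ifF; last lia.
  rewrite a0 /=; have -> : b - ((a + b).-1 - a) = 1 by lia.
  by rewrite linksC; apply: (ledk j 0).
move/negP: (ac _ cyc); apply; apply/allP=> e; rewrite def_c /unzip2 -map_comp.
case/mapP=> k _ ->; rewrite /= /f; case: ifP => _ /=; apply: edF; exact/forallP.
Qed.

Lemma theta_acyclicP F :
  reflect (forall i j, full F i -> full F j -> i = j) (acyclic (G := G) F).
Proof.
apply: (iffP idP) => [ac i j fi fj | H].
  apply/eqP; apply: contraTT ac => nij; exact: two_full_cycle nij fi fj.
apply/asboolP=> c cyc; apply/negP=> cF.
have [i [j [nij fi fj]]] := cycle_two_full cyc cF.
by rewrite (H i j fi fj) eqxx in nij.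
Qed.

End ThetaCircuits.

(** * Atoms of a simple matroid *)

Section Matroids.
Variables (E : finType) (M : matroid E).
Implicit Types (X Y I : {set E}) (e : E) (x : flat M).

Lemma mclosure_dep I e : indep M I -> ~~ indep M (e |: I) -> e \in mclosure M I.
Proof.
move=> indI dep; rewrite inE eqn_leq [X in _ && X]mrankS ?subsetUr // andbT.
have [K [indK sK <-]] := mrank_basis M (e |: I).
apply: leq_trans (mrank_indep indI (subxx I)).
have lt : #|K| < #|e |: I|.
  by apply: proper_card; rewrite properEneq sK andbT; apply: contraNneq dep => <-.
by move: lt; rewrite cardsU1; case: (e \notin I) => /=; lia.
Qed.

Lemma notin_mclosure X e : e \notin X ->
  (forall I, indep M I -> I \subset X -> indep M (e |: I)) -> e \notin mclosure M X.
Proof.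
move=> eX H; have [I [indI sIX cI]] := mrank_basis M X.
rewrite inE -cI neq_ltn orbC; apply/orP; left.
have -> : #|I|.+1 = #|e |: I| by rewrite cardsU1 (contra (subsetP sIX e)).
by apply: mrank_indep; [apply: H | apply: setUS].
Qed.

Lemma rk_cl_add x e : e \notin (x : {set E}) -> rk (cl M (e |: x)) = (rk x).+1.
Proof.
move=> ex; rewrite /rk /= mrank_closure; apply/eqP; rewrite eqn_leq; apply/andP; split.
  have [K [indK sK <-]] := mrank_basis M (e |: x).
  have : #|K :\ e| <= mrank M x.
    apply: mrank_indep; first exact: indep_sub (subD1set K e) indK.
    by apply/subsetP=> f; rewrite !inE => /andP[/negPf fe /(subsetP sK)];
      rewrite !inE fe.
  by rewrite (cardsD1 e K); case: (e \in K); lia.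
rewrite ltn_neqAle mrankS ?subsetUr // andbT eq_sym.
apply: contra ex => ex; rewrite -(eqP (flat_setP x)) inE; exact: ex.
Qed.

Lemma join_cl_set1 x e : (x `|` cl M [set e])%O = cl M (e |: x).
Proof.
apply/eqP; rewrite eq_le leUx cl_le cl_le subUset !sub1set.
have le1 : ((x `|` cl M [set e])%O : flat M) = (x `|` cl M [set e])%O by [].
have sx : (x <= x `|` cl M [set e])%O by apply: leUl.
have se : (cl M [set e] <= x `|` cl M [set e])%O by apply: leUr.
move: se; rewrite cl_le sub1set => ->; rewrite -leEflat sx !andbT.
rewrite leEflat (subset_trans (subsetUr [set e] x)) ?subset_mclosure //=.
by apply: (subsetP (subset_mclosure M _)); rewrite inE set11.
Qed.

Hypothesis indep1 : forall e, indep M [set e].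
Hypothesis closed1 : forall e, mclosure M [set e] = [set e].

Lemma atomsE : atoms M = [set cl M [set e] | e : E].
Proof.
apply/setP=> a; rewrite inE; apply/idP/imsetP=> [/eqP ra | [e _ ->]].
  have [I [indI sI]] := mrank_basis M a; rewrite -/(rk a) ra.
  move/eqP/cards1P=> [e eI]; exists e => //; apply/esym/rk_le_eq.
    by rewrite cl_le -eI.
  by rewrite ra /rk /= mrank_closure -(cards1 e); apply: mrank_indep.
rewrite /rk /= mrank_closure eqn_leq; apply/andP; split; last first.
  by have := mrank_indep (indep1 e) (subxx _); rewrite cards1.
have [J [_ sJ <-]] := mrank_basis M [set e].
by rewrite -(cards1 e) subset_leq_card.
Qed.

Lemma cl_set1_inj : injective (fun e => cl M [set e]).
Proof.
move=> e f /(congr1 (fun x : flat M => (x : {set E}))) /=; rewrite !closed1.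
exact: set1_inj.
Qed.

Lemma nmissE x : nmiss x = #|~: (x : {set E})|.
Proof.
rewrite /nmiss; set B := [set a in _ | _].
have -> : B = [set cl M [set e] | e in (x : {set E})].
  apply/setP=> a; rewrite inE atomsE; apply/andP/imsetP.
    by case=> /imsetP[e _ ->]; rewrite cl_le sub1set => ex; exists e.
  by case=> e ex ->; rewrite cl_le sub1set ex; split=> //; apply/imsetP; exists e.
rewrite atomsE !card_imset; try exact: cl_set1_inj.
by rewrite [in RHS]cardsCs setCK.
Qed.

End Matroids.

(** * Flats of a theta graph and their complements *)

Section ThetaFlats.
Variables (m : nat) (l : m.-tuple nat).
Hypothesis l_gt0 : forall i, 0 < tnth l i.
Let M := cycle_matroid (theta_graph l).
Let E := edge (theta_graph l).
Implicit Types (F X Y I : {set E}) (e f : E) (i j : 'I_m).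

Definition path_of e : 'I_m := tag e.

Lemma fullP F i : reflect (forall e, path_of e = i -> e \in F) (full F i).
Proof.
apply: (iffP forallP) => [H e | H k]; last exact: H.
by case: e => j k; rewrite /path_of /= => ji; subst i; apply: H.
Qed.

(** If a path is disjoint from [Y], it is complete in the complement of [Y], and there
   an edge which is the only one of [Y] on its path closes a cycle.  Hence [reduce Y] is
   the complement of the closure of the complement of [Y]. *)
Definition reduce Y : {set E} :=
  if [exists i, [forall e in Y, path_of e != i]]
  then [set e in Y | [exists f in Y, (f != e) && (path_of f == path_of e)]]
  else Y.

Lemma mclosureC Y : mclosure M (~: Y) = ~: reduce Y.
Proof.
have indP F : reflect (forall i j, full F i -> full F j -> i = j) (indep M F).
  exact: theta_acyclicP.
have fullC i : full (~: Y) i = [forall e in Y, path_of e != i].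
  apply/fullP/forall_inP=> [H e eY | H e ei].
    by apply/eqP=> /H; rewrite inE eY.
  by rewrite inE; apply/negP=> /H; rewrite ei eqxx.
apply/setP=> e; rewrite [in RHS]inE /reduce.
have [eY|eY] := boolP (e \in Y); last first.
  rewrite (subsetP (subset_mclosure M _)) ?inE //; apply/esym.
  by case: ifP => _; rewrite ?inE (negPf eY).
have eYC : e \notin ~: Y by rewrite inE eY.
case: ifP => [/existsP[i]|/existsP noi]; last first.
  rewrite eY; apply: negbTE; apply: notin_mclosure => // I /indP indI sI.
  apply/indP => i j; suff H k : full (e |: I) k -> k = path_of e.
    by move=> /H-> /H->.
  move/fullP=> fk; apply/eqP; rewrite eq_sym; apply: contraT => nk.
  case: noi; exists k; rewrite -fullC; apply/fullP=> f fk'.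
  have := fk f fk'; rewrite in_setU1 => /predU1P[ef|/(subsetP sI)//].
  by rewrite -fk' ef eqxx in nk.
rewrite -fullC => fi; rewrite inE eY /=.
have ei : path_of e != i by apply/eqP=> ei; move/fullP: fi => /(_ e ei); rewrite inE eY.
case: existsP => [[f /andP[fY /andP[fe /eqP pf]]]|nof] /=.
  apply: negbTE; apply: notin_mclosure => // I /indP indI sI.
  have fI : f \notin e |: I.
    by rewrite in_setU1 (negPf fe) /=; apply: contraL fY => /(subsetP sI); rewrite inE.
  have H k : full (e |: I) k -> full I k.
    move/fullP=> fk; apply/fullP=> g gk; have := fk g gk.
    rewrite in_setU1 => /predU1P[ge|//]; case/negP: fI; apply: fk.
    by rewrite pf -ge.
  by apply/indP => j k /H fj /H fk; apply: indI.
pose I := [set g : E | (path_of g == i) || (path_of g == path_of e)] :\ e.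
have sI : I \subset ~: Y.
  apply/subsetP=> g; rewrite 3!inE => /andP[ge /orP[/eqP gi|/eqP pg]].
    exact: (fullP _ _ fi).
  by rewrite inE; apply: contraT; rewrite negbK => gY; case: nof; exists g;
     rewrite gY ge pg eqxx.
apply: (subsetP (mclosureS M sI)); apply: mclosure_dep.
  apply/indP; suff H k : full I k -> k = i by move=> j k /H-> /H->.
  move/fullP=> fk; apply/eqP; apply: contraT => nki.
  have [ke|ke] := eqVneq k (path_of e).
    by have := fk e (esym ke); rewrite !inE eqxx.
  have := fk (path_edge (Ordinal (l_gt0 k))) erefl.
  by rewrite !inE /path_of /= (negPf nki) (negPf ke) andbF.
apply/negP=> /indP /(_ i (path_of e)) H; case/eqP: ei; apply/esym/H.
  by apply/fullP=> g gi; rewrite !inE gi eqxx /= andbT orbN.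
by apply/fullP=> g ge; rewrite !inE ge eqxx orbT andbT orbN.
Qed.

(** The nullity of [Y] in the dual matroid: there the paths are parallel classes, any
   [m.-1] of which are independent. *)
Definition nullity Y := #|Y| - minn m.-1 #|path_of @: Y|.

Lemma card_path_le Y i : [forall e in Y, path_of e != i] -> #|path_of @: Y| <= m.-1.
Proof.
move/forall_inP=> nY; have : #|path_of @: Y| <= #|[set~ i]|.
  apply: subset_leq_card; apply/subsetP=> _ /imsetP[e eY ->].
  by rewrite !inE nY.
by rewrite cardsC1 card_ord.
Qed.

(** Dropping an edge that is alone on its path lowers the cardinality and the number
   of paths met by one each. *)
Lemma nullity_reduce Y : nullity (reduce Y) = nullity Y.
Proof.
rewrite /nullity /reduce; case: ifP => // /existsP[i iY].
set Z := [set e in Y | _]; have sZY : Z \subset Y.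
  by apply/subsetP=> e; rewrite inE => /andP[].
have Zi : [forall e in Z, path_of e != i].
  apply/forall_inP=> e /(subsetP sZY); exact: (forall_inP iY).
have -> := minn_idPr (card_path_le Zi); have -> := minn_idPr (card_path_le iY).
have single e f : e \in Y :\: Z -> f \in Y -> path_of f = path_of e -> f = e.
  rewrite !inE => /andP[+ eY] fY pf; rewrite eY /= => /existsP nf.
  by apply/eqP; apply: contraT => fe; case: nf; exists f; rewrite fY fe pf eqxx.
have inj : {in Y :\: Z &, injective path_of}.
  by move=> e f eS fS /single; apply=> //; case/setDP: eS.
have dis : [disjoint path_of @: Z & path_of @: (Y :\: Z)].
  rewrite -setI_eq0; apply/eqP/setP=> c; rewrite !inE; apply/negP.
  case/andP=> /imsetP[f fZ ->] /imsetP[e eS pf].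
  have fe := single e f eS (subsetP sZY f fZ) pf.
  by move: eS; rewrite -fe inE fZ.
rewrite -(cardsID Z Y) (setIidPr sZY) -[in X in _ = _ - X](setID Y Z) (setIidPr sZY).
rewrite imsetU cardsU (disjoint_setI0 dis) cards0 subn0 (card_in_imset inj).
by rewrite subnDr.
Qed.

Lemma nullity_drop Y e : reduce Y = Y -> e \in Y ->
  nullity Y = (nullity (Y :\ e)).+1.
Proof.
move=> redY eY; rewrite /nullity (cardsD1 e Y) eY add1n.
have im_le : #|path_of @: (Y :\ e)| <= #|Y :\ e| by apply: leq_imset_card.
suff eqm : minn m.-1 #|path_of @: (Y :\ e)| = minn m.-1 #|path_of @: Y|.
  rewrite -eqm subSn //; exact: leq_trans (geq_minr _ _) im_le.
have subI : path_of @: (Y :\ e) \subset path_of @: Y by apply/imsetS/subD1set.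
have supI : path_of @: Y \subset path_of e |: path_of @: (Y :\ e).
  apply/subsetP=> _ /imsetP[f fY ->]; rewrite in_setU1.
  have [->|fe] := eqVneq f e; first by rewrite eqxx.
  by rewrite imset_f ?orbT // !inE fe.
move: redY; rewrite /reduce; case: ifP => [_ redY|noi _].
  have : e \in Y := eY; rewrite -{1}redY inE => /andP[_ /existsP[f /and3P[fY fe /eqP
    pf]]].
  congr minn; apply/eqP; rewrite eqn_leq subset_leq_card //=.
  apply/subset_leq_card; apply: (subset_trans supI).
  by rewrite subUset subxx andbT sub1set -pf imset_f // !inE fe.
have YT : path_of @: Y = setT.
  apply/setP=> i; rewrite inE; apply/imsetP.
  have /existsPn /(_ i) := negbT noi; rewrite negb_forall => /existsP[f].
  by rewrite negb_imply negbK => /andP[fY /eqP <-]; exists f.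
have := subset_leq_card supI; rewrite YT cardsT card_ord cardsU1.
by case: (_ \notin _) => /= le_m; rewrite (minn_idPl _) ?(minn_idPl _) //; lia.
Qed.

(** By induction from the top: adding an edge to a flat and closing raises the rank by
   one and lowers the nullity of the complement by one. *)
Lemma rk_nullity (x : flat M) : rk x +
    nullity (~: (x : {set E})) = rk (\top%O : flat M).
Proof.
have [n] := ubnP #|~: (x : {set E})|; elim: n x => // n IHn x ltn.
have [x1|[e ex]] := set_0Vmem (~: (x : {set E})).
  have -> : x = (\top%O : flat M).
    by apply: val_inj; rewrite /= -[LHS]setCK x1 setC0.
  by rewrite setCT /nullity cards0 sub0n addn0.
have nex : e \notin (x : {set E}) by rewrite inE in ex.
have redx : reduce (~: (x : {set E})) = ~: (x : {set E}).
  by rewrite -[LHS]setCK -mclosureC setCK (eqP (flat_setP x)).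
have eqC : ~: (cl M (e |: x) : {set E}) = reduce (~: (x : {set E}) :\ e).
  by rewrite /= -[e |: x]setCK mclosureC setCK setCU setDE setIC.
have := IHn (cl M (e |: x)); rewrite eqC rk_cl_add // nullity_reduce.
rewrite (nullity_drop redx ex) addnS addSn; apply.
apply: leq_trans (_ : #|~: (x : {set E}) :\ e| < n).
  rewrite ltnS; apply: subset_leq_card; rewrite /reduce; case: ifP => // _.
  by apply/subsetP=> f; rewrite inE => /andP[].
by rewrite (cardsD1 e) ex in ltn.
Qed.

Lemma theta_indep1 e : indep M [set e].
Proof.
apply/theta_acyclicP => // i j; suff H k : full [set e] k -> k = path_of e.
  by move=> /H-> /H->.
move/fullP/(_ (path_edge (Ordinal (l_gt0 k))) erefl).
by rewrite inE => /eqP <-.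
Qed.

End ThetaFlats.

Local Open Scope ring_scope.

(** * The operators in coordinates normalized by beta *)

Section Operators.
Variables (R : realFieldType) (E : finType) (M : matroid E).
Hypothesis indep1 : forall e, indep M [set e].
Hypothesis closed1 : forall e, mclosure M [set e] = [set e].
Let V := flat_space R M.
Implicit Types (v w : V) (x : flat M) (e : E) (k : R).

(** The coordinate of [v] on [beta x *: e_ x]: no weight is left when the operators are
   written in this basis. *)
Definition ncoord v x : R := coord_ v x / (beta x)%:R.

Let beta_neq0 x : (beta x)%:R != 0 :> R.
Proof. by rewrite pnatr_eq0 -lt0n beta_gt0. Qed.

Lemma ncoord_lin k v w x : ncoord (k *: v + w) x = k * ncoord v x + ncoord w x.
Proof. by rewrite /ncoord coordP mulrDl mulrA. Qed.

Lemma ncoord0 x : ncoord 0 x = 0.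
Proof. by rewrite /ncoord /coord_ ffunE mul0r. Qed.

Lemma ncoord_eq0 v : (forall x, ncoord v x = 0) -> v = 0.
Proof.
move=> v0; apply/ffunP=> x; rewrite [RHS]ffunE.
have /eqP := v0 x; rewrite /ncoord mulf_eq0 invr_eq0 (negPf (beta_neq0 x)) orbF.
by move/eqP.
Qed.

Lemma ncoordD v w x : ncoord (v + w) x = ncoord v x + ncoord w x.
Proof. by rewrite -[v]scale1r ncoord_lin mul1r scale1r. Qed.

Lemma ncoord_sum (I : Type) (r : seq I) (P : pred I) (F : I -> V) x :
  ncoord (\sum_(i <- r | P i) F i) x = \sum_(i <- r | P i) ncoord (F i) x.
Proof.
elim/big_rec2: _ => [|i y w _ <-]; [exact: ncoord0 | exact: ncoordD].
Qed.

(** In a simple matroid the atoms are the closures of singletons, so that the operators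
   can be indexed by the ground set. *)
Definition edge_op e : 'End(V) := Lbeta R (cl M [set e]).

Lemma ncoord_edge_op e v x :
  ncoord (edge_op e v) x = if e \in (x : {set E}) then 0 else ncoord v (cl M (e |: x)).
Proof.
rewrite /ncoord -dotb_ev -adjointbP lin_ext_e cl_le sub1set.
case: ifP => _; last by rewrite join_cl_set1 dotb_ev.
by rewrite /dotb big1 // => y _; rewrite /coord_ ffunE !mul0r.
Qed.

Lemma ncoord_K v x : ncoord (Kop R M v) x = (rk x)%:R * ncoord v x.
Proof.
rewrite [v in LHS]flat_space_sum linear_sum /= ncoord_sum (bigD1 x) //= big1.
  rewrite addr0 linearZ /= lin_ext_e /ncoord /coord_ !ffunE eqxx.
  by rewrite /GRing.scale /= mulr1 mulrCA mulrA.
move=> y nyx; rewrite linearZ /= lin_ext_e /ncoord /coord_ !ffunE eq_sym (negPf nyx).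
by rewrite /GRing.scale /= !mulr0 mul0r.
Qed.

Lemma ncoord_Sinv v x : ncoord (Sinv R M v) x =
  if x == \top%O then 0 else ncoord v x / (nmiss x)%:R.
Proof.
rewrite [v in LHS]flat_space_sum linear_sum /= ncoord_sum (bigD1 x) //= big1.
  rewrite addr0 linearZ /= lin_ext_e; case: ifP => _.
    by rewrite scaler0 ncoord0.
  rewrite /ncoord /coord_ !ffunE eqxx /GRing.scale /= mulr1; ring.
move=> y nyx; rewrite linearZ /= lin_ext_e; case: ifP => _.
  by rewrite scaler0 ncoord0.
rewrite /ncoord /coord_ !ffunE eq_sym (negPf nyx).
by rewrite /GRing.scale /= !mulr0 mul0r.
Qed.

Lemma ncoord_U v x : ncoord (Ubeta R M v) x =
  \sum_(e in ~: (x : {set E})) ncoord v (cl M (e |: x)).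
Proof.
rewrite /Ubeta sum_lfunE ncoord_sum atomsE // big_imset /=; last first.
  by move=> e f _ _; apply: cl_set1_inj.
rewrite [RHS]big_mkcond; apply: eq_bigr => e _.
by rewrite -/(edge_op e) ncoord_edge_op inE; case: (e \in _).
Qed.

(** The sum has [nmiss x] terms: apart from the factor that stems from [Kop], this
   is an average. *)
Lemma ncoord_D v x : ncoord (Dbeta R M v) x =
  (rk x).+1%:R / #|~: (x : {set E})|%:R *
  \sum_(e in ~: (x : {set E})) ncoord v (cl M (e |: x)).
Proof.
rewrite /Dbeta !comp_lfunE ncoord_Sinv nmissE //.
case: eqP => [->|_]; first by rewrite /= setCT big_set0 mulr0.
rewrite ncoord_U mulrAC mulrC [RHS]mulrC; congr (_ * _).
rewrite mulr_sumr; apply: eq_bigr => e; rewrite inE => ex.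
by rewrite ncoord_K rk_cl_add.
Qed.

Definition of_corank n v :=
  forall x, ncoord v x != 0 -> (rk x + n = rk (\top%O : flat M))%N.

Lemma of_corank_edge_op n e v : of_corank n v -> of_corank n.+1 (edge_op e v).
Proof.
move=> vk x; rewrite ncoord_edge_op; case: ifP => [|ex]; first by rewrite eqxx.
by move/vk; rewrite rk_cl_add ?ex // addnS addSn.
Qed.

Lemma of_corank_D n v : of_corank n v -> of_corank n.+1 (Dbeta R M v).
Proof.
move=> vk x; rewrite ncoord_D => nz.
have [e ex vx] : exists2 e, e \notin (x : {set E}) & ncoord v (cl M (e |: x)) != 0.
  apply: contrapT => none; case/eqP: nz; rewrite big1 ?mulr0 // => e; rewrite inE => ex.
  by apply/eqP; apply: contraT => nz; case: none; exists e.
by have := vk _ vx; rewrite rk_cl_add // addnS addSn.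
Qed.

Lemma of_corank_lin n k v w :
  of_corank n v -> of_corank n w -> of_corank n (k *: v + w).
Proof.
move=> vn wn x; rewrite ncoord_lin; have [v0|/vn //] := eqVneq (ncoord v x) 0.
by rewrite v0 mulr0 add0r; apply: wn.
Qed.

Lemma of_corank0 n : of_corank n 0.
Proof. by move=> x; rewrite ncoord0 eqxx. Qed.

Lemma Cbeta_ind n (P : V -> Prop) : P 0 ->
  (forall k v w, P v -> P w -> P (k *: v + w)) ->
  (forall v, v \in Cbeta R M n -> P (Dbeta R M v)) ->
  (forall e v, v \in Cbeta R M n -> P (edge_op e v)) ->
  forall v, v \in Cbeta R M n.+1 -> P v.
Proof.
move=> P0 Plin PD PL v /memv_addP[_ /memv_imgP[d dC ->] [w wC ->]].
rewrite -[Dbeta R M d]scale1r; apply: (Plin); first exact: PD.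
case/memv_sumP: wC => f fC ->; apply: big_ind => // [u u' uP u'P|a aM].
  by rewrite -[u]scale1r; apply: Plin.
have /memv_imgP[u uC ->] := fC a aM.
by move: aM; rewrite atomsE // => /imsetP[e _ ->]; apply: PL.
Qed.

Lemma Cbeta_D n v : v \in Cbeta R M n -> Dbeta R M v \in Cbeta R M n.+1.
Proof.
move=> vC; rewrite -[Dbeta R M v]addr0 /=.
by apply: memv_add; [apply: memv_img | apply: mem0v].
Qed.

Lemma Cbeta_edge_op n e v : v \in Cbeta R M n -> edge_op e v \in Cbeta R M n.+1.
Proof.
move=> vC; rewrite -[edge_op e v]add0r /=; apply: memv_add; first exact: mem0v.
have eM : cl M [set e] \in atoms M by rewrite atomsE //; apply/imsetP; exists e.
by rewrite memvE; apply: (sumv_sup _ eM); rewrite -memvE; apply: memv_img.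
Qed.

Lemma ncoord_vtop x :
  ncoord (vlevel R M (rk (\top%O : flat M))) x = (x == \top%O)%:R.
Proof.
rewrite /vlevel (big_pred1 \top%O) => [|y] /=; last first.
  apply/eqP/eqP=> [ry|-> //]; apply: rk_le_eq; first exact: lex1.
  by rewrite ry.
rewrite /ncoord /coord_ !ffunE /GRing.scale /=.
by case: eqP => [->|_]; rewrite ?mulr1 ?divff // mulr0 mul0r.
Qed.

End Operators.

(** The vectors that represent the indicator functions of the elements of [J] form a
   basis of [U]. *)
Lemma dimv_rep (R : fieldType) (V : vectType R) (U : {vspace V})
    (I : finType) (J : {set I}) (Rep : V -> (I -> R) -> Prop) :
    (forall c, (forall i, i \notin J -> c i = 0) -> exists2 v, v \in U & Rep v c) ->
    (forall v, v \in U -> exists2 c, forall i, i \notin J -> c i = 0 & Rep v c) ->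
    (forall v w c, Rep v c -> Rep w c -> v = w) ->
    Rep 0 (fun=> 0) ->
    (forall k v w c d, Rep v c -> Rep w d ->
       Rep (k *: v + w) (fun i => k * c i + d i)) ->
    (forall c, (forall i, i \notin J -> c i = 0) -> Rep 0 c -> forall i, c i = 0) ->
  \dim U = #|J|.
Proof.
move=> Rex Rrep Rfun R0 Rlin Rinj.
have /choice[phi phiP] : forall j, exists v : V, j \in J ->
    v \in U /\ Rep v (fun i => (i == j)%:R).
  move=> j; have [jJ|_] := boolP (j \in J); last by exists 0.
  have [|v vU Rv] := Rex (fun i => (i == j)%:R); last by exists v.
  by move=> i iJ; case: eqP iJ => // ->; rewrite jJ.
pose b := [tuple phi (enum_val i) | i < #|J|].
have Rsum (c : I -> R) : Rep (\sum_(i < #|J|) c (enum_val i) *: b`_i)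
    (fun j => if j \in J then c j else 0).
  have -> : \sum_(i < #|J|) c (enum_val i) *: b`_i = \sum_(j in J) c j *: phi j.
    rewrite [RHS]big_enum_val; apply: eq_bigr => i _.
    by rewrite -tnth_nth tnth_mktuple.
  have -> : (fun j => if j \in J then c j else 0) =
      (fun j => \sum_(i <- enum J) c i * (j == i)%:R).
    apply: funext => j; rewrite big_enum; case: ifP => jJ.
      rewrite (bigD1 j) //= eqxx mulr1 big1 ?addr0 // => i /andP[_ /negPf nij].
      by rewrite eq_sym nij mulr0.
    rewrite big1 // => i iJ; case: eqP => [ji|_]; last by rewrite mulr0.
    by rewrite ji iJ in jJ.
  rewrite -big_enum; have : {subset enum J <= J} by move=> j; rewrite mem_enum.
  elim: (enum J) => [_|j s IHs sJ].
    have -> : (fun j => \sum_(i <- [::]) c i * (j == i)%:R) = (fun=> 0).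
      by apply: funext => j; rewrite big_nil.
    by rewrite big_nil.
  have -> : (fun i => \sum_(h <- j :: s) c h * (i == h)%:R) =
      (fun i => c j * (i == j)%:R + \sum_(h <- s) c h * (i == h)%:R).
    by apply: funext => i; rewrite big_cons.
  rewrite big_cons; apply: Rlin; first by apply: (phiP _ (sJ j _)).2; rewrite inE eqxx.
  by apply: IHs => i iS; apply: sJ; rewrite inE iS orbT.
have free_b : free b.
  apply/freeP => k sum0 i.
  pose c j := if insub (index j (enum J)) is Some i then k i else 0.
  have cE h : c (enum_val h) = k h.
    rewrite /c; have -> : index (enum_val h) (enum J) = h.
      by rewrite /enum_val index_uniq ?enum_uniq // -cardE.
    by rewrite valK.
  have := Rsum c; under eq_bigr do rewrite cE.
  rewrite sum0 => R0c.
  have /(_ _ R0c (enum_val i)) := Rinj (fun j => if j \in J then c j else 0).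
  by rewrite enum_valP cE; apply=> j /negPf->.
have span_b : <<b>>%VS = U.
  apply/eqP; rewrite eqEsubv; apply/andP; split.
    apply/span_subvP => _ /mapP[i _ ->]; exact: (phiP _ (enum_valP i)).1.
  apply/subvP=> v vU; have [c cJ Rv] := Rrep v vU.
  have Rs := Rsum c; rewrite (_ : (fun j => _) = c) in Rs; last first.
    by apply: funext => j; case: ifPn => // /cJ->.
  rewrite (Rfun _ _ _ Rv Rs); apply: memv_suml => i _; apply: memvZ.
  by apply: memv_span; apply: mem_nth; rewrite size_tuple.
by rewrite -span_b; move: free_b; rewrite /free => /eqP ->; rewrite size_tuple.
Qed.

(** * The theta graph with paths of lengths 1, t, t, t *)

(** Rewrites the equality tests that hypotheses of the form [a != b] settle. *)
Ltac decide_eqs := repeat match goal with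
  | H : is_true (?a != ?b) |- context [?a == ?b] => rewrite (negbTE H)
  | H : is_true (?a != ?b) |- context [?b == ?a] => rewrite (eq_sym b a) (negbTE H)
  end.

Section ThetaOneThree.
Variable t : nat.
Hypothesis t_gt1 : (1 < t)%N.
Let l := [tuple 1; t; t; t]%N.
Definition gtheta := theta_graph [tuple 1; t; t; t]%N.
Let M := theta_matroid t.
Notation E := (edge gtheta).

Lemma len_gt0 i : (0 < tnth l i)%N.
Proof. by case: i => -[|[|[|[|//]]]] iP //=; rewrite /tnth /=; lia. Qed.

Lemma len_path (i : 'I_3) : tnth l (lift ord0 i) = t.
Proof. by case: i => -[|[|[|//]]]. Qed.

(** [eps] is the path of length one, and [pe i p] the edge in position [p] of the long
   path [i]. *)
Definition eps : E := @path_edge 4 l ord0 (Ordinal (isT : (0 < tnth l ord0)%N)).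

Definition pe (i : 'I_3) (p : 'I_t) : E :=
  @path_edge 4 l (lift ord0 i) (cast_ord (esym (len_path i)) p).

Definition pathof : E -> 'I_4 := @path_of 4 l.

Lemma pathof_pe i p : pathof (pe i p) = lift ord0 i. Proof. by []. Qed.
Lemma pathof_eps : pathof eps = ord0. Proof. by []. Qed.

Lemma pathof_pe_eq i j p q : (pathof (pe i p) == pathof (pe j q)) = (i == j).
Proof. by rewrite !pathof_pe (inj_eq lift_inj). Qed.

Definition pathE := (pathof_pe_eq,
    (fun i p => erefl : (pathof eps == pathof (pe i p)) = false),
  (fun i p => erefl : (pathof (pe i p) == pathof eps) = false)).

Lemma pe_eq i j p q : (pe i p == pe j q) = (i == j) && (p == q).
Proof.
have [<-|nij] /= := eqVneq i j; last first.
  by apply/negbTE; apply: contra nij => /eqP /(congr1 pathof)/lift_inj ->.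
by rewrite /pe /path_edge eq_Tagged /= (inj_eq (@cast_ord_inj _ _ _)).
Qed.

Lemma eps_pe i p : (eps == pe i p) = false. Proof. by []. Qed.
Lemma pe_eps i p : (pe i p == eps) = false. Proof. by []. Qed.

Definition edgeE := (pe_eq, eps_pe, pe_eps).

Variant edge_spec : E -> Type :=
  | EdgeEps : edge_spec eps
  | EdgePath i p : edge_spec (pe i p).

Lemma edgeP e : edge_spec e.
Proof.
case: e => c; case: (unliftP ord0 c) => [i ->|->] k.
  suff -> : existT _ (lift ord0 i) k = pe i (cast_ord (len_path i) k) :> E.
    exact: EdgePath.
  by rewrite /pe cast_ordK.
suff -> : existT _ ord0 k = eps :> E by exact: EdgeEps.
by congr existT; apply: val_inj; case: k => -[].
Qed.

Lemma card_edge : #|E| = (3 * t + 1)%N.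
Proof.
rewrite card_tagged sumnE big_map big_enum /= big_ord_recl /= !card_ord.
under eq_bigr do rewrite card_ord len_path.
by rewrite sum_nat_const card_ord addnC.
Qed.

Notation red := (@reduce 4 l).

Lemma compl_cl (Y : {set E}) : ~: (cl M (~: Y) : {set E}) = red Y.
Proof. by rewrite /= -[RHS]setCK -mclosureC //; exact: len_gt0. Qed.

Lemma reduce_seq (s : seq E) : uniq s ->
  all (fun e => count (fun f => pathof f == pathof e) s != 1%N) s ->
  red [set:: s] = [set:: s].
Proof.
move=> Us /allP H; rewrite /reduce; case: ifP => // _.
apply/setP=> e; rewrite !inE andb_idr // => es.
have [f [fs fe /eqP pf]] : exists f, [/\ f \in s, f != e & pathof f == pathof e].
  apply: contrapT => nof; have := H e es.
  rewrite (@eq_in_count _ _ (pred1 e)) ?count_uniq_mem ?es // => f fs /=.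
  apply/idP/eqP=> [pf|-> //]; apply/eqP; apply: contraT => fe; case: nof.
  by exists f.
by apply/existsP; exists f; rewrite !inE fs fe -/(pathof f) pf eqxx.
Qed.

Lemma closed1 (e : E) : mclosure M [set e] = [set e].
Proof.
rewrite -[in LHS](setCK [set e]) mclosureC; last exact: len_gt0.
pose p0 : 'I_t := Ordinal (ltnW t_gt1); pose p1 : 'I_t := Ordinal t_gt1.
have other i p : exists q : 'I_t, pe i q != pe i p.
  exists (if p == p0 then p1 else p0); rewrite edgeE eqxx /=.
  by case: (eqVneq p p0) => [->|]; rewrite // eq_sym.
rewrite -[RHS]setCK; congr (~: _); rewrite /reduce; case: ifP => // /existsP[c].
move/forall_inP=> noc.
have {noc} mem f : f != e -> pathof f != c by move=> fe; apply: noc; rewrite !inE.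
have ee : e = eps.
  case: (edgeP e) mem => // i p mem; case/eqP: (mem eps isT).
  case: (unliftP ord0 c) mem => [h ->|-> //] mem.
  have [hi|nhi] := eqVneq h i; last first.
    by have := mem (pe h p0); rewrite edgeE (negbTE nhi) pathof_pe eqxx => /(_ isT).
  by have [q /mem] := other i p; rewrite hi pathof_pe eqxx.
apply/setP=> f; rewrite !inE andb_idr // ee; case: (edgeP f) => [|i p _];
  first by rewrite eqxx.
have [q qp] := other i p; apply/existsP; exists (pe i q); rewrite !inE qp.
by rewrite -/(pathof _) -/(pathof _) pathE eqxx.
Qed.

Lemma indep1 (e : E) : indep M [set e].
Proof. by apply: theta_indep1; apply: len_gt0. Qed.

Lemma reduce_seq_eps (s : seq E) i j k p q r : i != j -> i != k -> j != k ->
  eps \in s -> pe i p \in s -> pe j q \in s -> pe k r \in s ->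
  red [set:: s] = [set:: s].
Proof.
move=> ij ik jk es ps qs rs; rewrite /reduce ifF //; apply/existsP=> -[c].
move/forall_inP=> noc; have mem f : f \in s -> pathof f != c.
  by move=> fs; apply: noc; rewrite inE.
case: (unliftP ord0 c) mem => [h ->|->] mem; last by have := mem _ es; rewrite eqxx.
have : h \in [:: i; j; k].
  have U : uniq [:: i; j; k] by rewrite /= !inE negb_or ij ik jk.
  have sub : {subset [:: i; j; k] <= enum 'I_3} by move=> g _; rewrite mem_enum.
  have [|_ ->] := uniq_min_size U sub; first by rewrite size_enum_ord.
  by rewrite mem_enum.
rewrite !inE => /or3P[] /eqP hh; [have := mem _ ps|have := mem _ qs|have := mem _ rs];
  by rewrite hh pathof_pe eqxx.
Qed.

Lemma reduce_absent c (s : seq E) : uniq s -> c \notin map pathof s ->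
  red [set:: s] =
  [set:: [seq e <- s | count (fun f => pathof f == pathof e) s != 1%N]].
Proof.
move=> Us cs; rewrite /reduce ifT; last first.
  apply/existsP; exists c; apply/forall_inP=> e; rewrite inE => es.
  by apply: contraNneq cs => <-; apply: map_f.
apply/setP=> e; rewrite !inE mem_filter andbC; case es: (e \in s); rewrite ?andbF //=.
rewrite andbT; apply/existsP/idP=> [[f]|].
  rewrite inE => /and3P[fs fe pf].
  have : (2 <= count (fun f => pathof f == pathof e) s)%N.
    have := @uniq_leq_size _ [:: e; f] [seq f <- s | pathof f == pathof e].
    rewrite -size_filter; apply; first by rewrite /= inE eq_sym fe.
    by move=> g; rewrite !inE mem_filter => /orP[] /eqP->; rewrite ?eqxx ?es ?fs ?andbT.
  by case: (count _ s) => [|[|n]].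
move=> H; apply: contrapT => nof; case/negP: H; apply/eqP.
rewrite (@eq_in_count _ _ (pred1 e)) ?count_uniq_mem ?es // => f fs /=.
apply/idP/eqP=> [pf|-> //]; apply/eqP; apply: contraT => fe; case: nof.
by exists f; rewrite inE fs fe.
Qed.

Lemma nullity_seq (s : seq E) : uniq s ->
  @nullity 4 l [set:: s] = (size s - minn 3 (size (undup (map pathof s))))%N.
Proof.
move=> Us; rewrite /nullity cardsE (card_uniqP Us); congr (_ - minn _ _)%N.
rewrite -(card_uniqP (undup_uniq _)); apply: eq_card => c; rewrite mem_undup.
apply/imsetP/mapP=> -[e]; rewrite ?inE => es ->; exists e => //.
by rewrite inE.
Qed.

Section Values.
Variable R : realFieldType.
Let V := flat_space R M.
Implicit Types (v w : V) (s : seq E).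

Definition flat_of s : flat M := cl M (~: [set:: s]).

(** Sets of edges are given by lists.  The closure in [flat_of s] gives a meaning to
   [value v s] when the complement of [s] is not closed, as happens after an edge of
   the complement of a flat has been dropped. *)
Definition value v s : R := ncoord v (flat_of s).

Lemma value_eq v s s' : s =i s' -> value v s = value v s'.
Proof.
by move=> ss; rewrite /value /flat_of (_ : [set:: s] = [set:: s']) //;
  apply/setP=> e; rewrite !inE ss.
Qed.

(** The complement of [s] contains a complete path, so that [reduce] drops the edges
   that are alone on theirs. *)
Lemma value_absent c v s : uniq s -> c \notin map pathof s ->
  value v s = value v [seq e <- s | count (fun f => pathof f == pathof e) s != 1%N].
Proof.
move=> Us cs; rewrite /value; congr ncoord; apply: val_inj => /=.
rewrite !mclosureC ?(reduce_absent Us cs); try exact: len_gt0.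
set s' := [seq e <- s | _]; congr (~: _); apply/esym/(@reduce_seq s').
  exact: filter_uniq.
apply/allP=> e; rewrite mem_filter => /andP[e1 es].
suff -> : count (fun f => pathof f == pathof e) s' =
  count (fun f => pathof f == pathof e) s by [].
rewrite -!size_filter -filter_predI; congr size; apply: eq_filter => f /=.
by apply: andb_idr => /eqP ->.
Qed.

(** The accumulator [s0] makes these sums compute on explicit lists without any
   comparison of edges. *)
Fixpoint pick_sum (F : E -> seq E -> R) s0 s : R :=
  if s is e :: s' then F e (s0 ++ s') + pick_sum F (rcons s0 e) s' else 0.

Lemma pick_sumE F s : uniq s -> (forall e s s', s =i s' -> F e s = F e s') ->
  pick_sum F [::] s = \sum_(e <- s) F e [seq f <- s | f != e].
Proof.
move=> + eqF; rewrite -[s in uniq s]cat0s -[in RHS](cat0s s).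
have -> : \sum_(e <- [::] ++ s) F e [seq f <- [::] ++ s | f != e] =
  \sum_(e <- s) F e [seq f <- [::] ++ s | f != e] by [].
elim: s [::] => [|e s IHs] s0 Us /=; first by rewrite big_nil.
rewrite big_cons -cat_rcons -IHs ?cat_rcons //; congr (_ + _); apply: eqF => f.
move: Us; rewrite mem_filter !mem_cat inE cat_uniq /= negb_or.
case/and3P=> _ /andP[es0 _] /andP[es _].
by have [->|] := eqVneq f e; rewrite ?(negbTE es0) ?(negbTE es).
Qed.

(** With weights [g] this covers both [edge_op e] (the indicator of [e]) and [Dbeta]
   (constant weights). *)
Definition drop_sum (g : E -> R) v s := pick_sum (fun e s' => g e * value v s') [::] s.

Lemma value_drop (s : seq E) e : red [set:: s] = [set:: s] -> e \in s ->
  cl M (e |: flat_of s) = flat_of [seq f <- s | f != e].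
Proof.
move=> reds es; apply: val_inj; rewrite /= mclosureC ?reds; last exact: len_gt0.
congr mclosure; apply/setP=> f; rewrite !inE mem_filter negb_and negbK.
by [].
Qed.

Lemma drop_sumE g v s : uniq s ->
    drop_sum g v s = \sum_(e <- s) g e * value v [seq f <- s | f != e].
Proof.
by move=> Us; rewrite /drop_sum pick_sumE // => e s1 s2 /value_eq ->.
Qed.

Lemma flat_ofC s : red [set:: s] = [set:: s] -> ~: (flat_of s : {set E}) = [set:: s].
Proof. by rewrite compl_cl. Qed.

Notation L e := (edge_op R M e).

Lemma value_edge_op e v s : uniq s -> red [set:: s] = [set:: s] ->
  value (L e v) s = drop_sum (fun f => (f == e)%:R) v s.
Proof.
move=> Us reds; rewrite drop_sumE // /value ncoord_edge_op.
have -> : (e \in (flat_of s : {set E})) = (e \notin s).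
  by rewrite -[LHS]negbK -in_setC flat_ofC // inE.
have [es|es] /= := boolP (e \in s); last first.
  rewrite big_seq big1 // => f fs; case: eqP => [fe|_]; last by rewrite mul0r.
  by rewrite -fe fs in es.
rewrite (bigD1_seq e) // (eqxx e) mul1r big1 => [|f /negPf->]; last by rewrite mul0r.
exact: etrans (congr1 (ncoord v) (value_drop reds es)) (esym (addr0 _)).
Qed.

Lemma value_D v s : uniq s -> red [set:: s] = [set:: s] ->
  value (Dbeta R M v) s =
  ((rk (\top%O : flat M)).+1 - @nullity 4 l [set:: s])%:R / (size s)%:R
    * drop_sum (fun=> 1) v s.
Proof.
move=> Us reds; rewrite drop_sumE // /value ncoord_D; last first.
- exact: closed1.
- exact: indep1.
rewrite flat_ofC // cardsE (card_uniqP Us); congr (_%:R / _ * _).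
  have := @rk_nullity 4 l len_gt0 (flat_of s); rewrite flat_ofC // => <-.
  by rewrite -addSn addnK.
transitivity (\sum_(e in s) ncoord v (cl M (e |: flat_of s))).
  by apply: eq_bigl => e; rewrite inE.
rewrite -big_uniq // [LHS]big_seq [RHS]big_seq; apply: eq_bigr => e es.
by rewrite mul1r value_drop.
Qed.

End Values.

End ThetaOneThree.

(* Unification must not unfold edges and values when it compares explicit lists. *)
Arguments pathof : simpl never.
Arguments pe : simpl never.
Arguments eps : simpl never.
Opaque pe eps pathof value.

(** * Shapes of small corank *)

Section Boundaries.
Variables (t : nat) (R : realFieldType).
Hypothesis t_gt1 : (1 < t)%N.
Notation V := (flat_space R (theta_matroid t)).
Implicit Types (i j k : 'I_3) (p q r : 'I_t).
Notation pe := (@pe t).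
Notation eps := (eps t).
Variables (g : edge (gtheta t) -> R) (v : V).

Lemma ord_eqxx n (a : 'I_n) : (a == a) = true. Proof. exact: eqxx. Qed.

Ltac edges := repeat progress (rewrite ?inE ?edgeE ?pathE ?ord_eqxx; decide_eqs;
  rewrite ?andbF ?andbT /=).
Ltac absent c := rewrite (@value_absent t t_gt1 R c) /=; edges.

Lemma pick_sum2 (F : edge (gtheta t) -> seq (edge (gtheta t)) -> R) a b :
  pick_sum F [::] [:: a; b] =
  F a [:: b] + F b [:: a].
Proof. by rewrite /= !addrA addr0. Qed.

Lemma pick_sum3 (F : edge (gtheta t) -> seq (edge (gtheta t)) -> R) a b c :
  pick_sum F [::] [:: a; b; c] =
  F a [:: b; c] + F b [:: a; c] + F c [:: a; b].
Proof. by rewrite /= !addrA addr0. Qed.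

Lemma pick_sum4 (F : edge (gtheta t) -> seq (edge (gtheta t)) -> R) a b c d :
  pick_sum F [::] [:: a; b; c; d] =
  F a [:: b; c; d] + F b [:: a; c; d] + F c [:: a; b; d] + F d [:: a; b; c].
Proof. by rewrite /= !addrA addr0. Qed.

Lemma pick_sum5 (F : edge (gtheta t) -> seq (edge (gtheta t)) -> R) a b c d e :
  pick_sum F [::] [:: a; b; c; d; e] =
  F a [:: b; c; d; e] + F b [:: a; c; d; e] + F c [:: a; b; d; e] +
  F d [:: a; b; c; e] + F e [:: a; b; c; d].
Proof. by rewrite /= !addrA addr0. Qed.

Lemma pick_sum6 (F : edge (gtheta t) -> seq (edge (gtheta t)) -> R) a b c d e f :
  pick_sum F [::] [:: a; b; c; d; e; f] =
  F a [:: b; c; d; e; f] + F b [:: a; c; d; e; f] + F c [:: a; b; d; e; f] +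
  F d [:: a; b; c; e; f] + F e [:: a; b; c; d; f] + F f [:: a; b; c; d; e].
Proof. by rewrite /= !addrA addr0. Qed.

Definition pick_sum_expand := (pick_sum2, pick_sum3, pick_sum4, pick_sum5, pick_sum6).

(** In the names below, a digit counts the edges on a long path, and [e] stands for
   [eps]. *)
Lemma value_1 i p : value v [:: pe i p] = value v [::].
Proof. by move=> *; absent (pathof eps). Qed.

Lemma value_12 i j p q q' : i != j -> q != q' ->
    value v [:: pe i p; pe j q; pe j q'] = value v [:: pe j q; pe j q'].
Proof. by move=> *; absent (pathof eps). Qed.

Lemma value_21 i j p p' q : i != j -> p != p' ->
    value v [:: pe i p; pe i p'; pe j q] = value v [:: pe i p; pe i p'].
Proof. by move=> *; absent (pathof eps). Qed.

Lemma value_111 i j k p q r : i != j -> i != k -> j != k ->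
    value v [:: pe i p; pe j q; pe k r] = value v [::].
Proof. by move=> *; absent (pathof eps). Qed.

Lemma value_e11 i j k p q : i != j -> i != k -> j != k ->
    value v [:: eps; pe i p; pe j q] = value v [::].
Proof. by move=> *; absent (lift ord0 k). Qed.

Lemma value_211 i j k p p' q r : i != j -> i != k -> j != k -> p != p' ->
    value v [:: pe i p; pe i p'; pe j q; pe k r] = value v [:: pe i p; pe i p'].
Proof. by move=> *; absent (pathof eps). Qed.

Lemma value_e21 i j k p p' q : i != j -> i != k -> j != k -> p != p' ->
    value v [:: eps; pe i p; pe i p'; pe j q] = value v [:: pe i p; pe i p'].
Proof. by move=> *; absent (lift ord0 k). Qed.

Lemma value_31 i j p p' p'' q : i != j -> p != p' -> p != p'' -> p' != p'' ->
    value v [:: pe i p; pe i p'; pe i p''; pe j q] = value v [:: pe i p; pe i p';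
    pe i p''].
Proof. by move=> *; absent (pathof eps). Qed.

Lemma value_122 i j k p q q' r r' : i != j -> i != k -> j != k -> q != q' ->
    r != r' -> value v [:: pe i p; pe j q; pe j q'; pe k r;
    pe k r'] = value v [:: pe j q; pe j q'; pe k r; pe k r'].
Proof. by move=> *; absent (pathof eps). Qed.

Lemma value_212 i j k p p' q r r' : i != j -> i != k -> j != k -> p != p' ->
    r != r' -> value v [:: pe i p; pe i p'; pe j q; pe k r;
    pe k r'] = value v [:: pe i p; pe i p'; pe k r; pe k r'].
Proof. by move=> *; absent (pathof eps). Qed.

Lemma value_221 i j k p p' q q' r : i != j -> i != k -> j != k -> p != p' ->
    q != q' -> value v [:: pe i p; pe i p'; pe j q; pe j q';
    pe k r] = value v [:: pe i p; pe i p'; pe j q; pe j q'].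
Proof. by move=> *; absent (pathof eps). Qed.

Lemma value_311 i j k p p' p'' q r : i != j -> i != k -> j != k -> p != p' ->
    p != p'' -> p' != p'' -> value v [:: pe i p; pe i p'; pe i p''; pe j q;
    pe k r] = value v [:: pe i p; pe i p'; pe i p''].
Proof. by move=> *; absent (pathof eps). Qed.

Lemma value_e31 i j k p p' p'' q : i != j -> i != k -> j != k -> p != p' ->
    p != p'' -> p' != p'' -> value v [:: eps; pe i p; pe i p'; pe i p'';
    pe j q] = value v [:: pe i p; pe i p'; pe i p''].
Proof. by move=> *; absent (lift ord0 k). Qed.

Lemma value_e22 i j k p p' q q' : i != j -> i != k -> j != k -> p != p' ->
    q != q' -> value v [:: eps; pe i p; pe i p'; pe j q;
    pe j q'] = value v [:: pe i p; pe i p'; pe j q; pe j q'].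
Proof. by move=> *; absent (lift ord0 k). Qed.

Lemma value_e121 i j k p q q' r : value v [:: eps; pe i p; pe j q; pe j q';
    pe k r] = value v [:: eps; pe j q; pe j q'; pe i p; pe k r].
Proof.
by apply: value_eq => x; rewrite !inE; case: (x == eps); case: (x == pe i p);
  case: (x == pe j q); case: (x == pe j q').
Qed.

Lemma drop_sum_2 i p p' : p != p' ->
  drop_sum g v [:: pe i p; pe i p'] =
  g (pe i p) * value v [::]
  + g (pe i p') * value v [::].
Proof. by move=> *; rewrite /drop_sum pick_sum_expand !value_1. Qed.

Lemma drop_sum_e111 i j k p q r : i != j -> i != k -> j != k ->
  drop_sum g v [:: eps; pe i p; pe j q; pe k r] =
  g (eps) * value v [::]
  + g (pe i p) * value v [::]
  + g (pe j q) * value v [::]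
  + g (pe k r) * value v [::].
Proof.
by move=> *; rewrite /drop_sum pick_sum_expand value_111 ?(@value_e11 j k i)
  ?(@value_e11 i k j) ?(@value_e11 i j k); edges.
Qed.

Lemma drop_sum_3 i p p' p'' : p != p' -> p != p'' -> p' != p'' ->
  drop_sum g v [:: pe i p; pe i p'; pe i p''] =
  g (pe i p) * value v [:: pe i p'; pe i p'']
  + g (pe i p') * value v [:: pe i p; pe i p'']
  + g (pe i p'') * value v [:: pe i p; pe i p'].
Proof. by move=> *; rewrite /drop_sum pick_sum_expand. Qed.

Lemma drop_sum_22 i j p p' q q' : i != j -> p != p' -> q != q' ->
  drop_sum g v [:: pe i p; pe i p'; pe j q; pe j q'] =
  g (pe i p) * value v [:: pe j q; pe j q']
  + g (pe i p') * value v [:: pe j q; pe j q']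
  + g (pe j q) * value v [:: pe i p; pe i p']
  + g (pe j q') * value v [:: pe i p; pe i p'].
Proof.
by move=> *; rewrite /drop_sum pick_sum_expand !value_12 // !value_21; edges.
Qed.

Lemma drop_sum_e211 i j k p p' q r : i != j -> i != k -> j != k -> p != p' ->
  drop_sum g v [:: eps; pe i p; pe i p'; pe j q; pe k r] =
  g (eps) * value v [:: pe i p; pe i p']
  + g (pe i p) * value v [:: eps; pe i p'; pe j q; pe k r]
  + g (pe i p') * value v [:: eps; pe i p; pe j q; pe k r]
  + g (pe j q) * value v [:: pe i p; pe i p']
  + g (pe k r) * value v [:: pe i p; pe i p'].
Proof.
by move=> *; rewrite /drop_sum pick_sum_expand value_211 ?(@value_e21 i k j)
  ?(@value_e21 i j k); edges.
Qed.

Lemma drop_sum_4 i p p' p'' p''' : p != p' -> p != p'' -> p != p''' -> p' != p'' ->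
    p' != p''' -> p'' != p''' ->
  drop_sum g v [:: pe i p; pe i p'; pe i p''; pe i p'''] =
  g (pe i p) * value v [:: pe i p'; pe i p''; pe i p''']
  + g (pe i p') * value v [:: pe i p; pe i p''; pe i p''']
  + g (pe i p'') * value v [:: pe i p; pe i p'; pe i p''']
  + g (pe i p''') * value v [:: pe i p; pe i p'; pe i p''].
Proof. by move=> *; rewrite /drop_sum pick_sum_expand. Qed.

Lemma drop_sum_32 i j p p' p'' q q' : i != j -> p != p' -> p != p'' -> p' != p'' ->
    q != q' ->
  drop_sum g v [:: pe i p; pe i p'; pe i p''; pe j q; pe j q'] =
  g (pe i p) * value v [:: pe i p'; pe i p''; pe j q; pe j q']
  + g (pe i p') * value v [:: pe i p; pe i p''; pe j q; pe j q']
  + g (pe i p'') * value v [:: pe i p; pe i p'; pe j q; pe j q']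
  + g (pe j q) * value v [:: pe i p; pe i p'; pe i p'']
  + g (pe j q') * value v [:: pe i p; pe i p'; pe i p''].
Proof. by move=> *; rewrite /drop_sum pick_sum_expand !value_31; edges. Qed.

Lemma drop_sum_222 i j k p p' q q' r r' : i != j -> i != k -> j != k -> p != p' ->
    q != q' -> r != r' ->
  drop_sum g v [:: pe i p; pe i p'; pe j q; pe j q'; pe k r; pe k r'] =
  g (pe i p) * value v [:: pe j q; pe j q'; pe k r; pe k r']
  + g (pe i p') * value v [:: pe j q; pe j q'; pe k r; pe k r']
  + g (pe j q) * value v [:: pe i p; pe i p'; pe k r; pe k r']
  + g (pe j q') * value v [:: pe i p; pe i p'; pe k r; pe k r']
  + g (pe k r) * value v [:: pe i p; pe i p'; pe j q; pe j q']
  + g (pe k r') * value v [:: pe i p; pe i p'; pe j q; pe j q'].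
Proof.
by move=> *; rewrite /drop_sum pick_sum_expand !value_122 // !value_212 //
  !value_221; edges.
Qed.

Lemma drop_sum_e311 i j k p p' p'' q r : i != j -> i != k -> j != k -> p != p' ->
    p != p'' -> p' != p'' ->
  drop_sum g v [:: eps; pe i p; pe i p'; pe i p''; pe j q; pe k r] =
  g (eps) * value v [:: pe i p; pe i p'; pe i p'']
  + g (pe i p) * value v [:: eps; pe i p'; pe i p''; pe j q; pe k r]
  + g (pe i p') * value v [:: eps; pe i p; pe i p''; pe j q; pe k r]
  + g (pe i p'') * value v [:: eps; pe i p; pe i p'; pe j q; pe k r]
  + g (pe j q) * value v [:: pe i p; pe i p'; pe i p'']
  + g (pe k r) * value v [:: pe i p; pe i p'; pe i p''].
Proof.
by move=> *; rewrite /drop_sum pick_sum_expand value_311 ?(@value_e31 i k j)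
  ?(@value_e31 i j k); edges.
Qed.

Lemma drop_sum_e221 i j k p p' q q' r : i != j -> i != k -> j != k -> p != p' ->
    q != q' ->
  drop_sum g v [:: eps; pe i p; pe i p'; pe j q; pe j q'; pe k r] =
  g (eps) * value v [:: pe i p; pe i p'; pe j q; pe j q']
  + g (pe i p) * value v [:: eps; pe j q; pe j q'; pe i p'; pe k r]
  + g (pe i p') * value v [:: eps; pe j q; pe j q'; pe i p; pe k r]
  + g (pe j q) * value v [:: eps; pe i p; pe i p'; pe j q'; pe k r]
  + g (pe j q') * value v [:: eps; pe i p; pe i p'; pe j q; pe k r]
  + g (pe k r) * value v [:: pe i p; pe i p'; pe j q; pe j q'].
Proof.
by move=> *; rewrite /drop_sum pick_sum_expand (value_e121 i j k p' q q' r)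
  (value_e121 i j k p q q' r) (@value_221 i j k p p' q q' r) ?(@value_e22 i j k p p'
  q q'); edges.
Qed.

(** [coflat n s]: [s] lists the complement of a flat of corank [n]. *)
Definition coflat n (s : seq (edge (gtheta t))) : Prop :=
  [/\ uniq s, @reduce 4 [tuple 1; t; t; t]%N [set:: s] = [set:: s] &
      @nullity 4 [tuple 1; t; t; t]%N [set:: s] = n].

Lemma coflat_2 i p p' : p != p' -> coflat 1 [:: pe i p; pe i p'].
Proof.
move=> *; have U : uniq [:: pe i p; pe i p'] by rewrite /=; edges.
split=> //; first by apply: reduce_seq => //=; edges.
by rewrite nullity_seq //=; edges.
Qed.

Lemma coflat_e111 i j k p q r : i != j -> i != k -> j != k ->
    coflat 1 [:: eps; pe i p; pe j q; pe k r].
Proof.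
move=> *; have U : uniq [:: eps; pe i p; pe j q; pe k r] by rewrite /=; edges.
split=> //; first by apply: (@reduce_seq_eps t _ i j k p q r) => //;
rewrite !inE ?eqxx ?orbT.
by rewrite nullity_seq //=; edges.
Qed.

Lemma coflat_3 i p p' p'' : p != p' -> p != p'' -> p' != p'' ->
    coflat 2 [:: pe i p; pe i p'; pe i p''].
Proof.
move=> *; have U : uniq [:: pe i p; pe i p'; pe i p''] by rewrite /=; edges.
split=> //; first by apply: reduce_seq => //=; edges.
by rewrite nullity_seq //=; edges.
Qed.

Lemma coflat_22 i j p p' q q' : i != j -> p != p' -> q != q' ->
    coflat 2 [:: pe i p; pe i p'; pe j q; pe j q'].
Proof.
move=> *; have U : uniq [:: pe i p; pe i p'; pe j q; pe j q'] by rewrite /=; edges.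
split=> //; first by apply: reduce_seq => //=; edges.
by rewrite nullity_seq //=; edges.
Qed.

Lemma coflat_e211 i j k p p' q r : i != j -> i != k -> j != k -> p != p' ->
    coflat 2 [:: eps; pe i p; pe i p'; pe j q; pe k r].
Proof.
move=> *; have U : uniq [:: eps; pe i p; pe i p'; pe j q; pe k r] by rewrite /=; edges.
split=> //; first by apply: (@reduce_seq_eps t _ i j k p q r) => //;
rewrite !inE ?eqxx ?orbT.
by rewrite nullity_seq //=; edges.
Qed.

Lemma coflat_4 i p p' p'' p''' : p != p' -> p != p'' -> p != p''' -> p' != p'' ->
    p' != p''' -> p'' != p''' -> coflat 3 [:: pe i p; pe i p'; pe i p''; pe i p'''].
Proof.
move=> *; have U : uniq [:: pe i p; pe i p'; pe i p''; pe i p'''] by rewrite /=; edges.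
split=> //; first by apply: reduce_seq => //=; edges.
by rewrite nullity_seq //=; edges.
Qed.

Lemma coflat_32 i j p p' p'' q q' : i != j -> p != p' -> p != p'' -> p' != p'' ->
    q != q' -> coflat 3 [:: pe i p; pe i p'; pe i p''; pe j q; pe j q'].
Proof.
move=> *; have U : uniq [:: pe i p; pe i p'; pe i p''; pe j q;
  pe j q'] by rewrite /=; edges.
split=> //; first by apply: reduce_seq => //=; edges.
by rewrite nullity_seq //=; edges.
Qed.

Lemma coflat_222 i j k p p' q q' r r' : i != j -> i != k -> j != k -> p != p' ->
    q != q' -> r != r' -> coflat 3 [:: pe i p; pe i p'; pe j q; pe j q'; pe k r;
    pe k r'].
Proof.
move=> *; have U : uniq [:: pe i p; pe i p'; pe j q; pe j q'; pe k r;
  pe k r'] by rewrite /=; edges.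
split=> //; first by apply: reduce_seq => //=; edges.
by rewrite nullity_seq //=; edges.
Qed.

Lemma coflat_e311 i j k p p' p'' q r : i != j -> i != k -> j != k -> p != p' ->
    p != p'' -> p' != p'' -> coflat 3 [:: eps; pe i p; pe i p'; pe i p''; pe j q;
    pe k r].
Proof.
move=> *; have U : uniq [:: eps; pe i p; pe i p'; pe i p''; pe j q;
  pe k r] by rewrite /=; edges.
split=> //; first by apply: (@reduce_seq_eps t _ i j k p q r) => //;
rewrite !inE ?eqxx ?orbT.
by rewrite nullity_seq //=; edges.
Qed.

Lemma coflat_e221 i j k p p' q q' r : i != j -> i != k -> j != k -> p != p' ->
    q != q' -> coflat 3 [:: eps; pe i p; pe i p'; pe j q; pe j q'; pe k r].
Proof.
move=> *; have U : uniq [:: eps; pe i p; pe i p'; pe j q; pe j q';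
  pe k r] by rewrite /=; edges.
split=> //; first by apply: (@reduce_seq_eps t _ i j k p q r) => //;
rewrite !inE ?eqxx ?orbT.
by rewrite nullity_seq //=; edges.
Qed.

End Boundaries.

(** * Classification of the flats of corank at most three *)

Section Classification.
Variables (t : nat) (R : realFieldType).
Hypothesis t_gt1 : (1 < t)%N.
Notation M := (theta_matroid t).
Notation V := (flat_space R M).
Implicit Types (i j k : 'I_3) (p q r : 'I_t).
Notation E := (edge (gtheta t)).
Notation pe := (@pe t).
Notation eps := (eps t).
Notation coflat := (@coflat t).
Implicit Types (v : V) (s : seq E).

Lemma coflat_flat n s : coflat n s -> (rk (flat_of s) + n = rk (\top%O : flat M))%N.
Proof.
by case=> Us reds <-; rewrite -(rk_nullity (len_gt0 t_gt1) (flat_of s)) flat_ofC.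
Qed.

Lemma coflat_value_edge_op n e v s : coflat n s ->
  value (edge_op R M e v) s = drop_sum (fun f => (f == e)%:R) v s.
Proof. by case=> Us reds _; apply: value_edge_op. Qed.

(** The rank of the flats of corank [n.-1], which [Kop] contributes to the values of
   [Dbeta v] in corank [n] *)
Definition D_scale n : R := ((rk (\top%O : flat M)).+1 - n)%:R.

Lemma coflat_D_scale n s : coflat n s -> D_scale n != 0.
Proof.
by move/coflat_flat; rewrite /D_scale pnatr_eq0 => <-; rewrite -addSn addnK.
Qed.

Lemma coflat_value_D n v s : coflat n s ->
  value (Dbeta R M v) s = D_scale n * ((size s)%:R^-1 * drop_sum (fun=> 1) v s).
Proof. by case=> Us reds <-; rewrite value_D // mulrA. Qed.

Lemma coflat_eq n s s' : uniq s' -> s =i s' -> coflat n s -> coflat n s'.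
Proof.
move=> Us' ss [Us reds nul]; have ss' : [set:: s] = [set:: s'] :> {set E}.
  by apply/setP=> e; rewrite !inE ss.
by split=> //; rewrite -ss'.
Qed.

Lemma value_ext n v : of_corank n v -> (forall s, coflat n s -> value v s = 0) -> v = 0.
Proof.
move=> vn v0; apply: ncoord_eq0 => x; apply/eqP; apply: contraT => vx; have nz := vx.
pose s := enum (~: (x : {set E})).
have sE : [set:: s] = ~: (x : {set E}) by apply/setP=> e; rewrite inE mem_enum.
have xs : flat_of s = x.
  by apply: val_inj; rewrite /= sE setCK; exact: (eqP (flat_setP x)).
case/eqP: vx; rewrite -xs; apply: v0; split; first exact: enum_uniq.
  by rewrite sE -compl_cl // setCK /= (eqP (flat_setP x)).
by have := vn x nz; rewrite sE -(rk_nullity (len_gt0 t_gt1) x) => /addnI.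
Qed.

Definition i0 : 'I_3 := @Ordinal 3 0 isT.
Definition i1 : 'I_3 := @Ordinal 3 1 isT.
Definition i2 : 'I_3 := @Ordinal 3 2 isT.

Lemma ord3P (P : 'I_3 -> Prop) : P i0 -> P i1 -> P i2 -> forall i, P i.
Proof.
move=> P0 P1 P2 i; have : i \in [:: i0; i1; i2].
  by case: i => -[|[|[|//]]] ip; rewrite !inE -!val_eqE.
by rewrite !inE => /or3P[] /eqP->.
Qed.

Definition edge_list (b : bool) (s0 s1 s2 : seq 'I_t) : seq E :=
  nseq b eps ++ map (pe i0) s0 ++ map (pe i1) s1 ++ map (pe i2) s2.

(** With [eps], a complement of a flat meets every path, and its nullity is its
   cardinality minus three; without [eps], no path is met in a single edge, and each
   path that is met contributes its number of edges minus one to the nullity. *)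
Lemma coflat_edge_list n s : coflat n s -> exists b (u0 u1 u2 : seq 'I_t),
  [/\ s =i edge_list b u0 u1 u2, uniq u0, uniq u1 & uniq u2] /\
  if b then
    [/\ 0 < size u0, 0 < size u1, 0 < size u2 &
        size u0 + size u1 + size u2 = n + 2]%N
  else
    [/\ size u0 != 1, size u1 != 1, size u2 != 1 &
        (size u0).-1 + (size u1).-1 + (size u2).-1 = n]%N.
Proof.
move=> cfg; pose f i := [seq p <- enum 'I_t | pe i p \in s].
have mem_f i p : (p \in f i) = (pe i p \in s) by rewrite mem_filter mem_enum andbT.
have Uf i : uniq (f i) by rewrite filter_uniq ?enum_uniq.
have mem_pe i j p (u : seq 'I_t) : (pe i p \in map (pe j) u) = (i == j) && (p \in u).
  apply/mapP/andP=> [[q qu /eqP]|[/eqP-> pu]]; last by exists p.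
  by rewrite pe_eq => /andP[-> /eqP->].
have mem_eps j (u : seq 'I_t) : (eps \in map (pe j) u) = false.
  by apply/mapP=> -[q _ /eqP]; rewrite eps_pe.
pose b := eps \in s; pose c := edge_list b (f i0) (f i1) (f i2).
have sc : s =i c.
  move=> e; rewrite /c /edge_list !mem_cat mem_nseq lt0b; case: (edgeP e) => [|i p].
    by rewrite !mem_eps !orbF -/b; case: (b); rewrite ?eqxx.
  rewrite !mem_pe !mem_f pe_eps andbF /=.
  by move: i; apply: ord3P; rewrite /= ?orbF.
have Umap i : uniq (map (pe i) (f i)).
  by rewrite map_inj_uniq // => p q /eqP; rewrite pe_eq eqxx => /eqP.
have Uc : uniq c.
  rewrite /c /edge_list !cat_uniq !Umap !andbT /= !has_cat.
  have dis i j : i != j -> has [in map (pe i) (f i)] (map (pe j) (f j)) = false.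
    move=> ij; apply/hasPn=> _ /mapP[p _ ->] /=.
    by rewrite mem_pe eq_sym (negbTE ij).
  have dise i : has [in nseq b eps] (map (pe i) (f i)) = false.
    by apply/hasPn=> _ /mapP[p _ ->] /=; rewrite mem_nseq pe_eps andbF.
  by rewrite !dise !dis //=; case: (b).
have [_ redc nulc] := coflat_eq Uc sc cfg.
have cnt_eps : count (fun e => pathof e == pathof eps) c = b.
  rewrite /c /edge_list !count_cat !count_map count_nseq eqxx mul1n.
  have z i : count (preim (pe i) (fun e => pathof e == pathof eps)) (f i) = 0%N.
    by apply/eqP; rewrite -leqn0 leqNgt -has_count; apply/hasPn=> p _;
      change (pathof (pe i p) != pathof eps); rewrite pathof_pe pathof_eps.
  by rewrite !z !addn0.
have cnt i : count (fun e => pathof e == lift ord0 i) c = size (f i).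
  have cntj j : count (preim (pe j) (fun e => pathof e == lift ord0 i)) (f j) =
      ((j == i) * size (f j))%N.
    rewrite (@eq_count _ _ (fun=> j == i)) => [|p /=].
      by case: (j == i); rewrite ?count_predT ?count_pred0 ?mul1n.
    by rewrite pathof_pe (inj_eq lift_inj).
  rewrite /c /edge_list !count_cat !count_map count_nseq !cntj.
  have -> : (pathof eps == lift ord0 i) = false by rewrite pathof_eps.
  by move: i {cntj}; apply: ord3P; rewrite /= !(mul0n, mul1n, add0n, addn0).
pose d := map (@pathof t) c.
have mem_d h : (h \in d) = (0 < count (fun e => pathof e == h) c)%N.
  by rewrite -has_count; apply/mapP/hasP=> -[e ec]; [move->; exists e | move/eqP;
    exists e].
have sz_d : size (undup d) = (b + (0 < size (f i0)) + (0 < size (f i1)) +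
  (0 < size (f i2)))%N.
  have -> : size (undup d) = size [seq h <- [:: pathof eps; lift ord0 i0;
    lift ord0 i1; lift ord0 i2] | h \in d].
    apply/perm_size/uniq_perm; rewrite ?undup_uniq ?filter_uniq // => h.
    rewrite mem_undup mem_filter andb_idr // => _.
    case: (unliftP ord0 h) => [i|] -> //.
    by move: i; apply: ord3P; rewrite !inE eqxx ?orbT.
  rewrite size_filter /= !mem_d cnt_eps !cnt addn0 !addnA; by case: (b).
have szc : size c = (b + size (f i0) + size (f i1) + size (f i2))%N.
  by rewrite /c /edge_list !size_cat !size_map size_nseq !addnA.
rewrite nullity_seq // -/d sz_d szc in nulc.
exists b, (f i0), (f i1), (f i2); split; first by rewrite !Uf.
have memc_eps : b -> eps \in c by rewrite -sc.
case: (b) cnt_eps memc_eps nulc => /= cnt_eps memc_eps nulc.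
  have pos i : (0 < size (f i))%N.
    rewrite lt0n; apply/negP=> /eqP fi0.
    have absent : lift ord0 i \notin map (@pathof t) c by rewrite -/d mem_d cnt fi0.
    have := memc_eps isT; have /setP/(_ eps) := reduce_absent Uc absent.
    by rewrite redc !inE mem_filter cnt_eps => ->.
  split; rewrite ?pos //; have [h0 h1 h2] := And3 (pos i0) (pos i1) (pos i2).
  by move: nulc; rewrite h0 h1 h2 /=; lia.
have absent : pathof eps \notin map (@pathof t) c by rewrite -/d mem_d cnt_eps.
have no1 i : size (f i) != 1%N.
  apply/negP=> /eqP fi1; have [p pf] : exists p, p \in f i.
    by case: (f i) fi1 => // p u _; exists p; rewrite inE eqxx.
  have : pe i p \in c by rewrite -sc -mem_f.
  have /setP/(_ (pe i p)) := reduce_absent Uc absent.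
  by rewrite redc !inE mem_filter pathof_pe cnt fi1 => ->.
by split=> //; move: nulc (no1 i0) (no1 i1) (no1 i2); case: (size (f i0)) => [|[|?]];
  case: (size (f i1)) => [|[|?]]; case: (size (f i2)) => [|[|?]] //=; lia.
Qed.

Ltac split_uniq := repeat match goal with
  | H : is_true (_ && _) |- _ => let H1 := fresh in let H2 := fresh in
      case/andP: H => H1 H2
  end.

Ltac same_elements := let x := fresh "x" in
  move=> x; rewrite !inE; repeat match goal with |- context [x == ?a] => case: (x ==
    a) => //= end.

(** A vector supported in corank 1, 2 or 3 is determined by its values on the shapes
   that the constraints of [coflat_edge_list] leave. *)
Lemma value_ext1 v : of_corank 1 v ->
  (forall i p p', p != p' -> value v [:: pe i p; pe i p'] = 0) ->
  (forall i j k p q r, i != j -> i != k -> j != k ->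
  value v [:: eps; pe i p; pe j q; pe k r] = 0) ->
  v = 0.
Proof.
move=> vn H2 He111; apply: (value_ext vn) => s.
case/coflat_edge_list=> b [u0 [u1 [u2 [[sc U0 U1 U2] sz]]]]; rewrite (value_eq v sc).
clear sc; have /and3P[] : [&& size u0 <= 4,
size u1 <= 4 & size u2 <= 4]%N by case: b sz => -[]; lia.
case: b sz => -[s0 s1 s2 sz].
  have {s0 s1 s2 sz} : [&& 0 < size u0, 0 < size u1, 0 < size u2 &
      size u0 + size u1 + size u2 == 1 + 2]%N by rewrite s0 s1 s2 sz eqxx.
  case: u0 U0 => [|a [|a1 [|a2 [|a3 [|//]]]]];
  case: u1 U1 => [|b [|b1 [|b2 [|b3 [|//]]]]];
  case: u2 U2 => [|c [|c1 [|c2 [|c3 [|//]]]]] //=;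
  rewrite ?inE ?negb_or => *; split_uniq; rewrite /edge_list /=.
  - by apply: He111.
have {s0 s1 s2 sz} : [&& size u0 != 1, size u1 != 1, size u2 != 1 &
    (size u0).-1 + (size u1).-1 + (size u2).-1 == 1]%N by rewrite s0 s1 s2 sz eqxx.
case: u0 U0 => [|a [|a1 [|a2 [|a3 [|//]]]]];
case: u1 U1 => [|b [|b1 [|b2 [|b3 [|//]]]]];
case: u2 U2 => [|c [|c1 [|c2 [|c3 [|//]]]]] //=;
rewrite ?inE ?negb_or => *; split_uniq; rewrite /edge_list /=.
- by apply: H2.
- by apply: H2.
- by apply: H2.
Qed.

Lemma value_ext2 v : of_corank 2 v ->
  (forall i p p' p'', p != p' -> p != p'' -> p' != p'' ->
  value v [:: pe i p; pe i p'; pe i p''] = 0) ->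
  (forall i j p p' q q', i != j -> p != p' -> q != q' ->
  value v [:: pe i p; pe i p'; pe j q; pe j q'] = 0) ->
  (forall i j k p p' q r, i != j -> i != k -> j != k -> p != p' ->
  value v [:: eps; pe i p; pe i p'; pe j q; pe k r] = 0) ->
  v = 0.
Proof.
move=> vn H3 H22 He211; apply: (value_ext vn) => s.
case/coflat_edge_list=> b [u0 [u1 [u2 [[sc U0 U1 U2] sz]]]]; rewrite (value_eq v sc).
clear sc; have /and3P[] : [&& size u0 <= 4,
size u1 <= 4 & size u2 <= 4]%N by case: b sz => -[]; lia.
case: b sz => -[s0 s1 s2 sz].
  have {s0 s1 s2 sz} : [&& 0 < size u0, 0 < size u1, 0 < size u2 &
      size u0 + size u1 + size u2 == 2 + 2]%N by rewrite s0 s1 s2 sz eqxx.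
  case: u0 U0 => [|a [|a1 [|a2 [|a3 [|//]]]]];
  case: u1 U1 => [|b [|b1 [|b2 [|b3 [|//]]]]];
  case: u2 U2 => [|c [|c1 [|c2 [|c3 [|//]]]]] //=;
  rewrite ?inE ?negb_or => *; split_uniq; rewrite /edge_list /=.
  - by rewrite (@value_eq t R v _ [:: eps; pe i2 c; pe i2 c1; pe i0 a; pe i1 b]);
    [apply: He211 | same_elements].
  - by rewrite (@value_eq t R v _ [:: eps; pe i1 b; pe i1 b1; pe i0 a; pe i2 c]);
    [apply: He211 | same_elements].
  - by apply: He211.
have {s0 s1 s2 sz} : [&& size u0 != 1, size u1 != 1, size u2 != 1 &
    (size u0).-1 + (size u1).-1 + (size u2).-1 == 2]%N by rewrite s0 s1 s2 sz eqxx.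
case: u0 U0 => [|a [|a1 [|a2 [|a3 [|//]]]]];
case: u1 U1 => [|b [|b1 [|b2 [|b3 [|//]]]]];
case: u2 U2 => [|c [|c1 [|c2 [|c3 [|//]]]]] //=;
rewrite ?inE ?negb_or => *; split_uniq; rewrite /edge_list /=.
- by apply: H3.
- by apply: H22.
- by apply: H3.
- by apply: H22.
- by apply: H22.
- by apply: H3.
Qed.

Lemma value_ext3 v : of_corank 3 v ->
  (forall i p p' p'' p''', p != p' -> p != p'' -> p != p''' -> p' != p'' ->
  p' != p''' -> p'' != p''' -> value v [:: pe i p; pe i p'; pe i p'';
  pe i p'''] = 0) ->
  (forall i j p p' p'' q q', i != j -> p != p' -> p != p'' -> p' != p'' ->
  q != q' -> value v [:: pe i p; pe i p'; pe i p''; pe j q; pe j q'] = 0) ->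
  (forall i j k p p' q q' r r', i != j -> i != k -> j != k -> p != p' -> q != q' ->
  r != r' -> value v [:: pe i p; pe i p'; pe j q; pe j q'; pe k r; pe k r'] = 0) ->
  (forall i j k p p' p'' q r, i != j -> i != k -> j != k -> p != p' -> p != p'' ->
  p' != p'' -> value v [:: eps; pe i p; pe i p'; pe i p''; pe j q; pe k r] = 0) ->
  (forall i j k p p' q q' r, i != j -> i != k -> j != k -> p != p' -> q != q' ->
  value v [:: eps; pe i p; pe i p'; pe j q; pe j q'; pe k r] = 0) ->
  v = 0.
Proof.
move=> vn H4 H32 H222 He311 He221; apply: (value_ext vn) => s.
case/coflat_edge_list=> b [u0 [u1 [u2 [[sc U0 U1 U2] sz]]]]; rewrite (value_eq v sc).
clear sc; have /and3P[] : [&& size u0 <= 4,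
size u1 <= 4 & size u2 <= 4]%N by case: b sz => -[]; lia.
case: b sz => -[s0 s1 s2 sz].
  have {s0 s1 s2 sz} : [&& 0 < size u0, 0 < size u1, 0 < size u2 &
      size u0 + size u1 + size u2 == 3 + 2]%N by rewrite s0 s1 s2 sz eqxx.
  case: u0 U0 => [|a [|a1 [|a2 [|a3 [|//]]]]];
  case: u1 U1 => [|b [|b1 [|b2 [|b3 [|//]]]]];
  case: u2 U2 => [|c [|c1 [|c2 [|c3 [|//]]]]] //=;
  rewrite ?inE ?negb_or => *; split_uniq; rewrite /edge_list /=.
  - by rewrite (@value_eq t R v _ [:: eps; pe i2 c; pe i2 c1; pe i2 c2; pe i0 a;
    pe i1 b]); [apply: He311 | same_elements].
  - by rewrite (@value_eq t R v _ [:: eps; pe i1 b; pe i1 b1; pe i2 c; pe i2 c1;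
    pe i0 a]); [apply: He221 | same_elements].
  - by rewrite (@value_eq t R v _ [:: eps; pe i1 b; pe i1 b1; pe i1 b2; pe i0 a;
    pe i2 c]); [apply: He311 | same_elements].
  - by rewrite (@value_eq t R v _ [:: eps; pe i0 a; pe i0 a1; pe i2 c; pe i2 c1;
    pe i1 b]); [apply: He221 | same_elements].
  - by apply: He221.
  - by apply: He311.
have {s0 s1 s2 sz} : [&& size u0 != 1, size u1 != 1, size u2 != 1 &
    (size u0).-1 + (size u1).-1 + (size u2).-1 == 3]%N by rewrite s0 s1 s2 sz eqxx.
case: u0 U0 => [|a [|a1 [|a2 [|a3 [|//]]]]];
case: u1 U1 => [|b [|b1 [|b2 [|b3 [|//]]]]];
case: u2 U2 => [|c [|c1 [|c2 [|c3 [|//]]]]] //=;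
rewrite ?inE ?negb_or => *; split_uniq; rewrite /edge_list /=.
- by apply: H4.
- by rewrite (@value_eq t R v _ [:: pe i2 c; pe i2 c1; pe i2 c2; pe i1 b;
  pe i1 b1]); [apply: H32 | same_elements].
- by apply: H32.
- by apply: H4.
- by rewrite (@value_eq t R v _ [:: pe i2 c; pe i2 c1; pe i2 c2; pe i0 a;
  pe i0 a1]); [apply: H32 | same_elements].
- by apply: H222.
- by rewrite (@value_eq t R v _ [:: pe i1 b; pe i1 b1; pe i1 b2; pe i0 a;
  pe i0 a1]); [apply: H32 | same_elements].
- by apply: H32.
- by apply: H32.
- by apply: H4.
Qed.

End Classification.

(** * Coefficients of the vectors of the first three spaces *)

Section Representations.
Variables (t : nat) (R : realFieldType).
Hypothesis t_gt1 : (1 < t)%N.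
Notation M := (theta_matroid t).
Notation V := (flat_space R M).
Implicit Types (i j k : 'I_3) (p q r : 'I_t).
Notation E := (edge (gtheta t)).
Notation pe := (@pe t).
Notation eps := (eps t).
Implicit Types (v w : V) (e f x y z : E) (a : R).

Lemma value_lin a v w s : value (a *: v + w) s = a * value v s + value w s.
Proof. exact: ncoord_lin. Qed.

Lemma value0 s : value (0 : V) s = 0.
Proof. exact: ncoord0. Qed.

Definition rep0 v (c : R) := of_corank 0 v /\ value v [::] = c.

(** Equivalently, [v] is the combination with coefficients [u] of the images of
   [vlevel R M (rk \top)] under the operators [edge_op e]. *)
Definition rep1 v (u : E -> R) :=
  [/\ of_corank 1 v,
   forall i p p', p != p' -> value v [:: pe i p; pe i p'] = u (pe i p) + u (pe i p') &
   forall i j k p q r, i != j -> i != k -> j != k ->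
     value v [:: eps; pe i p; pe j q; pe k r] =
     u eps + u (pe i p) + u (pe j q) + u (pe k r)].

Definition sym2 (C : E -> E -> R) := forall x y, C x y = C y x.

(** [C] is summed over the pairs whose removal leaves a set that is independent in the
   dual matroid.  The operator [Dbeta] produces the remaining terms [D], which are
   visible in the shape e211 only. *)
Definition rep2 v (C : E -> E -> R) (D : E -> R) :=
  [/\ of_corank 2 v, sym2 C,
   forall i p p' p'', p != p' -> p != p'' -> p' != p'' ->
     value v [:: pe i p; pe i p'; pe i p''] =
     C (pe i p) (pe i p') + C (pe i p) (pe i p'') + C (pe i p') (pe i p''),
   forall i j p p' q q', i != j -> p != p' -> q != q' ->
     value v [:: pe i p; pe i p'; pe j q; pe j q'] =
     C (pe i p) (pe j q) + C (pe i p) (pe j q') +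
     C (pe i p') (pe j q) + C (pe i p') (pe j q') &
   forall i j k p p' q r, i != j -> i != k -> j != k -> p != p' ->
     value v [:: eps; pe i p; pe i p'; pe j q; pe k r] =
     C (pe i p) (pe i p') + C (pe i p) (pe j q) + C (pe i p') (pe j q) +
     C (pe i p) (pe k r) + C (pe i p') (pe k r) +
     C eps (pe i p) + C eps (pe i p') + D (pe j q) + D (pe k r)].

Definition sym3 (C : E -> E -> E -> R) :=
  (forall x y z, C x y z = C y x z) /\ (forall x y z, C x y z = C x z y).

(** [C] is summed over the triples whose removal leaves a set that is independent in
   the dual matroid.  The remaining terms are visible in the shapes e311 and e221 only.
   For edges of the same path [X] matters through [X e f + X f e] only, and [W] matters
   for edges of different paths only, through [W e f + W f e]. *)
Definition rep3 v (C : E -> E -> E -> R) (X W : E -> E -> R) :=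
  [/\ of_corank 3 v, sym3 C,
   forall i p1 p2 p3 p4, p1 != p2 -> p1 != p3 -> p1 != p4 -> p2 != p3 ->
   p2 != p4 -> p3 != p4 ->
     value v [:: pe i p1; pe i p2; pe i p3; pe i p4] =
     C (pe i p1) (pe i p2) (pe i p3) + C (pe i p1) (pe i p2) (pe i p4) +
     C (pe i p1) (pe i p3) (pe i p4) + C (pe i p2) (pe i p3) (pe i p4),
   forall i j p1 p2 p3 q1 q2, i != j -> p1 != p2 -> p1 != p3 -> p2 != p3 -> q1 != q2 ->
     value v [:: pe i p1; pe i p2; pe i p3; pe j q1; pe j q2] =
     C (pe i p1) (pe i p2) (pe j q1) + C (pe i p1) (pe i p3) (pe j q1) +
     C (pe i p2) (pe i p3) (pe j q1) + C (pe i p1) (pe i p2) (pe j q2) +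
     C (pe i p1) (pe i p3) (pe j q2) + C (pe i p2) (pe i p3) (pe j q2) &
   [/\ forall i j k p1 p2 q1 q2 r1 r2, i != j -> i != k -> j != k ->
       p1 != p2 -> q1 != q2 -> r1 != r2 ->
     value v [:: pe i p1; pe i p2; pe j q1; pe j q2; pe k r1; pe k r2] =
     C (pe i p1) (pe j q1) (pe k r1) + C (pe i p2) (pe j q1) (pe k r1) +
     C (pe i p1) (pe j q2) (pe k r1) + C (pe i p2) (pe j q2) (pe k r1) +
     C (pe i p1) (pe j q1) (pe k r2) + C (pe i p2) (pe j q1) (pe k r2) +
     C (pe i p1) (pe j q2) (pe k r2) + C (pe i p2) (pe j q2) (pe k r2),
   forall i j k p1 p2 p3 q r, i != j -> i != k -> j != k ->
       p1 != p2 -> p1 != p3 -> p2 != p3 ->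
     value v [:: eps; pe i p1; pe i p2; pe i p3; pe j q; pe k r] =
     let Z e f := X e f + W e f + W f e in
     C (pe i p1) (pe i p2) (pe i p3) +
     C (pe i p1) (pe i p2) (pe j q) + C (pe i p1) (pe i p3) (pe j q) +
     C (pe i p2) (pe i p3) (pe j q) + C (pe i p1) (pe i p2) (pe k r) +
     C (pe i p1) (pe i p3) (pe k r) + C (pe i p2) (pe i p3) (pe k r) +
     C eps (pe i p1) (pe i p2) + C eps (pe i p1) (pe i p3) + C eps (pe i p2) (pe i p3) +
     Z (pe i p1) (pe j q) + Z (pe i p2) (pe j q) + Z (pe i p3) (pe j q) +
     Z (pe i p1) (pe k r) + Z (pe i p2) (pe k r) + Z (pe i p3) (pe k r) &
   forall i j k p1 p2 q1 q2 r, i != j -> i != k -> j != k -> p1 != p2 -> q1 != q2 ->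
     value v [:: eps; pe i p1; pe i p2; pe j q1; pe j q2; pe k r] =
     let S e f := X e f + X f e in
     C eps (pe i p1) (pe j q1) + C eps (pe i p1) (pe j q2) +
     C eps (pe i p2) (pe j q1) + C eps (pe i p2) (pe j q2) +
     C (pe i p1) (pe i p2) (pe j q1) + C (pe i p1) (pe i p2) (pe j q2) +
     C (pe i p1) (pe j q1) (pe j q2) + C (pe i p2) (pe j q1) (pe j q2) +
     C (pe i p1) (pe j q1) (pe k r) + C (pe i p2) (pe j q1) (pe k r) +
     C (pe i p1) (pe j q2) (pe k r) + C (pe i p2) (pe j q2) (pe k r) +
     S (pe i p1) (pe i p2) + S (pe j q1) (pe j q2) +
     X (pe i p1) (pe k r) + X (pe i p2) (pe k r) +
     X (pe j q1) (pe k r) + X (pe j q2) (pe k r)]].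

Lemma rep1_lin a v w u u' : rep1 v u -> rep1 w u' ->
  rep1 (a *: v + w) (fun e => a * u e + u' e).
Proof.
case=> v0 v1 v2 [w0 w1 w2]; split; first exact: of_corank_lin.
  by move=> *; rewrite value_lin v1 // w1 //; ring.
by move=> *; rewrite value_lin v2 // w2 //; ring.
Qed.

Lemma rep2_lin a v w C D C' D' : rep2 v C D -> rep2 w C' D' ->
  rep2 (a *: v + w) (fun x y => a * C x y + C' x y) (fun e => a * D e + D' e).
Proof.
case=> v0 sC v1 v2 v3 [w0 sC' w1 w2 w3]; split; first exact: of_corank_lin.
- by move=> x y; rewrite sC sC'.
- by move=> *; rewrite value_lin v1 // w1 //; ring.
- by move=> *; rewrite value_lin v2 // w2 //; ring.
- by move=> *; rewrite value_lin v3 // w3 //; ring.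
Qed.

Lemma rep3_lin a v w C X W C' X' W' : rep3 v C X W -> rep3 w C' X' W' ->
  rep3 (a *: v + w) (fun x y z => a * C x y z + C' x y z)
    (fun x y => a * X x y + X' x y) (fun x y => a * W x y + W' x y).
Proof.
case=> v0 [sC tC] v1 v2 [v3 v4 v5] [w0 [sC' tC'] w1 w2 [w3 w4 w5]].
split; [exact: of_corank_lin|..|split].
- by split=> x y z; [rewrite sC sC' | rewrite tC tC'].
- by move=> *; rewrite value_lin v1 // w1 //; ring.
- by move=> *; rewrite value_lin v2 // w2 //; ring.
- by move=> *; rewrite value_lin v3 // w3 //; ring.
- by move=> *; rewrite value_lin v4 // w4 //=; ring.
- by move=> *; rewrite value_lin v5 // w5 //=; ring.
Qed.

Lemma rep1_edge_op e v (a : R) : rep0 v a ->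
    rep1 (edge_op R M e v) (fun x => (x == e)%:R * a).
Proof.
case=> v0 v1; split; first exact: of_corank_edge_op.
- move=> i p p' pp; rewrite (coflat_value_edge_op t_gt1 _ _ (coflat_2 i pp)).
  by rewrite drop_sum_2 // v1; ring.
- move=> i j k p q r ij ik jk.
  rewrite (coflat_value_edge_op t_gt1 _ _ (coflat_e111 p q r ij ik jk)).
  by rewrite drop_sum_e111 // v1; ring.
Qed.

Lemma rep1_D v a : rep0 v a ->
  rep1 (Dbeta R M v) (fun x => D_scale t R 1 * a * (if x == eps then -1 / 2 else 1 /
  2)).
Proof.
case=> v0 v1; split; first by apply: of_corank_D => //;
  [exact: indep1 | exact: closed1].
- move=> i p p' pp; rewrite (coflat_value_D t_gt1 _ (coflat_2 i pp)).
  by rewrite drop_sum_2 // v1 /= ?pe_eps; field.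
- move=> i j k p q r ij ik jk.
  rewrite (coflat_value_D t_gt1 _ (coflat_e111 p q r ij ik jk)).
  by rewrite drop_sum_e111 // v1 /= ?pe_eps ?eqxx; field.
Qed.

Lemma rep2_edge_op e v u : rep1 v u ->
  rep2 (edge_op R M e v) (fun x y => (x == e)%:R * u y + (y == e)%:R * u x) (fun=> 0).
Proof.
case=> v0 v1 v2; split; first exact: of_corank_edge_op.
- by move=> x y; rewrite addrC.
- move=> i p p' p'' pp pp' pp''.
  rewrite (coflat_value_edge_op t_gt1 _ _ (coflat_3 i pp pp' pp'')).
  by rewrite drop_sum_3 // !v1 //; ring.
- move=> i j p p' q q' ij pp qq.
  rewrite (coflat_value_edge_op t_gt1 _ _ (coflat_22 ij pp qq)).
  by rewrite drop_sum_22 // !v1 //; ring.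
- move=> i j k p p' q r ij ik jk pp.
  rewrite (coflat_value_edge_op t_gt1 _ _ (coflat_e211 q r ij ik jk pp)).
  by rewrite drop_sum_e211 // !v1 // !v2 //; ring.
Qed.

(** The shapes 3 and 22 impose the values on two path edges, and e211 then imposes those
   on pairs with [eps], up to the terms [D]. *)
Definition average_pair (u : E -> R) x y :=
  if x == eps then u x / 5 - u y / 30
  else if y == eps then u y / 5 - u x / 30
  else if pathof x == pathof y then (u x + u y) / 3 else (u x + u y) / 4.

Ltac by_paths := rewrite /= ?pe_eps ?eps_pe ?eqxx ?pathE; decide_eqs; rewrite ?eqxx /=.

Lemma rep2_D v u : rep1 v u ->
  rep2 (Dbeta R M v) (fun x y => D_scale t R 2 * average_pair u x y)
    (fun e => D_scale t R 2 * (- u e / 10)).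
Proof.
case=> v0 v1 v2; split.
- by apply: of_corank_D => //; [exact: indep1 | exact: closed1].
- move=> x y; congr (_ * _); rewrite /average_pair (eq_sym (pathof y)).
  have [->|xe] := eqVneq x eps; have [->|ye] := eqVneq y eps => //.
  by case: ifP => _; rewrite addrC.
- move=> i p p' p'' pp pp' pp''.
  rewrite (coflat_value_D t_gt1 _ (coflat_3 i pp pp' pp'')) drop_sum_3 // !v1 //.
  by rewrite /average_pair; by_paths; field.
- move=> i j p p' q q' ij pp qq.
  rewrite (coflat_value_D t_gt1 _ (coflat_22 ij pp qq)) drop_sum_22 // !v1 //.
  by rewrite /average_pair; by_paths; field.
- move=> i j k p p' q r ij ik jk pp.
  rewrite (coflat_value_D t_gt1 _ (coflat_e211 q r ij ik jk pp)) drop_sum_e211 // !v1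
    // !v2 //.
  by rewrite /average_pair; by_paths; field.
Qed.

Lemma rep3_edge_op e v C D : rep2 v C D ->
  rep3 (edge_op R M e v)
    (fun x y z => (x == e)%:R * C y z + (y == e)%:R * C x z + (z == e)%:R * C x y)
    (fun x y => (x == e)%:R * D y) (fun _ _ => 0).
Proof.
case=> v0 sC v1 v2 v3; split; [exact: of_corank_edge_op|..|split].
- split=> x y z; first by rewrite (sC y x); ring.
  by rewrite (sC y z); ring.
- move=> i p1 p2 p3 p4 h1 h2 h3 h4 h5 h6.
  rewrite (coflat_value_edge_op t_gt1 _ _ (coflat_4 i h1 h2 h3 h4 h5 h6)).
  by rewrite drop_sum_4 // !v1 //; ring.
- move=> i j p1 p2 p3 q1 q2 ij h1 h2 h3 h4.
  rewrite (coflat_value_edge_op t_gt1 _ _ (coflat_32 ij h1 h2 h3 h4)).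
  by rewrite drop_sum_32 // !v1 // !v2 //; ring.
- move=> i j k p1 p2 q1 q2 r1 r2 ij ik jk h1 h2 h3.
  rewrite (coflat_value_edge_op t_gt1 _ _ (coflat_222 ij ik jk h1 h2 h3)).
  by rewrite drop_sum_222 // !v2 //; ring.
- move=> i j k p1 p2 p3 q r ij ik jk h1 h2 h3.
  rewrite (coflat_value_edge_op t_gt1 _ _ (coflat_e311 q r ij ik jk h1 h2 h3)).
  by rewrite drop_sum_e311 // !v1 // !v3 //=; ring.
- move=> i j k p1 p2 q1 q2 r ij ik jk h1 h2.
  rewrite (coflat_value_edge_op t_gt1 _ _ (coflat_e221 r ij ik jk h1 h2)).
  have ji : j != i by rewrite eq_sym.
  rewrite drop_sum_e221 // !v2 // !v3 //=.
  by rewrite !(sC (pe j _) (pe i _)); ring.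
Qed.

Section AverageTriple.
Variables (C : E -> E -> R) (D : E -> R).

(** These weights are imposed by the values of [Dbeta v]: 1/4 by the shape 4, 1/5 by 32,
   1/6 for three different paths by 222, 1/60 by e311, 1/10 by e221, and 1/6 for a pair
   with [eps] by e311 and e221 alike. *)
Definition pair_weight x y z : R :=
  if (x == eps) || (y == eps) then 1 / 6
  else if z == eps then if pathof x == pathof y then 1 / 60 else 1 / 10
  else if [&& pathof x == pathof y, pathof x == pathof z & pathof y == pathof z]
    then 1 / 4
  else if [|| pathof x == pathof y, pathof x == pathof z | pathof y == pathof z]
    then 1 / 5
  else 1 / 6.

Definition average_triple x y z : R :=
  pair_weight x y z * C x y + pair_weight x z y * C x z + pair_weight y z x * C y z +
  (if [|| pathof x == pathof y, pathof x == pathof z | pathof y == pathof z]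
   then 0
   else if [|| x == eps, y == eps | z == eps]
   then ((x != eps)%:R * D x + (y != eps)%:R * D y + (z != eps)%:R * D z) / 12
   else 0).

Definition average_cross x y : R :=
  if pathof x == pathof y then - C x y / 30 else D y / 6.

End AverageTriple.

Lemma average_triple_sym C D : sym2 C -> sym3 (average_triple C D).
Proof.
move=> sC; split=> x y z; rewrite /average_triple /pair_weight.
  rewrite (sC y x) !(eq_sym (pathof y) (pathof x)) !(eq_sym (pathof z) (pathof x))
    !(eq_sym (pathof z) (pathof y)).
  case: (pathof x == pathof y); case: (pathof x == pathof z);
    case: (pathof y == pathof z); case: (x == eps); case: (y == eps);
    case: (z == eps) => /=; ring.
rewrite (sC z y) !(eq_sym (pathof y) (pathof x)) !(eq_sym (pathof z) (pathof x))
  !(eq_sym (pathof z) (pathof y)).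
case: (pathof x == pathof y); case: (pathof x == pathof z);
  case: (pathof y == pathof z); case: (x == eps); case: (y == eps);
  case: (z == eps) => /=; ring.
Qed.

Lemma rep3_D v C D : rep2 v C D ->
  rep3 (Dbeta R M v) (fun x y z => D_scale t R 3 * average_triple C D x y z)
    (fun x y => D_scale t R 3 * average_cross C D x y)
    (fun x y => D_scale t R 3 * (- C x y / 30)).
Proof.
case=> v0 sC v1 v2 v3; split; [|..|split].
- by apply: of_corank_D => //; [exact: indep1 | exact: closed1].
- by have [s t'] := average_triple_sym D sC; split=> x y z; congr (_ * _).
- move=> i p1 p2 p3 p4 h1 h2 h3 h4 h5 h6.
  rewrite (coflat_value_D t_gt1 _ (coflat_4 i h1 h2 h3 h4 h5 h6)).
  rewrite drop_sum_4 // !v1 //.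
  by rewrite /average_triple /pair_weight; by_paths; field.
- move=> i j p1 p2 p3 q1 q2 ij h1 h2 h3 h4.
  rewrite (coflat_value_D t_gt1 _ (coflat_32 ij h1 h2 h3 h4)).
  rewrite drop_sum_32 // !v1 // !v2 //.
  by rewrite /average_triple /pair_weight; by_paths; field.
- move=> i j k p1 p2 q1 q2 r1 r2 ij ik jk h1 h2 h3.
  rewrite (coflat_value_D t_gt1 _ (coflat_222 ij ik jk h1 h2 h3)).
  rewrite drop_sum_222 // !v2 //.
  by rewrite /average_triple /pair_weight; by_paths; field.
- move=> i j k p1 p2 p3 q r ij ik jk h1 h2 h3.
  rewrite (coflat_value_D t_gt1 _ (coflat_e311 q r ij ik jk h1 h2 h3)).
  rewrite drop_sum_e311 // !v1 // !v3 //=.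
  rewrite /average_cross /average_triple /pair_weight !(sC (pe j _) (pe i _)) !(sC
    (pe k _) (pe i _)).
  by by_paths; field.
- move=> i j k p1 p2 q1 q2 r ij ik jk h1 h2.
  rewrite (coflat_value_D t_gt1 _ (coflat_e221 r ij ik jk h1 h2)).
  have ji : j != i by rewrite eq_sym.
  rewrite drop_sum_e221 // !v2 // !v3 //=.
  rewrite /average_cross /average_triple /pair_weight.
  rewrite !(sC (pe j _) (pe i _)) (sC (pe i p2) (pe i p1)) (sC (pe j q2) (pe j q1)).
  by by_paths; field.
Qed.

End Representations.

(** * Functions determined by their sums over subsets *)

Section SubsetSums.
Variables (R : realFieldType) (t : nat).
Implicit Types (f : 'I_t -> 'I_t -> R) (p q : 'I_t).

Lemma exists_notin (s : seq 'I_t) : (size s < t)%N -> exists p, p \notin s.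
Proof.
move=> lt; apply: contrapT => none.
have : (size (enum 'I_t) <= size s)%N.
  apply: uniq_leq_size; first exact: enum_uniq.
  by move=> p _; apply: contraT => ps; case: none; exists p.
by rewrite size_enum_ord leqNgt lt.
Qed.

Lemma sum_pairs_eq0 (f : 'I_t -> R) : (2 < t)%N ->
  (forall p q, p != q -> f p + f q = 0) -> forall p, f p = 0.
Proof.
move=> t2 f0 p; have [q] := @exists_notin [:: p] (ltnW t2).
rewrite !inE eq_sym => pq; have [r] := @exists_notin [:: p; q] t2.
rewrite !inE negb_or !(eq_sym r) => /andP[pr qr].
have := f0 p q pq; have := f0 p r pr; have := f0 q r qr; lra.
Qed.

(** The ten triples of five points determine the ten pairs. *)
Lemma sum_pairs_triples_eq0 f : (4 < t)%N -> (forall p q, f p q = f q p) ->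
  (forall p q r, p != q -> p != r -> q != r -> f p q + f p r + f q r = 0) ->
  forall p q, p != q -> f p q = 0.
Proof.
move=> t4 sf f0 p q pq.
have [a] := @exists_notin [:: p; q] (ltnW (ltnW t4)).
rewrite !inE !negb_or !(eq_sym a) => /andP[pa qa].
have [b] := @exists_notin [:: p; q; a] (ltnW t4).
rewrite !inE !negb_or !(eq_sym b) => /and3P[pb qb ab].
have [c] := @exists_notin [:: p; q; a; b] t4.
rewrite !inE !negb_or !(eq_sym c) => /and4P[pc qc ac bc].
have := f0 p q a pq pa qa; have := f0 p q b pq pb qb; have := f0 p q c pq pc qc.
have := f0 p a b pa pb ab; have := f0 p a c pa pc ac; have := f0 p b c pb pc bc.
have := f0 q a b qa qb ab; have := f0 q a c qa qc ac; have := f0 q b c qb qc bc.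
have := f0 a b c ab ac bc; lra.
Qed.

(** Six points are necessary: five have ten pairs but only five quadruples. *)
Lemma sum_pairs_quads_eq0 f : (5 < t)%N -> (forall p q, f p q = f q p) ->
  (forall p q r s, p != q -> p != r -> p != s -> q != r -> q != s -> r != s ->
     f p q + f p r + f p s + f q r + f q s + f r s = 0) ->
  forall p q, p != q -> f p q = 0.
Proof.
move=> t5 sf f0 p q pq.
have [a] := @exists_notin [:: p; q] (ltnW (ltnW (ltnW t5))).
rewrite !inE !negb_or !(eq_sym a) => /andP[pa qa].
have [b] := @exists_notin [:: p; q; a] (ltnW (ltnW t5)).
rewrite !inE !negb_or !(eq_sym b) => /and3P[pb qb ab].
have [c] := @exists_notin [:: p; q; a; b] (ltnW t5).
rewrite !inE !negb_or !(eq_sym c) => /and4P[pc qc ac bc].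
have [d] := @exists_notin [:: p; q; a; b; c] t5.
rewrite !inE !negb_or !(eq_sym d) => /and5P[pd qd ad drop_sum cd].
have := f0 p q a b pq pa pb qa qb ab; have := f0 p q a c pq pa pc qa qc ac.
have := f0 p q a d pq pa pd qa qd ad; have := f0 p q b c pq pb pc qb qc bc.
have := f0 p q b d pq pb pd qb qd drop_sum; have := f0 p q c d pq pc pd qc qd cd.
have := f0 p a b c pa pb pc ab ac bc; have := f0 p a b d pa pb pd ab ad drop_sum.
have := f0 p a c d pa pc pd ac ad cd; have := f0 p b c d pb pc pd bc drop_sum cd.
have := f0 q a b c qa qb qc ab ac bc; have := f0 q a b d qa qb qd ab ad drop_sum.
have := f0 q a c d qa qc qd ac ad cd; have := f0 q b c d qb qc qd bc drop_sum cd.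
have := f0 a b c d ab ac ad bc drop_sum cd; lra.
Qed.

End SubsetSums.

(** * The spaces contain all the vectors with coefficients *)

Section Realization.
Variables (t : nat) (R : realFieldType).
Hypothesis t_gt1 : (1 < t)%N.
Notation M := (theta_matroid t).
Notation V := (flat_space R M).
Implicit Types (i j k : 'I_3) (p q r : 'I_t).
Notation E := (edge (gtheta t)).
Notation pe := (@pe t).
Notation eps := (eps t).
Implicit Types (v w : V) (e f x y z : E) (a : R).
Notation rep0 := (@rep0 t R).
Notation rep1 := (@rep1 t R).
Notation rep2 := (@rep2 t R).
Notation rep3 := (@rep3 t R).

Lemma sub_eq0 v w : -1 *: v + w = 0 -> v = w.
Proof. by rewrite scaleN1r addrC => /eqP; rewrite subr_eq0 => /eqP. Qed.

Lemma rep1_unique v w u : rep1 v u -> rep1 w u -> v = w.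
Proof.
move=> rv rw; apply: sub_eq0; have [v0 v1 v2] := rep1_lin (-1) rv rw.
by apply: (value_ext1 t_gt1 v0) => *; rewrite ?v1 ?v2 //; ring.
Qed.

Lemma rep2_unique v w C D : rep2 v C D -> rep2 w C D -> v = w.
Proof.
move=> rv rw; apply: sub_eq0; have [v0 _ v1 v2 v3] := rep2_lin (-1) rv rw.
by apply: (value_ext2 t_gt1 v0) => *; rewrite ?v1 ?v2 ?v3 //; ring.
Qed.

Lemma rep3_unique v w C X W : rep3 v C X W -> rep3 w C X W -> v = w.
Proof.
move=> rv rw; apply: sub_eq0; have [v0 _ v1 v2 [v3 v4 v5]] := rep3_lin (-1) rv rw.
by apply: (value_ext3 t_gt1 v0) => *; rewrite ?v1 ?v2 ?v3 ?v4 ?v5 //=; ring.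
Qed.

Lemma rep1_0 : rep1 0 (fun=> 0).
Proof. by split=> [|*|*]; [exact: of_corank0 | rewrite value0; ring..]. Qed.

Lemma rep2_0 : rep2 0 (fun _ _ => 0) (fun=> 0).
Proof. by split=> [||*|*|*] //; [exact: of_corank0 | rewrite value0; ring..]. Qed.

Lemma rep3_0 : rep3 0 (fun _ _ _ => 0) (fun _ _ => 0) (fun _ _ => 0).
Proof.
split=> [||*|*|] //; [exact: of_corank0 | rewrite value0; ring | rewrite value0;
ring |].
by split=> *; rewrite value0 /=; ring.
Qed.

Lemma rep1_sum (F : E -> V) (u : E -> E -> R) : (forall e, rep1 (F e) (u e)) ->
  rep1 (\sum_e F e) (fun x => \sum_e u e x).
Proof.
move=> H; elim: (index_enum _) => [|e s IHs].
  have -> : (fun x => \sum_(e <- [::]) u e x) = fun=> 0.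
    by apply: funext => x; rewrite big_nil.
  by rewrite big_nil; apply: rep1_0.
have -> : (fun x => \sum_(f <- e :: s) u f x) = (fun x => 1 * u e x +
  \sum_(f <- s) u f x).
  by apply: funext => x; rewrite big_cons mul1r.
by rewrite big_cons -[F e]scale1r; apply: rep1_lin.
Qed.

Lemma rep2_sum (F : E -> V) C D : (forall e, rep2 (F e) (C e) (D e)) ->
  rep2 (\sum_e F e) (fun x y => \sum_e C e x y) (fun x => \sum_e D e x).
Proof.
move=> H; elim: (index_enum _) => [|e s IHs].
  have -> : (fun x y => \sum_(e <- [::]) C e x y) = fun _ _ => 0.
    by apply: funext => x; apply: funext => y; rewrite big_nil.
  have -> : (fun x => \sum_(e <- [::]) D e x) = fun=> 0.
    by apply: funext => x; rewrite big_nil.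
  by rewrite big_nil; apply: rep2_0.
have -> : (fun x y => \sum_(f <- e :: s) C f x y) =
    (fun x y => 1 * C e x y + \sum_(f <- s) C f x y).
  by apply: funext => x; apply: funext => y; rewrite big_cons mul1r.
have -> : (fun x => \sum_(f <- e :: s) D f x) = (fun x => 1 * D e x +
  \sum_(f <- s) D f x).
  by apply: funext => x; rewrite big_cons mul1r.
by rewrite big_cons -[F e]scale1r; apply: rep2_lin.
Qed.

Lemma rep3_sum (F : E -> V) C X W : (forall e, rep3 (F e) (C e) (X e) (W e)) ->
  rep3 (\sum_e F e) (fun x y z => \sum_e C e x y z) (fun x y => \sum_e X e x y)
    (fun x y => \sum_e W e x y).
Proof.
have fun2 (A B : E -> E -> R) : (forall x y, A x y = B x y) -> A = B.
  by move=> AB; apply: funext => x; apply: funext => y.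
have fun3 (A B : E -> E -> E -> R) : (forall x y z, A x y z = B x y z) -> A = B.
  by move=> AB; apply: funext => x; apply: fun2.
move=> H; elim: (index_enum _) => [|e s IHs].
  have -> : (fun x y z => \sum_(e <- [::]) C e x y z) = fun _ _ _ => 0.
    by apply: fun3 => x y z; rewrite big_nil.
  have n2 (A : E -> E -> E -> R) : (fun x y => \sum_(e <- [::]) A e x y) = fun _ _ => 0.
    by apply: fun2 => x y; rewrite big_nil.
  by rewrite !n2 big_nil; apply: rep3_0.
have -> : (fun x y z => \sum_(f <- e :: s) C f x y z) =
    (fun x y z => 1 * C e x y z + \sum_(f <- s) C f x y z).
  by apply: fun3 => x y z; rewrite big_cons mul1r.
have n2 (A : E -> E -> E -> R) : (fun x y => \sum_(f <- e :: s) A f x y) =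
    (fun x y => 1 * A e x y + \sum_(f <- s) A f x y).
  by apply: fun2 => x y; rewrite big_cons mul1r.
by rewrite !n2 big_cons -[F e]scale1r; apply: rep3_lin.
Qed.

Notation Cb n := (Cbeta R M n).
Notation L := (edge_op R M).
Notation vtop := (vlevel R M (rk (\top%O : flat M))).

Lemma rep0_vtop : rep0 vtop 1.
Proof.
split=> [x|]; last first.
  rewrite [LHS]ncoord_vtop; case: eqP => // ne; case: ne; apply: val_inj => /=.
  apply/setP=> e; rewrite [RHS]in_setT.
  by apply: (subsetP (subset_mclosure _ _)); rewrite !inE.
by rewrite ncoord_vtop; case: (eqVneq x \top%O) => [-> _|_]; rewrite ?addn0 ?eqxx.
Qed.

Lemma Cbeta0_rep v : v \in Cb 0 -> exists a, rep0 v a.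
Proof.
move=> /vlineP[a ->]; exists a; have [v0 v1] := rep0_vtop.
have z0 : of_corank 0 (0 : V) by apply: of_corank0.
rewrite -[_ *: _]addr0; split; first exact: of_corank_lin.
by rewrite value_lin v1 value0; ring.
Qed.

Lemma Cbeta1_rep v : v \in Cb 1 -> exists u, rep1 v u.
Proof.
move: v; apply: (Cbeta_ind (@indep1 t t_gt1) (n := 0) (P := fun v => exists u,
  rep1 v u)).
- by exists (fun=> 0); apply: rep1_0.
- by move=> a v1 v2 [u1 r1] [u2 r2]; exists (fun e => a * u1 e + u2 e); apply: rep1_lin.
- by move=> w /Cbeta0_rep[a ra]; eexists; apply: rep1_D ra.
- by move=> e w /Cbeta0_rep[a ra]; eexists; apply: rep1_edge_op ra.
Qed.

Lemma Cbeta2_rep v : v \in Cb 2 -> exists C D, rep2 v C D.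
Proof.
move: v; apply: (Cbeta_ind (@indep1 t t_gt1) (n := 1) (P := fun v => exists C D,
  rep2 v C D)).
- by do 2 eexists; apply: rep2_0.
- by move=> a v1 v2 [C1 [D1 r1]] [C2 [D2 r2]]; do 2 eexists; apply: rep2_lin r1 r2.
- by move=> w /Cbeta1_rep[u ru]; do 2 eexists; apply: rep2_D ru.
- by move=> e w /Cbeta1_rep[u ru]; do 2 eexists; apply: rep2_edge_op ru.
Qed.

Lemma Cbeta3_rep v : v \in Cb 3 -> exists C X W, rep3 v C X W.
Proof.
move: v; apply: (Cbeta_ind (@indep1 t t_gt1) (n := 2) (P := fun v => exists C X W,
  rep3 v C X W)).
- by do 3 eexists; apply: rep3_0.
- by move=> a v1 v2 [C1 [X1 [W1 r1]]] [C2 [X2 [W2 r2]]]; do 3 eexists;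
  apply: rep3_lin r1 r2.
- by move=> w /Cbeta2_rep[C [D ru]]; do 3 eexists; apply: rep3_D ru.
- by move=> e w /Cbeta2_rep[C [D ru]]; do 3 eexists; apply: rep3_edge_op ru.
Qed.

Lemma Cb_edge_op n e v : v \in Cb n -> L e v \in Cb n.+1.
Proof. by move=> vC; apply: Cbeta_edge_op => //; exact: indep1. Qed.

Let sum_delta (F : E -> R) x : \sum_e (x == e)%:R * F e = F x.
Proof.
rewrite (bigD1 x) //= (eqxx x) mul1r big1 ?addr0 // => e.
by rewrite eq_sym => /negPf ->; rewrite mul0r.
Qed.

Lemma rep1_exists u : exists2 v, v \in Cb 1 & rep1 v u.
Proof.
have H e : rep1 (u e *: L e vtop + 0) (fun x => u e * ((x == e)%:R * 1) + 0).
  by apply: rep1_lin rep1_0; apply: rep1_edge_op rep0_vtop.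
have := rep1_sum H; set v := \sum_e _.
have -> : (fun x => \sum_e (u e * ((x == e)%:R * 1) + 0)) = u.
  apply: funext => x; by rewrite -[RHS]sum_delta; apply: eq_bigr => e _; ring.
exists v => //; apply: memv_suml => e _; rewrite addr0; apply: memvZ.
exact/Cb_edge_op/memv_line.
Qed.

Lemma rep2_exists_pairs C : sym2 C -> exists2 v, v \in Cb 2 & rep2 v C (fun=> 0).
Proof.
move=> sC; have /choice[w wP] : forall e, exists w,
  w \in Cb 1 /\ rep1 w (fun x => C e x / 2).
  by move=> e; have [w wC rw] := rep1_exists (fun x => C e x / 2); exists w.
have := rep2_sum (fun e => rep2_edge_op t_gt1 e (wP e).2); set v := \sum_e _.
have -> : (fun x y => \sum_e ((x == e)%:R * (C e y / 2) +
  (y == e)%:R * (C e x / 2))) = C.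
  apply: funext => x; apply: funext => y; rewrite big_split /= !sum_delta (sC y).
  by field.
have -> : (fun x : E => \sum_(e : E) 0) = fun=> 0 :> R by apply: funext => x;
  rewrite big1.
by exists v => //; apply: memv_suml => e _; apply: Cb_edge_op; apply: (wP e).1.
Qed.

Let p0 : 'I_t := Ordinal (ltnW t_gt1).
Let p1 : 'I_t := Ordinal t_gt1.

Lemma D_scale2_neq0 : D_scale t R 2 != 0.
Proof.
have cfg : coflat 2 [:: eps; pe i0 p0; pe i0 p1; pe i1 p0;
  pe i2 p0] by apply: coflat_e211.
by apply: coflat_D_scale cfg.
Qed.

Lemma D_scale3_neq0 : D_scale t R 3 != 0.
Proof.
have cfg : coflat 3 [:: eps; pe i0 p0; pe i0 p1; pe i1 p0; pe i1 p1; pe i2 p0].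
  by apply: coflat_e221.
by apply: coflat_D_scale cfg.
Qed.

(** The terms [D] come from [Dbeta]; the pair coefficients that come with them are then
   corrected by edge operators. *)
Lemma rep2_exists C D : sym2 C -> exists2 v, v \in Cb 2 & rep2 v C D.
Proof.
move=> sC; have k0 := D_scale2_neq0.
have [u uC ru] := rep1_exists (fun e => - 10 * D e / D_scale t R 2).
have rD := rep2_D t_gt1 ru; case: (rD) => _ sA _ _ _.
set A := (fun x y => D_scale t R 2 * _) in rD sA.
have [|w wC rw] := @rep2_exists_pairs (fun x y => C x y - A x y).
  by move=> x y; rewrite sC sA.
exists (1 *: Dbeta R M u + w).
  by rewrite scale1r; apply: memvD => //; apply: Cbeta_D.
have := rep2_lin 1 rD rw; congr (rep2 _ _ _); apply: funext => x.
  by apply: funext => y; ring.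
by field.
Qed.

(** The coefficients are not unique.  A part of [X (pe i p) (pe j q)] that depends on [p]
   only, an additive part of [X] on one path, and a part of [W] that is constant on two
   paths can be moved to the triples that contain [eps].  A part of [X (pe i p) (pe j q)]
   that depends on [q] only and changes sign with the path [i] cancels in the shape e221,
   and can be moved to [W]. *)
Lemma rep3_gauge (x y : 'I_3 -> 'I_3 -> 'I_t -> R) (c : 'I_3 -> 'I_3 -> R)
    (s : 'I_3 -> 'I_t -> R) v C X W C' X' W' :
  sym3 C' ->
  (forall i j k p q r, pe i p != pe j q -> pe i p != pe k r -> pe j q != pe k r ->
     C' (pe i p) (pe j q) (pe k r) = C (pe i p) (pe j q) (pe k r)) ->
  (forall i j k p q, i != j -> i != k -> j != k -> p != q ->
     C' eps (pe i p) (pe i q) = C eps (pe i p) (pe i q) +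
       (x i j p + x i j q + x i k p + x i k q) / 2 - c i j - c i k) ->
  (forall i j k p q, i != j -> i != k -> j != k ->
     C' eps (pe i p) (pe j q) = C eps (pe i p) (pe j q) +
       (x i k p + x j k q) / 2 - (s i p + s j q) / 2) ->
  (forall i j p q, i != j ->
     X' (pe i p) (pe j q) = X (pe i p) (pe j q) - x i j p + y i j q) ->
  (forall i p q, p != q -> X' (pe i p) (pe i q) + X' (pe i q) (pe i p) =
     X (pe i p) (pe i q) + X (pe i q) (pe i p) + s i p + s i q) ->
  (forall i j p q, i != j -> W' (pe i p) (pe j q) + W' (pe j q) (pe i p) =
     W (pe i p) (pe j q) + W (pe j q) (pe i p) - y i j q - y j i p + c i j) ->
  (forall i j k q, i != j -> i != k -> j != k -> y i k q + y j k q = 0) ->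
  rep3 v C X W -> rep3 v C' X' W'.
Proof.
move=> sC' HC HE1 HE2 HX HS HW Hy [v0 sC v1 v2 [v3 v4 v5]].
split=> //; last split.
- by move=> *; rewrite v1 // !HC // pe_eq eqxx.
- by move=> i j *; rewrite v2 // !HC // pe_eq ?eqxx //; decide_eqs.
- by move=> i j k *; rewrite v3 // !HC // pe_eq; decide_eqs.
- move=> i j k p q r a b ij ik jk pq pr qr; rewrite v4 //=.
  rewrite !HC ?pe_eq ?eqxx; do ?by decide_eqs.
  rewrite !(HE1 i j k) // !HX //.
  have W1 h p' q' : i != h -> W' (pe i p') (pe h q') = W (pe i p') (pe h q') +
      W (pe h q') (pe i p') - y i h q' - y h i p' + c i h - W' (pe h q') (pe i p').
    by move=> ih; rewrite -HW // addrK.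
  have y1 p' : y k i p' = - y j i p'.
    by apply/eqP; rewrite -addr_eq0 addrC Hy // eq_sym.
  by rewrite !W1 // !y1; field.
- move=> i j k p p' q q' r ij ik jk pp qq; rewrite v5 //=.
  rewrite !HC ?pe_eq ?eqxx; do ?by decide_eqs.
  rewrite !(HE2 i j k) // !(HX i k) // !(HX j k) //.
  have S1 h p1' p2' : p1' != p2' -> X' (pe h p1') (pe h p2') = X (pe h p1') (pe h p2') +
      X (pe h p2') (pe h p1') + s h p1' + s h p2' - X' (pe h p2') (pe h p1').
    by move=> ab; rewrite -HS // addrK.
  have y1 p1' : y j k p1' = - y i k p1'.
    by apply/eqP; rewrite -addr_eq0 addrC Hy.
  by rewrite (S1 i p p') // (S1 j q q') // !y1; field.
Qed.

Lemma rep3_exists_triples C : sym3 C ->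
  exists2 v, v \in Cb 3 & rep3 v C (fun _ _ => 0) (fun _ _ => 0).
Proof.
move=> [sC tC]; have /choice[w wP] : forall e, exists w, w \in Cb 2 /\
    rep2 w (fun x y => C e x y / 3) (fun=> 0).
  move=> e; have [|w wC rw] := @rep2_exists (fun x y => C e x y / 3) (fun=> 0).
    by move=> x y; rewrite tC.
  by exists w.
have := rep3_sum (fun e => rep3_edge_op t_gt1 e (wP e).2); set v := \sum_e _ => rv.
exists v; first by apply: memv_suml => e _; apply: Cb_edge_op; apply: (wP e).1.
move: rv; congr (rep3 _ _ _ _); apply: funext => x; apply: funext => y.
- apply: funext => z; rewrite !big_split /= !sum_delta (sC y x) (sC z x) (tC x z).
  by field.
- by rewrite big1 // => e _; rewrite mulr0.
- by rewrite big1.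
Qed.

Lemma rep3_exists_cross X :
  exists2 v, v \in Cb 3 & rep3 v (fun _ _ _ => 0) X (fun _ _ => 0).
Proof.
have /choice[w wP] : forall e, exists w, w \in Cb 2 /\ rep2 w (fun _ _ => 0) (X e).
  by move=> e; have [|w wC rw] := @rep2_exists (fun _ _ => 0) (X e); [|exists w].
have := rep3_sum (fun e => rep3_edge_op t_gt1 e (wP e).2); set v := \sum_e _ => rv.
exists v; first by apply: memv_suml => e _; apply: Cb_edge_op; apply: (wP e).1.
move: rv; congr (rep3 _ _ _ _); apply: funext => x; apply: funext => y.
- by apply: funext => z; rewrite big1 // => e _; ring.
- by rewrite sum_delta.
- by rewrite big1.
Qed.

(** The terms [W] come from [Dbeta], the terms [X] from edge operators applied to the
   terms [D] of the previous space. *)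
Lemma rep3_exists C X W : sym3 C -> exists2 v, v \in Cb 3 & rep3 v C X W.
Proof.
move=> [sC tC]; have k0 := D_scale3_neq0.
pose C2 x y := if pathof x == pathof y then 0 else - 15 * (W x y +
W y x) / D_scale t R 3.
have [|u uC ru] := @rep2_exists C2 (fun=> 0).
  by move=> x y; rewrite /C2 eq_sym (addrC (W y x)).
have rD := rep3_D t_gt1 ru; case: (rD) => _ [sA tA] _ _ _.
set A := (fun x y z => D_scale t R 3 * _) in rD sA tA.
have [|w wC rw] := @rep3_exists_triples (fun x y z => C x y z - A x y z).
  by split=> x y z; congr (_ - _); [exact: sC | exact: sA | exact: tC | exact: tA].
have [w' w'C rw'] := rep3_exists_cross X.
exists (1 *: Dbeta R M u + (1 *: w + w')).
  rewrite !scale1r; apply: memvD; first exact: Cbeta_D.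
  exact: memvD.
have := rep3_lin 1 rD (rep3_lin 1 rw rw').
apply: (@rep3_gauge (fun _ _ _ => 0) (fun _ _ _ => 0) (fun _ _ => 0) (fun _ _ => 0))
  => //.
- by move=> *; ring.
- by move=> *; rewrite /=; field.
- by move=> *; rewrite /=; field.
- by move=> i j p q ij; rewrite /average_cross /C2 pathE; decide_eqs; ring.
- by move=> i p q pq; rewrite /average_cross /C2 pathE !eqxx; ring.
- by move=> i j p q ij; rewrite /C2 !pathE; decide_eqs; field.
- by move=> *; ring.
Qed.

End Realization.

(** * Normal forms of the coefficients *)

(** The cyclic order on the long paths selects one path of each pair. *)
Definition nxt (i : 'I_3) : 'I_3 := if i == i0 then i1 else if i == i1 then i2 else i0.

Lemma nxt_neq i : i != nxt i. Proof. by move: i; apply: ord3P. Qed.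
Lemma nxt2_neq i : i != nxt (nxt i). Proof. by move: i; apply: ord3P. Qed.
Lemma nxt3 i : nxt (nxt (nxt i)) = i. Proof. by move: i; apply: ord3P. Qed.
Lemma neq_nxt i j : i != j -> j = nxt i \/ i = nxt j.
Proof.
by move: i j; do 2!apply: ord3P => //; move=> _; (left; apply/eqP; done) || (right;
  apply/eqP; done).
Qed.

Lemma third_path (i j k k' : 'I_3) : i != j -> i != k -> j != k ->
  (k' != i) && (k' != j) = (k' == k).
Proof. by move: i j k k'; do 4!apply: ord3P. Qed.

Lemma nxt_pick (i j k : 'I_3) : i != j -> i != k -> j != k ->
    (i == nxt k) = (j != nxt k).
Proof. by move: i j k; do 3!apply: ord3P. Qed.

Section NormalForms.
Variables (t : nat) (R : realFieldType).
Hypothesis t_gt5 : (5 < t)%N.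
Let t_gt1 : (1 < t)%N. Proof. by lia. Qed.
Let t_gt2 : (2 < t)%N. Proof. by lia. Qed.
Let t_gt4 : (4 < t)%N. Proof. by lia. Qed.
Notation M := (theta_matroid t).
Notation V := (flat_space R M).
Implicit Types (i j k : 'I_3) (p q r : 'I_t).
Notation E := (edge (gtheta t)).
Notation pe := (@pe t).
Notation eps := (eps t).
Implicit Types (v w : V) (e f x y z : E) (a : R).
Notation rep2 := (@rep2 t R).
Notation rep3 := (@rep3 t R).

Definition pos0 : 'I_t := Ordinal (ltnW t_gt1).
Notation p0 := pos0.

Definition normal2 (D : E -> R) := forall i, D (pe i p0) = 0.

(** The freedom in [rep3_gauge] is used up as follows: the first line fixes [s], the
   second [x], the last [y] and [c].  The third and fourth lines select one of the two
   orders in symmetric sums. *)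
Definition normal3 (C : E -> E -> E -> R) (X W : E -> E -> R) :=
  [/\ forall i p, C eps (pe i p) (pe (nxt i) p0) = 0,
      forall i j p, i != j -> X (pe i p) (pe j p0) = 0,
      forall i p q, (q <= p)%N -> X (pe i p) (pe i q) = 0,
      forall i j p q, i != nxt j -> W (pe i p) (pe j q) = 0 &
      forall j q, W (pe (nxt j) p0) (pe j q) = 0].

Lemma distinct_pairs_eq0 C : sym2 C ->
  (forall i p q, p != q -> C (pe i p) (pe i q) = 0 :> R) ->
  (forall i j p q, i != j -> C (pe i p) (pe j q) = 0) ->
  (forall i p, C eps (pe i p) = 0) ->
  forall x y, x != y -> C x y = 0.
Proof.
move=> sC H1 H2 H3 x y; case: (edgeP x) => [|i p]; case: (edgeP y) => [|j q].
- by rewrite eqxx.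
- by rewrite H3.
- by rewrite sC H3.
by rewrite pe_eq; have [<- /H1|/H2] := eqVneq i j.
Qed.

Lemma distinct_triples_eq0 C : sym3 C ->
  (forall i p q r, p != q -> p != r -> q != r ->
     C (pe i p) (pe i q) (pe i r) = 0 :> R) ->
  (forall i j p q r, i != j -> p != q -> C (pe i p) (pe i q) (pe j r) = 0) ->
  (forall i j k p q r, i != j -> i != k -> j != k ->
  C (pe i p) (pe j q) (pe k r) = 0) ->
  (forall i p q, p != q -> C eps (pe i p) (pe i q) = 0) ->
  (forall i j p q, i != j -> C eps (pe i p) (pe j q) = 0) ->
  forall x y z, x != y -> x != z -> y != z -> C x y z = 0.
Proof.
move=> [sC tC] H1 H2 H3 H4 H5.
have He i j p q : pe i p != pe j q -> C eps (pe i p) (pe j q) = 0.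
  by rewrite pe_eq; have [<- /H4|/H5] := eqVneq i j.
move=> x y z; case: (edgeP x) => [|i p]; case: (edgeP y) => [|j q];
  case: (edgeP z) => [|k r]; rewrite ?eqxx // => xy xz yz.
- exact: He.
- by rewrite sC He.
- by rewrite tC sC He.
move: xy xz yz; rewrite !pe_eq.
have [<-|ij] /= := eqVneq i j; have [<-|ik] /= := eqVneq i k => //.
- exact: H1.
- by move=> pq _ _; apply: H2.
- by move=> _ pr _; rewrite tC; apply: H2.
move=> _ _; have [<-|jk] /= := eqVneq j k; last by move=> _; apply: H3.
by rewrite sC tC => qr; apply: H2; rewrite // eq_sym.
Qed.

(** The shapes 3 and 22 determine the pairs of path edges; [D] vanishes at [pos0], so that
   e211 determines first the pairs with [eps], then [D]. *)
Lemma rep2_inj C D : rep2 0 C D -> normal2 D ->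
  (forall x y, x != y -> C x y = 0) /\ (forall i p, D (pe i p) = 0).
Proof.
case=> _ sC v1 v2 v3 nD.
have E1 i p q : p != q -> C (pe i p) (pe i q) = 0.
  apply: (sum_pairs_triples_eq0 (f := fun p q => C (pe i p) (pe i q))) => // *.
  by rewrite -v1 // value0.
have E2 i j p q : i != j -> C (pe i p) (pe j q) = 0.
  move=> ij; apply: (sum_pairs_eq0 t_gt2 (f := fun p => C (pe i p) (pe j q))).
  move=> {}p p' pp; apply: (sum_pairs_eq0 t_gt2
    (f := fun q => C (pe i p) (pe j q) + C (pe i p') (pe j q))) => {}q q' qq.
  by have := v2 i j p p' q q' ij pp qq; rewrite value0; lra.
have E3 i j k p p' q r : i != j -> i != k -> j != k -> p != p' ->
    C eps (pe i p) + C eps (pe i p') + D (pe j q) + D (pe k r) = 0.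
  move=> ij ik jk pp; have := v3 i j k p p' q r ij ik jk pp.
  by rewrite value0 !E1 // !E2 //; lra.
have E4 i p : C eps (pe i p) = 0.
  apply: (sum_pairs_eq0 t_gt2 (f := fun p => C eps (pe i p))) => {}p p' pp.
  have := E3 i (nxt i) (nxt (nxt i)) p p' p0 p0 (nxt_neq _) (nxt2_neq _) (nxt_neq _) pp.
  by rewrite !nD; lra.
split; first exact: distinct_pairs_eq0.
move=> i p; have [q] := @exists_notin t [:: p0] (ltnW t_gt2); rewrite inE eq_sym => pq.
have := E3 (nxt i) i (nxt (nxt i)) p0 q p p0.
by rewrite !E4 nD nxt_neq nxt2_neq eq_sym nxt_neq => /(_ isT isT isT pq); lra.
Qed.

(** The shapes 32 and 222 determine the triples that meet two or three long paths.  By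
   e311 a triple on one path is a sum over its pairs, which the shape 4 forces to be zero;
   hence [Z e f] does not depend on the position of [f].  In e221, comparison with
   position [pos0] isolates [X], and then [W] vanishes with [Z].  What is left of e221 is
   a relation between [C eps] and [X] on single paths, settled by the normalization. *)
Lemma rep3_inj C X W : rep3 0 C X W -> normal3 C X W ->
  [/\ forall x y z, x != y -> x != z -> y != z -> C x y z = 0,
      forall i j p q, X (pe i p) (pe j q) = 0 &
      forall i j p q, W (pe i p) (pe j q) = 0].
Proof.
case=> _ sC v1 v2 [v3 v4 v5] [N1 N2 N3 N4 N5]; have [sC1 tC1] := sC.
pose Z e f := X e f + W e f + W f e.
have C32 i j p q r : i != j -> p != q -> C (pe i p) (pe i q) (pe j r) = 0.
  move=> ij pq; apply: (sum_pairs_eq0 t_gt2 (f := fun r => C (pe i p) (pe i q) (pe j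
    r))).
  move=> r1 r2 rr; apply: (sum_pairs_triples_eq0 (f := fun p q =>
    C (pe i p) (pe i q) (pe j r1) + C (pe i p) (pe i q) (pe j r2))) => //.
    by move=> p' q'; rewrite !(sC1 (pe i q')).
  move=> p1 p2 p3 h1 h2 h3; have := v2 i j p1 p2 p3 r1 r2 ij h1 h2 h3 rr.
  by rewrite value0; lra.
have C222 i j k p q r : i != j -> i != k -> j != k -> C (pe i p) (pe j q) (pe k r) = 0.
  move=> ij ik jk.
  apply: (sum_pairs_eq0 t_gt2 (f := fun p => C (pe i p) (pe j q) (pe k r))) => p1 p2 pp.
  apply: (sum_pairs_eq0 t_gt2 (f := fun q => C (pe i p1) (pe j q) (pe k r) +
    C (pe i p2) (pe j q) (pe k r))) => q1 q2 qq.
  apply: (sum_pairs_eq0 t_gt2 (f := fun r => C (pe i p1) (pe j q1) (pe k r) +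
    C (pe i p2) (pe j q1) (pe k r) + (C (pe i p1) (pe j q2) (pe k r) +
    C (pe i p2) (pe j q2) (pe k r)))) => r1 r2 rr.
  by have := v3 i j k p1 p2 q1 q2 r1 r2 ij ik jk pp qq rr; rewrite value0; lra.
pose u i j k q r p1 p2 := C eps (pe i p1) (pe i p2) +
  (Z (pe i p1) (pe j q) + Z (pe i p2) (pe j q) + Z (pe i p1) (pe k r) +
  Z (pe i p2) (pe k r)) / 2.
have C3u i j k p1 p2 p3 q r : i != j -> i != k -> j != k -> p1 != p2 -> p1 != p3 ->
  p2 != p3 ->
    C (pe i p1) (pe i p2) (pe i p3) +
    u i j k q r p1 p2 + u i j k q r p1 p3 + u i j k q r p2 p3 = 0.
  move=> ij ik jk h1 h2 h3; have := v4 i j k p1 p2 p3 q r ij ik jk h1 h2 h3.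
  by rewrite value0 /= !(C32 i j) // !(C32 i k) // /u /Z; lra.
have u0 i j k p1 p2 q r : i != j -> i != k -> j != k -> p1 != p2 ->
  u i j k q r p1 p2 = 0.
  move=> ij ik jk; apply: (sum_pairs_quads_eq0 (f := u i j k q r)) => //.
    by move=> p p'; rewrite /u (tC1 _ (pe i p)); lra.
  move=> a b c d ab ac ad bc drop_sum cd;
    have := v1 i a b c d ab ac ad bc drop_sum cd; rewrite value0.
  have := C3u i j k a b c q r ij ik jk ab ac bc;
    have := C3u i j k a b d q r ij ik jk ab ad drop_sum.
  have := C3u i j k a c d q r ij ik jk ac ad cd;
    have := C3u i j k b c d q r ij ik jk bc drop_sum cd.
  lra.
have C4 i p q r : p != q -> p != r -> q != r -> C (pe i p) (pe i q) (pe i r) = 0.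
  move=> pq pr qr; have [h1 h2 h3] := And3 (nxt_neq i) (nxt2_neq i) (nxt_neq (nxt i)).
  have := C3u i (nxt i) (nxt (nxt i)) p q r p0 p0 h1 h2 h3 pq pr qr.
  by rewrite !u0 //; lra.
have third i j : i != j -> exists k, i != k /\ j != k.
  case/neq_nxt=> ->.
    by exists (nxt (nxt i)); rewrite nxt2_neq nxt_neq.
  by exists (nxt (nxt j)); rewrite nxt2_neq nxt_neq.
have Zq i j p q q' : i != j -> Z (pe i p) (pe j q) = Z (pe i p) (pe j q').
  move=> ij; have [k [ik jk]] := third i j ij; apply/eqP; rewrite -subr_eq0; apply/eqP.
  apply: (sum_pairs_eq0 t_gt2
    (f := fun p => Z (pe i p) (pe j q) - Z (pe i p) (pe j q'))) => p1 p2 pp.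
  have := u0 i j k p1 p2 q p0 ij ik jk pp; have := u0 i j k p1 p2 q' p0 ij ik jk pp.
  by rewrite /u; lra.
pose S e f := X e f + X f e.
have T0 i j p1 p2 q1 q2 : i != j -> p1 != p2 -> q1 != q2 ->
    C eps (pe i p1) (pe j q1) + C eps (pe i p1) (pe j q2) +
    C eps (pe i p2) (pe j q1) + C eps (pe i p2) (pe j q2) +
    S (pe i p1) (pe i p2) + S (pe j q1) (pe j q2) = 0.
  move=> ij pp qq; have [k [ik jk]] := third i j ij.
  have := v5 i j k p1 p2 q1 q2 p0 ij ik jk pp qq; rewrite value0 /= !N2 //.
  have C32' p q q' : q != q' -> C (pe i p) (pe j q) (pe j q') = 0.
    by move=> qq'; rewrite sC1 tC1 C32 // eq_sym.
  by rewrite !C32 // !C32' // !C222 // /S; lra.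
have X4 i j k p1 p2 q1 q2 r : i != j -> i != k -> j != k -> p1 != p2 -> q1 != q2 ->
    X (pe i p1) (pe k r) + X (pe i p2) (pe k r) + X (pe j q1) (pe k r) +
    X (pe j q2) (pe k r) = 0.
  move=> ij ik jk pp qq.
  have := v5 i j k p1 p2 q1 q2 r ij ik jk pp qq; rewrite value0 /=.
  have C32' p q q' : q != q' -> C (pe i p) (pe j q) (pe j q') = 0.
    by move=> qq'; rewrite sC1 tC1 C32 // eq_sym.
  rewrite !C32 // !C32' // !C222 //; have := T0 i j p1 p2 q1 q2 ij pp qq;
    rewrite /S; lra.
have another p : exists q, p != q.
  by have [q] := @exists_notin t [:: p] (ltnW t_gt2); rewrite inE eq_sym; exists q.
have Xneg i j k p q r : i != j -> i != k -> j != k ->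
    X (pe i p) (pe k r) = - X (pe j q) (pe k r).
  move=> ij ik jk; have H i' j' p' q1 q2 : i' != j' -> i' != k -> j' != k -> q1 != q2 ->
      X (pe i' p') (pe k r) + (X (pe j' q1) (pe k r) + X (pe j' q2) (pe k r)) / 2 = 0.
    move=> ij' ik' jk' qq; apply: (sum_pairs_eq0 t_gt2 (f := fun p =>
      X (pe i' p) (pe k r) + (X (pe j' q1) (pe k r) +
      X (pe j' q2) (pe k r)) / 2)) => p1 p2 pp.
    by have := X4 i' j' k p1 p2 q1 q2 r ij' ik' jk' pp qq; lra.
  have ji : j != i by rewrite eq_sym.
  have [p' pp] := another p; have [q' qq] := another q.
  have := H i j p q q' ij ik jk qq; have := H i j p' q q' ij ik jk qq.
  have := H j i q p p' ji jk ik pp; lra.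
have Znxt j p q : Z (pe (nxt j) p) (pe j q) =
    X (pe (nxt j) p) (pe j q) + W (pe (nxt j) p) (pe j q).
  by rewrite /Z (N4 j) ?addr0 // nxt2_neq.
have Xd i k p r : i != k -> X (pe i p) (pe k r) = 0.
  have Xnxt p' : X (pe (nxt k) p') (pe k r) = 0.
    have nk := nxt_neq k; have nk2 := nxt2_neq k.
    have z0 : X (pe (nxt k) p0) (pe k r) = 0.
      have := Zq (nxt k) k p0 r p0; rewrite eq_sym nxt_neq !Znxt !N5 (N2 (nxt k))
        ?(eq_sym _ k) //.
      by move/(_ isT); lra.
    have d1 : nxt k != nxt (nxt k) := nxt_neq _.
    have := Xneg (nxt k) (nxt (nxt k)) k p0 p0 r d1;
      have := Xneg (nxt k) (nxt (nxt k)) k p' p0 r d1.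
    by rewrite !(eq_sym _ k) nk nk2 => /(_ isT isT) + /(_ isT isT); rewrite z0; lra.
  move=> ik; case: (neq_nxt ik) => [ki|->]; last exact: Xnxt.
  have ni : i != nxt k by rewrite ki nxt2_neq.
  rewrite (Xneg i (nxt k) k p p0) ?Xnxt ?oppr0 //.
  by rewrite eq_sym nxt_neq.
have Wn j p q : W (pe (nxt j) p) (pe j q) = 0.
  have jn : j != nxt j := nxt_neq j.
  have := Zq j (nxt j) q p p0 jn; rewrite /Z !Xd // !(N4 j) ?nxt2_neq // N5; lra.
have W0 i j p q : W (pe i p) (pe j q) = 0.
  by have [->|/N4] := eqVneq i (nxt j).
have Z0 i j p q : i != j -> Z (pe i p) (pe j q) = 0.
  by move=> ij; rewrite /Z Xd // !W0; ring.
have Cii i p q : p != q -> C eps (pe i p) (pe i q) = 0.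
  move=> pq; have [h1 h2 h3] := And3 (nxt_neq i) (nxt2_neq i) (nxt_neq (nxt i)).
  by have := u0 i (nxt i) (nxt (nxt i)) p q p0 p0 h1 h2 h3 pq; rewrite /u !Z0 //; lra.
have Ssym e f : S e f = S f e by rewrite /S addrC.
have Sstep i p p1 p2 : p != p1 -> p != p2 ->
    S (pe i p) (pe i p1) = S (pe i p) (pe i p2) /\
    forall q, C eps (pe i p1) (pe (nxt i) q) = C eps (pe i p2) (pe (nxt i) q).
  move=> h1 h2; have f0 q : C eps (pe i p1) (pe (nxt i) q) - C eps (pe i p2) (pe (nxt
    i) q) +
      (S (pe i p) (pe i p1) - S (pe i p) (pe i p2)) / 2 = 0.
    apply: (sum_pairs_eq0 t_gt2 (f := fun q => C eps (pe i p1) (pe (nxt i) q) -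
      C eps (pe i p2) (pe (nxt i) q) +
      (S (pe i p) (pe i p1) - S (pe i p) (pe i p2)) / 2)) => q1 q2 qq.
    have := T0 i (nxt i) p p1 q1 q2 (nxt_neq i) h1 qq.
    by have := T0 i (nxt i) p p2 q1 q2 (nxt_neq i) h2 qq; lra.
  have SS : S (pe i p) (pe i p1) = S (pe i p) (pe i p2) by have := f0 p0;
    rewrite !N1; lra.
  by split=> // q; have := f0 q; rewrite SS; lra.
have [q0 q0P] := another p0.
have Sconst i p q : p != q -> S (pe i p) (pe i q) = S (pe i p0) (pe i q0).
  have [<- pq|pp0 pq] := eqVneq p0 p; first exact: (Sstep i p0 q q0 pq q0P).1.
  rewrite (Sstep i p q p0 pq _).1 1?eq_sym // Ssym.
  exact: (Sstep i p0 p q0 pp0 q0P).1.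
have Cconst i p q : C eps (pe i p) (pe (nxt i) q) = C eps (pe i p0) (pe (nxt i) q).
  have [p'] := @exists_notin t [:: p; p0] t_gt2; rewrite !inE negb_or => /andP[h1 h2].
  exact: (Sstep i p' p p0 h1 h2).2.
have C0 i q : 2 * C eps (pe i p0) (pe (nxt i) q) +
    (S (pe i p0) (pe i q0) + S (pe (nxt i) p0) (pe (nxt i) q0)) / 2 = 0.
  apply: (sum_pairs_eq0 t_gt2 (f := fun q => 2 * C eps (pe i p0) (pe (nxt i) q) +
    (S (pe i p0) (pe i q0) + S (pe (nxt i) p0) (pe (nxt i) q0)) / 2)) => q1 q2 qq.
  have := T0 i (nxt i) p0 q0 q1 q2 (nxt_neq i) q0P qq.
  by rewrite (Sconst _ _ _ qq) !(Cconst i q0); lra.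
have SS i : S (pe i p0) (pe i q0) + S (pe (nxt i) p0) (pe (nxt i) q0) = 0.
  by have := C0 i p0; rewrite N1; lra.
have S0 i p q : p != q -> S (pe i p) (pe i q) = 0.
  by move=> /Sconst ->; have := SS i; have := SS (nxt i); have := SS (nxt (nxt i));
     rewrite nxt3; lra.
have Cnxt i p q : C eps (pe i p) (pe (nxt i) q) = 0.
  by rewrite Cconst; have := C0 i q; rewrite SS; lra.
split=> //.
  apply: distinct_triples_eq0 => // i j p q /neq_nxt[->|->] //.
  by rewrite tC1.
move=> i j p q; have [<-|ij] := eqVneq i j; last exact: Xd.
have [qp|pq] := leqP q p; first exact: N3.
have := S0 i p q; rewrite -val_eqE neq_ltn pq => /(_ isT).
by rewrite /S (N3 i q p) ?addr0 // ltnW.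
Qed.

(** The solution [s] of the cyclic system [s i + s (nxt i) = m i] *)
Definition cyclic_half (m : 'I_3 -> R) i := (m i + m (nxt (nxt i)) - m (nxt i)) / 2.

Lemma cyclic_halfE m i : cyclic_half m i + cyclic_half m (nxt i) = m i.
Proof. by rewrite /cyclic_half nxt3; field. Qed.

Definition unpe (e : E) : option ('I_3 * 'I_t) :=
  [pick ip : 'I_3 * 'I_t | pe ip.1 ip.2 == e].

Lemma unpeK i p : unpe (pe i p) = Some (i, p).
Proof.
rewrite /unpe; case: pickP => [[j q] /=|/(_ (i, p))]; last by rewrite /= eqxx.
by rewrite pe_eq => /andP[/eqP-> /eqP->].
Qed.

(** Extends a function of two path edges to the triples that contain [eps] *)
Definition eps_ext (g : E -> E -> R) x y z :=
  if x == eps then g y z else if y == eps then g x z else if z == eps then g x y else 0.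

Lemma eps_ext_sym g : sym2 g -> sym3 (eps_ext g).
Proof.
move=> sg; split=> x y z; rewrite /eps_ext.
  by have [xe|xe] := eqVneq x eps; have [ye|ye] := eqVneq y eps; rewrite ?xe ?ye // sg.
have [xe|xe] := eqVneq x eps; first exact: sg.
by have [ye|ye] := eqVneq y eps; have [ze|ze] := eqVneq z eps; rewrite ?ye ?ze.
Qed.

Definition path_fun (F : 'I_3 -> 'I_t -> 'I_3 -> 'I_t -> R) (e f : E) : R :=
  if unpe e is Some (i, p) then if unpe f is Some (j, q) then F i p j q else 0 else 0.

Lemma path_funE F i p j q : path_fun F (pe i p) (pe j q) = F i p j q.
Proof. by rewrite /path_fun !unpeK. Qed.

Lemma path_fun_sym F : (forall i p j q, F i p j q = F j q i p) -> sym2 (path_fun F).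
Proof.
move=> sF x y; rewrite /path_fun; case: (unpe x) => [[i p]|];
  case: (unpe y) => [[j q]|] //.
Qed.

(** The functions of [rep3_gauge] are read off from the entries that have to vanish; the
   equations for [s] at [pos0] form a cyclic system. *)
Lemma rep3_normal v C X W : rep3 v C X W ->
  exists C' X' W', rep3 v C' X' W' /\ normal3 C' X' W'.
Proof.
move=> rv; have [_ sC _ _ _] := rv; have [sC1 tC1] := sC.
pose Ws i p j q := W (pe i p) (pe j q) + W (pe j q) (pe i p).
pose x i j p := X (pe i p) (pe j p0).
pose om j q := Ws (nxt j) p0 j q - Ws (nxt j) p0 j p0.
pose y i j q := if i == nxt j then om j q else - om j q.
pose c i j := - Ws i p0 j p0.
pose h i p j q := \sum_(k | (k != i) && (k != j)) (x i k p + x j k q) / 2.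
pose m i := 2 * (C eps (pe i p0) (pe (nxt i) p0) + h i p0 (nxt i) p0).
pose s i p := 2 * (C eps (pe i p) (pe (nxt i) p0) +
h i p (nxt i) p0) - cyclic_half m (nxt i).
pose g i p j q := h i p j q -
  (if i == j then \sum_(k | k != i) c i k else (s i p + s j q) / 2).
pose C' e f z := C e f z + eps_ext (path_fun g) e f z.
pose X' := path_fun (fun i p j q => if i == j then
    if (p < q)%N then X (pe i p) (pe i q) + X (pe i q) (pe i p) + s i p + s i q else 0
  else X (pe i p) (pe j q) - x i j p + y i j q).
pose W' := path_fun (fun i p j q =>
  if i == nxt j then Ws i p j q - y i j q - y j i p + c i j else 0).
have hsym i p j q : h i p j q = h j q i p.
  by apply: eq_big => k; [rewrite andbC | rewrite (addrC (x j k q))].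
have gsym i p j q : g i p j q = g j q i p.
  rewrite /g hsym eq_sym; congr (_ - _); case: eqP => [-> //|_]; by rewrite addrC.
have [sg1 sg2] := eps_ext_sym (path_fun_sym gsym).
have om0 j : om j p0 = 0 by rewrite /om subrr.
have y0 i j : y i j p0 = 0 by rewrite /y om0 oppr0 if_same.
have hE i j k p q : i != j -> i != k -> j != k -> h i p j q = (x i k p + x j k q) / 2.
  by move=> ij ik jk; rewrite /h (big_pred1 k) // => k'; apply: third_path.
have sum2 i j k (F : 'I_3 -> R) : i != j -> i != k -> j != k ->
    \sum_(k' | k' != i) F k' = F j + F k.
  move=> ij ik jk; rewrite (bigD1 j) 1?eq_sym //= (big_pred1 k) // => k'.
  exact: third_path.
exists C', X', W'; split.
  apply: (@rep3_gauge t R x y c s) rv => //.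
  - by split=> e f z; rewrite /C'; [rewrite sC1 sg1 | rewrite tC1 sg2].
  - by move=> *; rewrite /C' /eps_ext !pe_eps addr0.
  - move=> i j k p q ij ik jk _; rewrite /C' /eps_ext eqxx path_funE /g eqxx /h.
    under eq_bigl do rewrite andbb.
    by rewrite !(sum2 i j k) //; field.
  - move=> i j k p q ij ik jk; rewrite /C' /eps_ext eqxx path_funE /g (negbTE ij).
    by rewrite (hE i j k) //; ring.
  - by move=> i j p q ij; rewrite /X' path_funE (negbTE ij).
  - move=> i p q; rewrite -val_eqE /X' !path_funE eqxx.
    by case: ltngtP => //= _ _; ring.
  - move=> i j p q ij; have cs : c i j = c j i by rewrite /c /Ws addrC.
    rewrite /W' !path_funE; case: (neq_nxt ij) => [ji|ji].
      by rewrite ji eqxx (negbTE (nxt2_neq i)) -ji cs /Ws; ring.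
    by rewrite ji eqxx (negbTE (nxt2_neq j)) -ji /Ws; ring.
  - move=> i j k q ij ik jk; rewrite /y (nxt_pick ij ik jk).
    by case: (j == nxt k) => /=; ring.
split.
- move=> i p; rewrite /C' /eps_ext eqxx path_funE /g (negbTE (nxt_neq i)).
  have -> : s (nxt i) p0 = cyclic_half m (nxt i).
    by apply/eqP; rewrite /s -/(m _) subr_eq cyclic_halfE.
  by rewrite /s; field.
- by move=> i j p ij; rewrite /X' path_funE (negbTE ij) y0 /x; ring.
- by move=> i p q qp; rewrite /X' path_funE eqxx ltnNge qp.
- by move=> i j p q ij; rewrite /W' path_funE (negbTE ij).
move=> j q; rewrite /W' path_funE eqxx y0 /c /y eqxx /om; ring.
Qed.

Lemma rep2_normal v C D : rep2 v C D -> exists C' D', rep2 v C' D' /\ normal2 D'.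
Proof.
case=> v0 sC v1 v2 v3; pose d i := D (pe i p0).
pose m e := if unpe e is Some (i, _) then (\sum_(j | j != i) d j) / 2 else 0.
pose C' x y := C x y + (if x == eps then m y else if y == eps then m x else 0).
pose D' e := if unpe e is Some (i, p) then D (pe i p) - d i else 0.
have sum2 i j k (F : 'I_3 -> R) : i != j -> i != k -> j != k ->
    \sum_(k' | k' != i) F k' = F j + F k.
  move=> ij ik jk; rewrite (bigD1 j) 1?eq_sym //= (big_pred1 k) // => k'.
  exact: third_path.
exists C', D'; split; last by move=> i; rewrite /D' unpeK subrr.
split=> //.
- move=> x y; rewrite /C' sC; congr (_ + _).
  by have [xe|xe] := eqVneq x eps; have [ye|ye] := eqVneq y eps; rewrite ?xe ?ye.
- by move=> *; rewrite v1 // /C' !pe_eps !addr0.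
- by move=> *; rewrite v2 // /C' !pe_eps !addr0.
move=> i j k p p' q r ij ik jk pp; rewrite v3 // /C' !pe_eps eqxx /m /D' !unpeK.
by rewrite (sum2 i j k) //; field.
Qed.

End NormalForms.

(** * Dimensions *)

Section Counting.

Lemma card_sum_pred (A B : finType) (P : pred (A + B)) :
  #|[set s | P s]| = (#|[set a | P (inl a)]| + #|[set b | P (inr b)]|)%N.
Proof.
rewrite -!sum1_card big_sumType; congr (_ + _)%N; apply: eq_bigl => x; by rewrite !inE.
Qed.

Lemma card_pair_pred (A B : finType) (P : pred (A * B)) :
  #|[set s | P s]| = (\sum_a \sum_b P (a, b))%N.
Proof.
rewrite pair_big -sum1_card big_mkcond; apply: eq_bigr => -[a b] _ /=.
by rewrite inE; case: (P _).
Qed.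

Lemma sum_ltn t : (\sum_(p < t) \sum_(q < t) (p < q))%N = 'C(t, 2).
Proof.
rewrite exchange_big -[RHS]bin2_sum big_mkord; apply: eq_bigr => q _.
rewrite -big_mkcond /= -(big_ord_widen t (fun=> 1%N) (ltnW (ltn_ord q))).
by rewrite sum_nat_const card_ord muln1.
Qed.

End Counting.

Section Dimensions.
Variables (t : nat) (R : realFieldType).
Hypothesis t_gt5 : (5 < t)%N.
Let t_gt1 : (1 < t)%N. Proof. by lia. Qed.
Let t_gt2 : (2 < t)%N. Proof. by lia. Qed.
Notation M := (theta_matroid t).
Notation V := (flat_space R M).
Implicit Types (i j k : 'I_3) (p q r : 'I_t).
Notation E := (edge (gtheta t)).
Notation pe := (@pe t).
Notation eps := (eps t).
Implicit Types (v w : V) (e f x y z : E) (a : R).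
Notation rep1 := (@rep1 t R).
Notation rep2 := (@rep2 t R).
Notation rep3 := (@rep3 t R).
Notation unpe := (@unpe t).
Notation p0 := (pos0 t_gt5).

Lemma hbeta0 : hbeta R M 0 = 1%N.
Proof.
rewrite /hbeta /= dim_vline; case: eqP => // v0.
have [_] := rep0_vtop t R; rewrite v0 value0 => /eqP.
by rewrite eq_sym oner_eq0.
Qed.

Lemma hbeta1 : hbeta R M 1 = (3 * t + 1)%N.
Proof.
rewrite /hbeta -(card_edge t) -cardsT.
apply: (@dimv_rep _ _ _ _ setT (fun v c => rep1 v c)).
- by move=> c _; apply: rep1_exists.
- by move=> v /(Cbeta1_rep t_gt1)[u ru]; exists u => // e; rewrite inE.
- by move=> v w c; apply: rep1_unique.
- exact: rep1_0.
- by move=> *; apply: rep1_lin.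
move=> u _ [_ v1 v2].
have up i p : u (pe i p) = 0.
  apply: (sum_pairs_eq0 t_gt2 (f := fun p => u (pe i p))) => p' q pq.
  by rewrite -v1 // value0.
move=> e; case: (edgeP e) => // .
have := v2 i0 i1 i2 p0 p0 p0 isT isT isT; rewrite value0 !up; lra.
Qed.

(** Symmetric functions of distinct edges are turned into functions of sets by averaging
   over the orderings, so that they are counted by binomial coefficients. *)
Definition pair_val (C : E -> E -> R) (A : {set E}) : R :=
  (\sum_(x in A) \sum_(y in A) if x == y then 0 else C x y) / 2.

Definition triple_val (C : E -> E -> E -> R) (A : {set E}) : R :=
  (\sum_(x in A) \sum_(y in A) \sum_(z in A)
     if [|| x == y, x == z | y == z] then 0 else C x y z) / 6.

Lemma sum_set2 x y (F : E -> R) : x != y -> \sum_(e in [set x; y]) F e = F x + F y.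
Proof. by move=> xy; rewrite big_setU1 ?inE //= big_set1. Qed.

Lemma sum_set3 x y z (F : E -> R) : x != y -> x != z -> y != z ->
  \sum_(e in [set x; y; z]) F e = F x + F y + F z.
Proof.
move=> xy xz yz; rewrite setUC big_setU1 ?inE ?negb_or ?(eq_sym z) ?xz ?yz //=.
by rewrite sum_set2 // addrC.
Qed.

Lemma pair_valE C x y : sym2 C -> x != y -> pair_val C [set x; y] = C x y.
Proof.
move=> sC xy; rewrite /pair_val !sum_set2 // !(eqxx x) !(eqxx y) (eq_sym y) (negbTE xy).
by rewrite (sC y); field.
Qed.

Lemma triple_valE C x y z : sym3 C -> x != y -> x != z -> y != z ->
  triple_val C [set x; y; z] = C x y z.
Proof.
move=> [sC tC] xy xz yz; rewrite /triple_val !sum_set3 //.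
rewrite !(eqxx x) !(eqxx y) !(eqxx z) !(eq_sym y x) !(eq_sym z x) !(eq_sym z y).
rewrite (negbTE xy) (negbTE xz) (negbTE yz) /=.
rewrite (tC x z) (sC y x) (tC y z) (sC z x) (tC x z) (sC z y) (tC y z) (sC y x).
by field.
Qed.

Definition fun2_of (A : finType) (c : {set E} + A -> R) x y : R := c (inl [set x; y]).
Definition funpe_of (A : Type) (c : A + ('I_3 * 'I_t) -> R) e : R :=
  if unpe e is Some ip then c (inr ip) else 0.

Definition index2 : {set {set E} + 'I_3 * 'I_t} :=
  [set s : {set E} + 'I_3 * 'I_t | match s with inl A => #|A| == 2 | inr ip => ip.2
  != p0 end].

Lemma card_neq_p0 : (\sum_(p < t) (p != p0) = t.-1)%N.
Proof.
rewrite -big_mkcond /= sum1_card.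
by rewrite -[t in RHS]card_ord -(cardC1 p0); apply: eq_card => p; rewrite !inE.
Qed.

Lemma card_index2 : #|index2| = ('C(3 * t + 1, 2) + 3 * t.-1)%N.
Proof.
rewrite card_sum_pred card_draws card_edge card_pair_pred /=; congr (_ + _)%N.
under eq_bigr do rewrite card_neq_p0.
by rewrite sum_nat_const card_ord.
Qed.

Lemma rep2_eq v C D C' D' : rep2 v C D -> sym2 C' ->
  (forall x y, x != y -> C' x y = C x y) ->
  (forall i p, D' (pe i p) = D (pe i p)) -> rep2 v C' D'.
Proof.
case=> v0 sC v1 v2 v3 sC' CC DD; split=> //.
- by move=> *; rewrite v1 // !CC // edgeE eqxx.
- by move=> *; rewrite v2 // !CC // edgeE; decide_eqs.
- by move=> *; rewrite v3 // !DD !CC // ?edgeE ?eqxx //; decide_eqs.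
Qed.

Lemma hbeta2 : hbeta R M 2 = ('C(3 * t + 1, 2) + 3 * t.-1)%N.
Proof.
rewrite /hbeta -card_index2.
apply: (@dimv_rep _ _ _ _ _ (fun v c => rep2 v (fun2_of c) (funpe_of c))).
- move=> c _; apply: rep2_exists => // x y; by rewrite /fun2_of setUC.
- move=> v /(Cbeta2_rep t_gt1)[C0 [D0 /(rep2_normal t_gt5)[C [D [rv nD]]]]].
  have [_ sC _ _ _] := rv.
  exists (fun s : {set E} + 'I_3 * 'I_t => match s with
    | inl A => if #|A| == 2 then pair_val C A else 0 | inr ip => D (pe ip.1 ip.2) end).
    case=> [A|[i p]]; rewrite inE; first by move/negbTE->.
    by rewrite negbK => /eqP /= ->; apply: nD.
  apply: (rep2_eq rv).
  + by move=> x y; rewrite /fun2_of setUC.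
  + by move=> x y xy; rewrite /fun2_of cards2 xy pair_valE.
  + by move=> i p; rewrite /funpe_of unpeK.
- by move=> v w c; apply: rep2_unique.
- rewrite (_ : funpe_of _ = fun=> 0); first exact: rep2_0.
  by apply: funext => e; rewrite /funpe_of; case: (unpe e).
- move=> a v w c d rv rw; rewrite (_ : funpe_of _ =
    (fun e => a * funpe_of c e + funpe_of d e)); first exact: rep2_lin.
  by apply: funext => e; rewrite /funpe_of; case: (unpe e) => //; ring.
move=> c c0 rc; have nD : normal2 t_gt5 (funpe_of c).
  by move=> i; rewrite /funpe_of unpeK c0 // inE eqxx.
have [C0 D0] := rep2_inj rc nD.
move=> [A|[i p]]; last by have := D0 i p; rewrite /funpe_of unpeK.
have [/cards2P[x [y [xy ->]]]|A2] := boolP (#|A| == 2); first exact: C0.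
by apply: c0; rewrite inE.
Qed.

Notation T := ('I_3 * 'I_t)%type.
Notation I3 := (({set E} + T * T) + T * T)%type.

Definition fun3_of (c : I3 -> R) x y z : R := c (inl (inl [set x; y; z])).
Definition cross_of (c : I3 -> R) : E -> E -> R :=
  path_fun (fun i p j q => c (inl (inr ((i, p), (j, q))))).
Definition twist_of (c : I3 -> R) : E -> E -> R :=
  path_fun (fun i p j q => c (inr ((i, p), (j, q)))).

Definition dropped : {set {set E}} := [set [set eps; pe a.1 a.2;
    pe (nxt a.1) p0] | a : T].

(** The entries of [C], [X] and [W] that a normal form leaves free *)
Definition index3 : {set I3} :=
  [set s : I3 | match s with
    | inl (inl A) => (#|A| == 3) && (A \notin dropped)
    | inl (inr (a, b)) => if a.1 == b.1 then (a.2 < b.2)%N else b.2 != p0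
    | inr (a, b) => (a.1 == nxt b.1) && (a.2 != p0)
    end].

Lemma card_dropped3 (a : T) : #|[set eps; pe a.1 a.2; pe (nxt a.1) p0]| = 3.
Proof.
rewrite setUC cardsU1 !inE pe_eps pe_eq eq_sym (negbTE (nxt_neq _)) cards2.
by rewrite eps_pe.
Qed.

Lemma card_dropped : #|dropped| = (3 * t)%N.
Proof.
rewrite card_imset ?card_prod ?card_ord // => -[i p] [j q] /= eqA.
have mem x : x \in [set eps; pe i p; pe (nxt i) p0] ->
  x \in [set eps; pe j q; pe (nxt j) p0].
  by rewrite eqA.
have := mem (pe i p); have := mem (pe (nxt i) p0); rewrite !inE !edgeE !eqxx /= !orbT.
move=> /(_ isT) h1 /(_ isT) h2; apply/eqP; rewrite xpair_eqE.
have [ij|ij] := eqVneq i j.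
  move: h2; rewrite ij eqxx (negbTE (nxt_neq j)) /= orbF; exact.
have no2 : ((nxt i == j) || (nxt i == nxt j)) && (i == nxt j) = false.
  by clear -ij; move: i j ij; do 2!apply: ord3P.
move: h1 h2; rewrite (negbTE ij) /= => h1 /andP[h2 _].
move: no2; rewrite h2 andbT; case: (nxt i == j) h1 => //=.
by case/andP=> ->.
Qed.

Lemma card_index3 :
  (#|index3| + 3 * t = 'C(3 * t + 1, 3) + (6 * (t * t.-1) + 3 * 'C(t, 2)) +
  3 * (t * t.-1))%N.
Proof.
rewrite !card_sum_pred.
have -> : (#|[set A : {set E} | (#|A| == 3) && (A \notin dropped)]| = 'C(3 * t +
  1, 3) - 3 * t)%N.
  rewrite -card_edge -card_draws -card_dropped -[RHS]cardsDS; last first.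
    by apply/subsetP=> _ /imsetP[a _ ->]; rewrite inE card_dropped3.
  by apply: eq_card => A; rewrite !inE andbC.
have le_d : (3 * t <= 'C(3 * t + 1, 3))%N.
  rewrite -card_edge -card_draws -card_dropped; apply: subset_leq_card.
  by apply/subsetP=> _ /imsetP[a _ ->]; rewrite inE card_dropped3.
have sum_p0 : (\sum_(p < t) \sum_(q < t) (q != p0) = t * t.-1)%N.
  by under eq_bigr do rewrite card_neq_p0; rewrite sum_nat_const card_ord.
have sum_p0' : (\sum_(p < t) \sum_(q < t) (p != p0) = t * t.-1)%N.
  by rewrite exchange_big; apply: sum_p0.
have sumE (F : T -> T -> nat) : (\sum_a \sum_b F a b =
    \sum_i \sum_j \sum_p \sum_q F (i, p) (j, q))%N.
  transitivity (\sum_i \sum_p \sum_b F (i, p) b)%N.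
    by rewrite [RHS]pair_bigA; apply: eq_bigr => -[].
  apply: eq_bigr => i _; rewrite [RHS]exchange_big; apply: eq_bigr => p _.
  by rewrite [RHS]pair_bigA; apply: eq_bigr => -[].
have crossE : #|[set b : T * T | let: (a, b) := b in
    if a.1 == b.1 then (a.2 < b.2)%N else b.2 != p0]| = (6 * (t * t.-1) +
    3 * 'C(t, 2))%N.
  rewrite card_pair_pred sumE.
  have E i j : (\sum_(p < t) \sum_(q < t)
      (if (i, p).1 == (j, q).1 then ((i, p).2 < (j, q).2)%N else (j, q).2 != p0) =
      if i == j then 'C(t, 2) else t * t.-1)%N.
    by rewrite /=; case: (i == j); rewrite ?sum_ltn ?sum_p0.
  under eq_bigr do under eq_bigr do rewrite E.
  by rewrite !big_ord_recl !big_ord0 /=; lia.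
have twistE : #|[set b : T * T | let: (a, b) := b in
    (a.1 == nxt b.1) && (a.2 != p0)]| = (3 * (t * t.-1))%N.
  rewrite card_pair_pred sumE.
  have E i j : (\sum_(p < t) \sum_(q < t)
      (((i, p).1 == nxt (j, q).1) && ((i, p).2 != p0)) =
      if i == nxt j then t * t.-1 else 0)%N.
    rewrite /=; case: (i == nxt j); first by rewrite sum_p0'.
    by rewrite big1 // => p _; rewrite big1.
  under eq_bigr do under eq_bigr do rewrite E.
  by rewrite !big_ord_recl !big_ord0 /=; lia.
transitivity ('C(3 * t + 1, 3) - 3 * t + (6 * (t * t.-1) + 3 * 'C(t, 2)) +
    3 * (t * t.-1) + 3 * t)%N; last by lia.
by congr (_ + _ + _ + _)%N; [exact: crossE | exact: twistE].
Qed.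

Lemma card_set3 x y z : x != y -> x != z -> y != z -> #|[set x; y; z]| = 3.
Proof.
move=> xy xz yz; rewrite setUC cardsU1 !inE negb_or !(eq_sym z) xz yz /=.
by rewrite cards2 xy.
Qed.

Lemma card3_set (A : {set E}) : #|A| = 3 ->
  exists x y z, [/\ x != y, x != z, y != z & A = [set x; y; z]].
Proof.
move=> A3; have [x xA] : exists x, x \in A by apply/card_gt0P; rewrite A3.
have /eqP/cards2P[y [z [yz Axe]]] : #|A :\ x| = 2.
  by move: A3; rewrite (cardsD1 x) xA => -[].
have ne u : u \in [set y; z] -> x != u.
  by rewrite -Axe !inE eq_sym => /andP[].
exists x, y, z; rewrite !ne ?inE ?eqxx ?orbT //; split=> //.
by rewrite -setUA -Axe setD1K.
Qed.

Lemma rep3_eq v C X W C' X' W' : rep3 v C X W -> sym3 C' ->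
  (forall x y z, x != y -> x != z -> y != z -> C' x y z = C x y z) ->
  (forall i j p q, X' (pe i p) (pe j q) = X (pe i p) (pe j q)) ->
  (forall i j p q, W' (pe i p) (pe j q) = W (pe i p) (pe j q)) ->
  rep3 v C' X' W'.
Proof.
move=> rv sC' CC XX WW.
apply: (rep3_gauge (x := fun _ _ _ => 0) (y := fun _ _ _ => 0) (c := fun _ _ => 0)
  (s := fun _ _ => 0)) rv => //.
- by move=> *; apply: CC.
- by move=> i j k p q *; rewrite CC ?edgeE ?eqxx //; field.
- by move=> i j k p q ij *; rewrite CC ?edgeE ?(negbTE ij) //; field.
- by move=> *; rewrite XX; ring.
- by move=> *; rewrite !XX; ring.
- by move=> *; rewrite !WW; ring.
- by move=> *; ring.
Qed.

Lemma fun3_of_sym c : sym3 (fun3_of c).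
Proof.
by split=> x y z; rewrite /fun3_of; [rewrite (setUC [set x]) | rewrite setUAC].
Qed.

Lemma hbeta3 : hbeta R M 3 = #|index3|.
Proof.
rewrite /hbeta.
apply: (@dimv_rep _ _ _ _ _ (fun v c => rep3 v (fun3_of c) (cross_of c) (twist_of c))).
- by move=> c _; apply: rep3_exists => //; apply: fun3_of_sym.
- move=> v /(Cbeta3_rep t_gt1)[C0 [X0 [W0 /(rep3_normal t_gt5)[C [X [W [rv nv]]]]]]].
  have [_ sC _ _ _] := rv; have [n1 n2 n3 n4 n5] := nv.
  exists (fun s : I3 => match s with
    | inl (inl A) => if (#|A| == 3) && (A \notin dropped) then triple_val C A else 0
    | inl (inr (a, b)) => X (pe a.1 a.2) (pe b.1 b.2)
    | inr (a, b) => W (pe a.1 a.2) (pe b.1 b.2)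
    end).
    case=> [[A|[[i p] [j q]]]|[[i p] [j q]]]; rewrite inE /=.
    + by move/negbTE->.
    + case: eqVneq => [<-|ij]; first by rewrite -leqNgt => /n3.
      by rewrite negbK => /eqP->; apply: n2.
    + rewrite negb_and negbK; have [->|ij _] := eqVneq i (nxt j); last exact: n4.
      by move=> /eqP->; apply: n5.
  apply: (rep3_eq rv); first exact: fun3_of_sym.
  + move=> x y z xy xz yz; rewrite /fun3_of card_set3 //=.
    case: ifPn => [_|]; first by rewrite triple_valE.
    rewrite negbK => /imsetP[[i p] _ /= Axyz]; rewrite -(triple_valE sC xy xz yz) Axyz.
    by rewrite triple_valE ?eps_pe ?n1 // edgeE (negbTE (nxt_neq i)).
  + by move=> *; rewrite /cross_of path_funE.
  + by move=> *; rewrite /twist_of path_funE.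
- by move=> v w c; apply: rep3_unique.
- apply: (rep3_eq (rep3_0 t R)) => //.
  + by move=> *; rewrite /cross_of path_funE.
  + by move=> *; rewrite /twist_of path_funE.
- move=> a v w c d rv rw; apply: (rep3_eq (rep3_lin a rv rw)).
  + exact: fun3_of_sym.
  + by [].
  + by move=> *; rewrite /cross_of !path_funE.
  + by move=> *; rewrite /twist_of !path_funE.
move=> c c0 rc; have nc : normal3 t_gt5 (fun3_of c) (cross_of c) (twist_of c).
  split.
  - move=> i p; apply: c0; rewrite inE negb_and negbK; apply/orP; right.
    by apply/imsetP; exists (i, p).
  - by move=> i j p ij; rewrite /cross_of path_funE c0 // inE /= (negbTE ij) ?eqxx.
  - by move=> i p q qp; rewrite /cross_of path_funE c0 // inE /= ?eqxx -leqNgt.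
  - by move=> i j p q ij; rewrite /twist_of path_funE c0 // inE /= (negbTE ij).
  - by move=> j q; rewrite /twist_of path_funE c0 // inE /= ?eqxx ?andbF.
have [C0 X0 W0] := rep3_inj rc nc.
case=> [[A|[[i p] [j q]]]|[[i p] [j q]]].
- have [/eqP/card3_set[x [y [z [xy xz yz ->]]]]|A3] := boolP (#|A| == 3);
  first exact: C0.
  by apply: c0; rewrite inE (negbTE A3).
- by have := X0 i j p q; rewrite /cross_of path_funE.
- by have := W0 i j p q; rewrite /twist_of path_funE.
Qed.

End Dimensions.

Section Formulas.
Variables (t : nat) (R : realFieldType).
Hypothesis t_gt5 : (5 < t)%N.
Notation h k := (hbeta R (theta_matroid t) k).

Lemma bin2_double n : (2 * 'C(n, 2) = n * n.-1)%N.
Proof. by rewrite mulnC -[2%N]/(2`!) bin_ffact ffactnS ffactn1. Qed.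

Lemma bin3_six n : (6 * 'C(n, 3) = n * (n.-1 * n.-2))%N.
Proof. by rewrite mulnC -[6%N]/(3`!) bin_ffact !ffactnS ffactn0 muln1. Qed.

Lemma hbeta2_double : (2 * h 2 + 6 = 9 * t ^ 2 + 9 * t)%N.
Proof.
rewrite hbeta2 // mulnDr bin2_double; nia.
Qed.

Lemma hbeta3_double : (2 * h 3 + 28 * t = 9 * t ^ 3 + 21 * t ^ 2)%N.
Proof.
have := card_index3 t_gt5; rewrite -(hbeta3 R t_gt5).
have := bin3_six (3 * t + 1); have := bin2_double t.
case: t t_gt5 => // u _; rewrite addn1 /=; nia.
Qed.

End Formulas.

Lemma nat_of_addN (a b : N) : nat_of_bin (N.add a b) = (a + b)%N.
Proof. by case: a b => [|p] [|q] //=; rewrite ?addn0 // nat_of_add_pos. Qed.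

Lemma nat_of_mulN (a b : N) : nat_of_bin (N.mul a b) = (a * b)%N.
Proof. by case: a b => [|p] [|q] //=; rewrite ?muln0 // nat_of_mul_pos. Qed.

Unset Implicit Arguments.

Theorem theorem4 (R : realType) :
  (forall t : nat, (6 <= t)%N ->
    let h k := hbeta R (theta_matroid t) k in
    let T : rat := t%:R in
    [/\ [/\ h 0%N = 1%N,
            h 1%N = (3 * t + 1)%N,
            (h 2%N)%:R = (9 * T ^+ 2 + 9 * T - 6) / 2 :> rat &
            (h 3%N)%:R = (9 * T ^+ 3 + 21 * T ^+ 2 - 28 * T) / 2 :> rat],
        (h 2%N)%:R ^+ 2 - (h 1%N)%:R * (h 3%N)%:R =
          (27 * T ^+ 4 + 18 * T ^+ 3 + 99 * T ^+ 2 - 52 * T + 36) / 4 :> rat &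
        0 < (27 * T ^+ 4 + 18 * T ^+ 3 + 99 * T ^+ 2 - 52 * T + 36) / 4 :> rat])
  /\
  (let h k := hbeta R (theta_matroid 26) k in
    [/\ h 0%N = 1%N, h 1%N = 79%N, h 2%N = 3156%num, h 3%N = 85826%num &
        (h 2%N)%:R ^+ 2 - (h 1%N)%:R * (h 3%N)%:R = (3180082%num)%:R :> rat]).
Proof.
split=> [t t6|] h.
  move=> T.
  have h1 : h 1 = (3 * t + 1)%N by apply: hbeta1.
  have h2 : (h 2)%:R = (9 * T ^+ 2 + 9 * T - 6) / 2 :> rat.
    have /(congr1 (fun n : nat => n%:R : rat)) := hbeta2_double R t6.
    by rewrite -/(h 2) !(natrX, natrM, natrD) -/T; lra.
  have h3 : (h 3)%:R = (9 * T ^+ 3 + 21 * T ^+ 2 - 28 * T) / 2 :> rat.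
    have /(congr1 (fun n : nat => n%:R : rat)) := hbeta3_double R t6.
    by rewrite -/(h 3) !(natrX, natrM, natrD) -/T; lra.
  split; first by split=> //; apply: hbeta0; apply: ltnW.
    by rewrite h2 h3 h1 natrD natrM -/T; field.
  have T6 : 6 <= T by rewrite /T (ler_nat _ 6).
  nra.
have h0 : h 0%N = 1%N by apply: hbeta0.
have h1 : h 1%N = 79%N by apply: (hbeta1 R (isT : 5 < 26)%N).
have h2 : h 2%N = 3156%num.
  have := hbeta2_double R (isT : 5 < 26)%N; rewrite -/(h 2%N); lia.
have h3 : h 3%N = 85826%num.
  have := hbeta3_double R (isT : 5 < 26)%N; rewrite -/(h 3%N).
  (* large numerals are evaluated in binary *)
  have -> : (9 * 26 ^ 3 + 21 * 26 ^ 2 = 2 * 85826%num + 28 * 26)%N.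
    have /(congr1 nat_of_bin) :
        N.add (N.mul 9 (N.mul 26 (N.mul 26 26))) (N.mul 21 (N.mul 26 26)) =
        N.add (N.mul 2 85826) (N.mul 28 26) by [].
    by rewrite !nat_of_addN !nat_of_mulN !expnS expn0 !muln1; apply.
  by move/eqP; rewrite eqn_add2r eqn_pmul2l // => /eqP.
split; [exact: h0 | exact: h1 | exact: h2 | exact: h3 |]; rewrite h1 h2 h3.
have sub_sqr (a b c d : nat) : (a * a = b * c + d)%N ->
    a%:R ^+ 2 - b%:R * c%:R = d%:R :> rat.
  by move=> E; rewrite -natrX -mulnn E natrD natrM addrC addKr.
rewrite -[79%N]/(nat_of_bin 79); apply: sub_sqr; rewrite -!nat_of_mulN -nat_of_addN.
by congr nat_of_bin.
Qed.
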